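(* Let $\pi\colon X_2\to X_1$ be a modification of normal projective varieties with finitely generated divisor class groups and let $C\subseteq X_1$ be the center of $\pi$. Set $K_i:=\mathrm{Cl}(X_i)$, $R_i:=\mathcal{R}(X_i)$ and identify $U:=X_2\setminus\pi^{-1}(C)$ with $X_1\setminus C$. Then there are canonical surjective push forward maps $$\tilde\pi_*\colon K_2\to K_1,\ [D]\mapsto[\pi_*D],\qquad \pi_*\colon R_2\to R_1,\ (R_2)_{[D]}\ni f\mapsto f_{|U}\in(R_1)_{\tilde\pi_*[D]}.$$ Now suppose that $\mathcal{R}(X_2)$ is finitely generated, let $E_1,\ldots,E_l\subseteq X_2$ denote the exceptional prime divisors and $f_1,\ldots,f_l\in\mathcal{R}(X_2)$ the corresponding canonical sections. Then there is a commutative diagram of morphisms of graded algebras, i.e. $\pi_*=\psi\circ\lambda$ with $$\lambda\colon R_2\to R_2/\langle f_i-1;\ 1\le i\le l\rangle,\qquad \psi\colon R_2/\langle f_i-1;\ 1\le i\le l\rangle\to R_1,$$ where $\lambda$ is the canonical projection, with the projection $\tilde\lambda\colon K_2\to K_2/\langle\deg(f_1),\ldots,\deg(f_l)\rangle$ as accompanying homomorphism, and the induced morphism $\psi$ is an isomorphism.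
   Context: The ground field $\mathbb{K}$ is algebraically closed of characteristic zero. A modification is a proper birational morphism of normal projective varieties; its center $C\subseteq X_1$ is the closed subset (of codimension at least two) over whose complement $\pi$ is an isomorphism. The Cox ring of a normal complete variety $X$ with finitely generated divisor class group is the $\mathrm{Cl}(X)$-graded ring $\mathcal{R}(X)=\bigoplus_{[D]\in\mathrm{Cl}(X)}\Gamma(X,\mathcal{O}_X(D))$ (standard construction, also for class groups with torsion). The canonical section of a prime divisor $E$ is the homogeneous element $1_E\in\mathcal{R}(X)_{[E]}$ with divisor $E$. A morphism of graded algebras $A=\bigoplus_MA_m$ and $B=\bigoplus_NB_n$ is an algebra homomorphism $\psi\colon A\to B$ together with an accompanying homomorphism $\tilde\psi\colon M\to N$ of the grading groups such that $\psi(A_m)\subseteq B_{\tilde\psi(m)}$ for all $m\in M$. *)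

(* Defs.v *)
From HB Require Import structures.
From mathcomp Require Import all_boot all_order all_algebra.
From mathcomp Require Import generic_quotient ring_quotient fraction.
From mathcomp Require Import boolp classical_sets.
From mathcomp Require Import freeg mpoly.

Set Implicit Arguments.
Unset Strict Implicit.
Unset Printing Implicit Defensive.

Import GRing.Theory.
Local Open Scope ring_scope.
Local Open Scope classical_set_scope.
Local Open Scope quotient_scope.

Section SubgroupQuotient.
Variables (M : zmodType) (T : set M).

Definition subgroup_gen : pred M := fun x =>
  `[< exists s : seq (int * M),
        (forall c, c \in s -> T c.2) /\ x = \sum_(c <- s) c.2 *~ c.1 >].

Lemma subgroup_gen_closed : zmod_closed subgroup_gen.
Proof.
split=> [|x y /asboolP[s [sT ->]] /asboolP[t [tT ->]]]; apply/asboolP.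
  by exists [::]; rewrite big_nil.
exists (s ++ [seq (- c.1, c.2) | c <- t]); split.
  by move=> c; rewrite mem_cat => /orP[/sT //|/mapP[d /tT Td ->]].
rewrite big_cat big_map -sumrN; congr (_ + _).
by apply: eq_bigr => c _; rewrite mulrNz.
Qed.

HB.instance Definition _ :=
  GRing.isZmodClosed.Build M subgroup_gen subgroup_gen_closed.

Definition subgroup_gen_zmod : zmodClosed M :=
  GRing.ZmodClosed.clone M subgroup_gen _.

Definition zquot : Type := Quotient.quot subgroup_gen_zmod.
HB.instance Definition _ := GRing.Zmodule.on zquot.

Definition zproj : M -> zquot := \pi_(Quotient.quot subgroup_gen_zmod).

Lemma zproj_is_zmod_morphism : zmod_morphism zproj.
Proof. exact: raddfB. Qed.
HB.instance Definition _ :=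
  GRing.isZmodMorphism.Build M zquot zproj zproj_is_zmod_morphism.

End SubgroupQuotient.

Section IdealQuotient.
Variables (A : comPzRingType) (T : set A).

Definition ideal_gen : pred A := fun x =>
  `[< exists s : seq (A * A),
        (forall c, c \in s -> T c.2) /\ x = \sum_(c <- s) c.1 * c.2 >].

Lemma ideal_genM a x : x \in ideal_gen -> a * x \in ideal_gen.
Proof.
move=> /asboolP[s [sT ->]]; apply/asboolP.
exists [seq (a * c.1, c.2) | c <- s]; split=> [c /mapP[d /sT Td ->] //|].
by rewrite big_map mulr_sumr; apply: eq_bigr => c _; rewrite mulrA.
Qed.

Lemma ideal_gen_closed : zmod_closed ideal_gen.
Proof.
split=> [|x y]; first by apply/asboolP; exists [::]; rewrite big_nil.
move=> /asboolP[s [sT ->]] /(ideal_genM (-1)) /asboolP[t [tT yE]].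
apply/asboolP; exists (s ++ t); split.
  by move=> c; rewrite mem_cat => /orP[/sT|/tT].
by rewrite big_cat -[- y]mulN1r yE.
Qed.

HB.instance Definition _ :=
  GRing.isZmodClosed.Build A ideal_gen ideal_gen_closed.

Definition ideal_gen_zmod : zmodClosed A :=
  GRing.ZmodClosed.clone A ideal_gen _.

(* [ring_quotient] only equips quotients by proper ideals with a ring
   structure; here the zero ring is allowed. *)
Definition rquot : Type := Quotient.quot ideal_gen_zmod.
HB.instance Definition _ := GRing.Zmodule.on rquot.

Definition rproj : A -> rquot := \pi_(Quotient.quot ideal_gen_zmod).

Lemma rproj_is_zmod_morphism : zmod_morphism rproj.
Proof. exact: raddfB. Qed.
HB.instance Definition _ :=
  GRing.isZmodMorphism.Build A rquot rproj rproj_is_zmod_morphism.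

Lemma rproj_eq x y : (rproj x == rproj y) = (x - y \in ideal_gen).
Proof. exact: eqmodE. Qed.

Definition rquot_repr (x : rquot) : A :=
  repr (x : Quotient.quot ideal_gen_zmod).

Lemma rquot_reprK : cancel rquot_repr rproj.
Proof. by move=> x; exact: reprK. Qed.

Definition rquot_mul (x y : rquot) : rquot :=
  rproj (rquot_repr x * rquot_repr y).

Lemma rproj_mul : {morph rproj : x y / x * y >-> rquot_mul x y}.
Proof.
move=> x y; apply/eqP; rewrite rproj_eq.
set x' := rquot_repr (rproj x); set y' := rquot_repr (rproj y).
have xI : x - x' \in ideal_gen.
  by rewrite -rproj_eq rquot_reprK.
have yI : y - y' \in ideal_gen.
  by rewrite -rproj_eq rquot_reprK.
rewrite -[_ - _]/(x * y - x' * y').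
have -> : x * y - x' * y' = y * (x - x') + x' * (y - y').
  by rewrite !mulrBr (mulrC y x) (mulrC y x') addrA addrNK.
by rewrite rpredD ?ideal_genM.
Qed.

Lemma rquot_mulA : associative rquot_mul.
Proof.
move=> x y z; rewrite -(rquot_reprK x) -(rquot_reprK y) -(rquot_reprK z).
by rewrite -!rproj_mul mulrA.
Qed.

Lemma rquot_mulC : commutative rquot_mul.
Proof. by move=> x y; rewrite /rquot_mul mulrC. Qed.

Lemma rquot_mul1 : left_id (rproj 1) rquot_mul.
Proof. by move=> x; rewrite -(rquot_reprK x) -rproj_mul mul1r. Qed.

Lemma rquot_mulDl : left_distributive rquot_mul +%R.
Proof.
move=> x y z; rewrite -(rquot_reprK x) -(rquot_reprK y) -(rquot_reprK z).
by rewrite -raddfD -!rproj_mul mulrDl raddfD.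
Qed.

HB.instance Definition _ := GRing.Zmodule_isComPzRing.Build rquot
  rquot_mulA rquot_mulC rquot_mul1 rquot_mulDl.

Lemma rproj_is_monoid_morphism : monoid_morphism rproj.
Proof. by split=> //; exact: rproj_mul. Qed.
HB.instance Definition _ :=
  GRing.isMonoidMorphism.Build A rquot rproj rproj_is_monoid_morphism.

End IdealQuotient.

Section GroupAlgebra.
Variables (F : fieldType) (M : zmodType).

Definition group_alg : Type := {freeg M / F}.
HB.instance Definition _ := GRing.Lmodule.on group_alg.

Definition gmon (a : F) (m : M) : group_alg := << a *g m >>.
Definition gcoef (m : M) (f : group_alg) : F := coeff m f.

Definition group_alg_mul (f g : group_alg) : group_alg :=
  fglift (fun m => fglift (fun n => gmon 1 (m + n)) g : group_alg) f.
Definition group_alg_one : group_alg := gmon 1 0.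

Lemma group_alg_ind (P : group_alg -> Prop) :
  P 0 -> (forall f g, P f -> P g -> P (f + g)) -> (forall a m, P (gmon a m)) ->
  forall f, P f.
Proof.
move=> P0 PD Pm f; rewrite -[f]freeg_sumE.
by elim/big_ind: _ => // m _; exact: Pm.
Qed.

Lemma gcoef_gmon a m n : gcoef n (gmon a m) = if m == n then a else 0.
Proof. by rewrite /gcoef coeffU; case: eqP => _; rewrite (mulr1, mulr0). Qed.

Lemma scale_gmon c a m : c *: gmon a m = gmon (c * a) m.
Proof. by apply/eqP/freeg_eqP => n; rewrite coeffZ !coeffU mulrA. Qed.

Lemma group_alg_mulDl : left_distributive group_alg_mul +%R.
Proof.
move=> f1 f2 g; rewrite /group_alg_mul; set h := fun m => _.
have hB := lift_is_additive h.
have h0 : fglift h 0 = 0 by rewrite -[X in fglift _ X](subrr 0) hB subrr.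
by rewrite -{1}[f2]opprK hB -(add0r (- f2)) hB h0 sub0r opprK.
Qed.

Lemma group_alg_mul0l g : group_alg_mul 0 g = 0.
Proof.
by apply: (addrI (group_alg_mul 0 g)); rewrite -group_alg_mulDl !addr0.
Qed.

Lemma group_alg_mul_gmonl a m g :
  group_alg_mul (gmon a m) g = a *: (fglift (fun n => gmon 1 (m + n)) g : group_alg).
Proof. exact: liftU. Qed.

Lemma group_alg_mul_gmon a b m n :
  group_alg_mul (gmon a m) (gmon b n) = gmon (a * b) (m + n).
Proof. by rewrite group_alg_mul_gmonl liftU !scale_gmon mulr1. Qed.

Lemma group_alg_mul0r f : group_alg_mul f 0 = 0.
Proof.
elim/group_alg_ind: f => [|f g Hf Hg|a m]; first exact: group_alg_mul0l.
  by rewrite group_alg_mulDl Hf Hg addr0.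
rewrite group_alg_mul_gmonl -[X in fglift _ X](subrr 0).
by rewrite (lift_is_additive (fun n => gmon 1 (m + n))) subrr scaler0.
Qed.

Lemma group_alg_mulDr : right_distributive group_alg_mul +%R.
Proof.
move=> f g1 g2; elim/group_alg_ind: f => [|f1 f2 H1 H2|a m].
- by rewrite !group_alg_mul0l addr0.
- by rewrite !group_alg_mulDl H1 H2 addrACA.
rewrite !group_alg_mul_gmonl -scalerDr; congr (_ *: _).
set h := fun n => _; have hB := lift_is_additive h.
have h0 : fglift h 0 = 0 by rewrite -[X in fglift _ X](subrr 0) hB subrr.
by rewrite -{1}[g2]opprK hB -(add0r (- g2)) hB h0 sub0r opprK.
Qed.

Lemma group_alg_mulC : commutative group_alg_mul.
Proof.
move=> f g; elim/group_alg_ind: f => [|f1 f2 H1 H2|a m].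
- by rewrite group_alg_mul0l group_alg_mul0r.
- by rewrite group_alg_mulDl group_alg_mulDr H1 H2.
elim/group_alg_ind: g => [|g1 g2 H1 H2|b n].
- by rewrite group_alg_mul0l group_alg_mul0r.
- by rewrite group_alg_mulDl group_alg_mulDr H1 H2.
by rewrite !group_alg_mul_gmon mulrC addrC.
Qed.

Lemma group_alg_mulA : associative group_alg_mul.
Proof.
move=> f g h; elim/group_alg_ind: f => [|f1 f2 H1 H2|a m].
- by rewrite !group_alg_mul0l.
- by rewrite !group_alg_mulDl H1 H2.
elim/group_alg_ind: g => [|g1 g2 H1 H2|b n].
- by rewrite !(group_alg_mul0l, group_alg_mul0r).
- by rewrite !(group_alg_mulDl, group_alg_mulDr) H1 H2.
elim/group_alg_ind: h => [|h1 h2 H1 H2|c p].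
- by rewrite !group_alg_mul0r.
- by rewrite !group_alg_mulDr H1 H2.
by rewrite !group_alg_mul_gmon mulrA addrA.
Qed.

Lemma group_alg_mul1 : left_id group_alg_one group_alg_mul.
Proof.
elim/group_alg_ind=> [|f g Hf Hg|a m]; first exact: group_alg_mul0r.
  by rewrite group_alg_mulDr Hf Hg.
by rewrite group_alg_mul_gmon mul1r add0r.
Qed.

Lemma group_alg_one_neq0 : group_alg_one != 0.
Proof. by rewrite freegU_eq0 oner_eq0. Qed.

HB.instance Definition _ := GRing.Zmodule_isComNzRing.Build group_alg
  group_alg_mulA group_alg_mulC group_alg_mul1 group_alg_mulDl group_alg_one_neq0.

End GroupAlgebra.

Section ProjectiveSpace.
Variables (K : closedFieldType) (n : nat).

(* The points of P^n(K) are the lines through the origin of K^(n+1). *)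
Definition pspace : Type := {L : {vspace 'rV[K]_n.+1} | \dim L == 1%N}.

(* A choice of homogeneous coordinates. *)
Definition hcoord (x : pspace) (i : 'I_n.+1) : K := vpick (val x) 0 i.

Definition peval (p : {mpoly K[n.+1]}) (x : pspace) : K := p.@[hcoord x].

Definition zclosed (Z : set pspace) : Prop :=
  exists T : set {mpoly K[n.+1]},
    (forall p, T p -> exists d, p \is d.-homog) /\
    Z = [set x | forall p, T p -> peval p x = 0].

Definition zopen (W : set pspace) : Prop := zclosed (~` W).

Definition zclosure (A : set pspace) : set pspace :=
  [set x | forall Z, zclosed Z -> A `<=` Z -> Z x].

Definition irred_closed (Z : set pspace) : Prop :=
  [/\ zclosed Z, Z !=set0 &
      forall Z1 Z2, zclosed Z1 -> zclosed Z2 -> Z `<=` Z1 `|` Z2 ->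
        Z `<=` Z1 \/ Z `<=` Z2].

Record projvar := ProjVar {
  pts : set pspace;
  pts_irred : irred_closed pts }.

Lemma memv_pspace (x : pspace) (v : 'rV[K]_n.+1) :
  v \in val x -> exists t, forall i, v 0 i = t * hcoord x i.
Proof.
move=> vx; have px : vpick (val x) != 0.
  by rewrite vpick0 -dimv_eq0 (eqP (valP x)).
have xE : val x = <[vpick (val x)]>%VS.
  apply/esym/eqP; rewrite eqEdim -memvE memv_pick (eqP (valP x)).
  by rewrite dim_vline px.
move: vx; rewrite xE => /vlineP[t ->]; exists t => i.
by rewrite mxE.
Qed.

Lemma homog_scale d (p : {mpoly K[n.+1]}) t v : p \is d.-homog ->
  p.@[fun i => t * v i] = t ^+ d * p.@[v].
Proof.
move=> /dhomogP ph; rewrite !mevalE mulr_sumr; apply: eq_big_seq => m mp.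
rewrite mulrCA; congr (_ * _).
have -> : d = (\sum_i m i)%N by rewrite -mdegE -(ph m mp).
rewrite -prodrXr -big_split /=.
by apply: eq_bigr => i _; exact: exprMn.
Qed.

Lemma zclosed_zeros d (p : {mpoly K[n.+1]}) :
  p \is d.-homog -> zclosed [set x | peval p x = 0].
Proof.
move=> ph; exists [set p]; split=> [q ->|]; first by exists d.
by apply/seteqP; split=> x /= => [px q -> //|]; apply.
Qed.

Lemma irred_nonvanish Z d e (p q : {mpoly K[n.+1]}) : irred_closed Z ->
  p \is d.-homog -> q \is e.-homog ->
  (exists2 x, Z x & peval p x != 0) -> (exists2 x, Z x & peval q x != 0) ->
  exists2 x, Z x & (peval p x != 0) && (peval q x != 0).
Proof.
move=> [_ _ Zirr] ph qh [x Zx px] [y Zy qy]; apply: contrapT => nex.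
have [|/(_ x Zx) /eqP|/(_ y Zy) /eqP] :=
  Zirr _ _ (zclosed_zeros ph) (zclosed_zeros qh).
- move=> z Zz; apply: contrapT => /not_orP[/eqP pz /eqP qz].
  by apply: nex; exists z => //; apply/andP.
- by rewrite (negPf px).
- by rewrite (negPf qy).
Qed.

End ProjectiveSpace.

Section FunctionField.
Variables (K : closedFieldType) (n : nat) (X : projvar K n).

(* The polynomials vanishing on the affine cone over [X]. *)
Definition vanish : pred {mpoly K[n.+1]} := fun p =>
  `[< forall (x : pspace K n) (v : 'rV[K]_n.+1),
        pts X x -> v \in val x -> p.@[fun i => v 0 i] = 0 >].

Lemma vanish_idealr : idealr_closed vanish.
Proof.
have [_ [x Xx] _] := pts_irred X.
split=> [||a p q /asboolP vp /asboolP vq].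
  by apply/asboolP => *; rewrite meval0.
  apply/negP => /asboolP /(_ x 0 Xx (mem0v _)) /eqP.
  by rewrite meval1 oner_eq0.
apply/asboolP => y v Xy yv.
by rewrite mevalD mevalM (vp y) // (vq y) // mulr0 addr0.
Qed.

HB.instance Definition _ := isIdealr.Build _ vanish vanish_idealr.

Lemma notin_vanish p : p \notin vanish ->
  exists d, exists2 x, pts X x & peval (pihomog mdeg d p) x != 0.
Proof.
apply: contraNP => /forallNP vp; apply/asboolP => x v Xx xv.
have [t vE] := memv_pspace xv; rewrite (meval_eq _ vE).
rewrite [p](@pihomog_partitionE _ _ mdeg (msize p)) //.
rewrite raddf_sum big1 //= => d _; rewrite (homog_scale _ _ (pihomogP _ _ _)).
have /forall2NP/(_ x)[//|/negP/negPn/eqP] := vp d.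
by rewrite /peval => ->; rewrite mulr0.
Qed.

Lemma notin_vanishP d p : p \is d.-homog ->
  p \notin vanish <-> exists2 x, pts X x & peval p x != 0.
Proof.
move=> ph; split=> [/notin_vanish[e [x Xx]]|[x Xx]].
  have [->|neq] := eqVneq e d; first by rewrite pihomog_dE //; exists x.
  by rewrite (@pihomog_ne0 _ _ _ d) 1?eq_sym // /peval meval0 eqxx.
apply: contra => /asboolP /(_ x (vpick (val x)) Xx) pv.
by rewrite /peval [_.@[_]]pv // memv_pick.
Qed.

Lemma vanish_prime : prime_idealr_closed vanish.
Proof.
move=> p q; apply: contraTT; rewrite negb_or => /andP[].
move=> /notin_vanish[d pd] /notin_vanish[e qe].
have [x Xx /andP[px qx]] :=
  irred_nonvanish (pts_irred X) (pihomogP _ _ _) (pihomogP _ _ _) pd qe.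
pose cone (f : {mpoly K[n.+1]}) : {poly K} :=
  \poly_(i < msize f) peval (pihomog mdeg i f) x.
have coneE f t : (cone f).[t] = f.@[fun i => t * hcoord x i].
  rewrite horner_poly [in RHS](@pihomog_partitionE _ _ mdeg (msize f) f) //.
  rewrite raddf_sum /=; apply: eq_bigr => i _.
  by rewrite (homog_scale _ _ (pihomogP _ _ _)) mulrC.
have cone_neq0 f i : peval (pihomog mdeg i f) x != 0 -> cone f != 0.
  move=> fx; have ltif : (i < msize f)%N.
    rewrite ltnNge; apply: contra fx => lefi.
    rewrite pihomogE big_seq_cond big1 ?/peval ?meval0 // => m /andP[mf /eqP mi].
    by have := msize_mdeg_lt mf; rewrite mi ltnNge lefi.
  by apply: contra fx => /eqP/polyP/(_ i); rewrite coef_poly ltif coef0 => ->.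
have /closed_nonrootP[t] : cone p * cone q != 0.
  by apply: mulf_neq0; [exact: (cone_neq0 _ _ px)|exact: (cone_neq0 _ _ qx)].
rewrite rootE hornerM !coneE; apply: contra => /asboolP vpq.
have tx : t *: vpick (val x) \in val x by rewrite memvZ ?memv_pick.
have vE i : (t *: vpick (val x)) 0 i = t * hcoord x i by rewrite mxE.
by have := vpq _ _ Xx tx; rewrite mevalM !(meval_eq _ vE) => ->.
Qed.

HB.instance Definition _ := isPrimeIdealrClosed.Build _ vanish vanish_prime.

Definition vanishing_ideal : prime_idealr {mpoly K[n.+1]} :=
  PrimeIdealr.clone _ vanish _.

Definition coordring : Type := {ideal_quot vanishing_ideal}.
HB.instance Definition _ := GRing.ComNzRing.on coordring.

Definition coord_unit : pred coordring := fun a => `[< exists b, b * a = 1 >].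
Definition coord_inv (a : coordring) : coordring :=
  if pselect (exists b, b * a = 1) is left e then projT1 (cid e) else a.

Lemma coord_mulV : {in coord_unit, left_inverse 1 coord_inv *%R}.
Proof.
move=> a /asboolP ua; rewrite /coord_inv; case: pselect => // e.
by case: (cid e).
Qed.

Lemma coord_unitP (a b : coordring) : b * a = 1 -> coord_unit a.
Proof. by move=> ba; apply/asboolP; exists b. Qed.

Lemma coord_inv_out : {in [predC coord_unit], coord_inv =1 id}.
Proof.
move=> a /negP ua; rewrite /coord_inv; case: pselect => // e.
by case: ua; apply/asboolP.
Qed.

HB.instance Definition _ := GRing.ComNzRing_hasMulInverse.Build coordring
  coord_mulV coord_unitP coord_inv_out.

Lemma coord_integral (a b : coordring) : a * b = 0 -> (a == 0) || (b == 0).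
Proof. exact: Quotient.rquot_IdomainAxiom. Qed.
HB.instance Definition _ :=
  GRing.ComUnitRing_isIntegral.Build coordring coord_integral.

Definition polyfrac (p : {mpoly K[n.+1]}) : {fraction coordring} :=
  FracField.tofrac (\pi_({ideal_quot vanishing_ideal}) p : coordring).

(* The function field: quotients of homogeneous elements of equal degree. *)
Definition is_ratfun : pred {fraction coordring} := fun a =>
  `[< exists d f g, [/\ f \is d.-homog, g \is d.-homog, g \notin vanish &
        a = polyfrac f / polyfrac g] >].

Lemma polyfracB : {morph polyfrac : p q / p - q}.
Proof. by move=> p q; rewrite /polyfrac -tofracB -rmorphB. Qed.
Lemma polyfracD : {morph polyfrac : p q / p + q}.
Proof. by move=> p q; rewrite /polyfrac -tofracD -rmorphD. Qed.
Lemma polyfracM : {morph polyfrac : p q / p * q}.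
Proof. by move=> p q; rewrite /polyfrac -tofracM -rmorphM. Qed.
Lemma polyfrac_eq0 p : (polyfrac p == 0) = (p \in vanish).
Proof.
rewrite /polyfrac tofrac_eq0 -[X in _ == X](rmorph0 \pi_({ideal_quot vanishing_ideal})).
by rewrite -[_ == _]/(_ == _ %[mod {ideal_quot vanishing_ideal}])
  -Quotient.idealrBE subr0.
Qed.

Lemma is_ratfun_closed : GRing.divring_closed is_ratfun.
Proof.
split.
- apply/asboolP; exists 0%N, 1, 1.
  have h1 : (1 : {mpoly K[n.+1]}) \is 0.-homog by exact: dhomog1.
  split; rewrite ?divff ?polyfrac_eq0 //; exact: (idealr_closed_nontrivial vanish_idealr).1.
- move=> a b /asboolP[d [f [g [fh gh gX ->]]]] /asboolP[e [f' [g' [fh' gh' gX' ->]]]].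
  apply/asboolP; exists (d + e)%N, (f * g' - f' * g), (g * g'); split.
  + by apply: rpredB; [|rewrite addnC]; exact: dhomogM.
  + exact: dhomogM.
  + by rewrite -polyfrac_eq0 polyfracM mulf_neq0 ?polyfrac_eq0.
  rewrite polyfracB !polyfracM -mulNr addf_div ?polyfrac_eq0 //.
  by rewrite mulNr.
- move=> a b /asboolP[d [f [g [fh gh gX ->]]]] /asboolP[e [f' [g' [fh' gh' gX' ->]]]].
  have [f'X|f'X] := boolP (f' \in vanish).
    apply/asboolP; exists 0%N, 0, 1; split; rewrite ?dhomog0 ?dhomog1 //.
      exact: (idealr_closed_nontrivial vanish_idealr).1.
    by move: f'X; rewrite -polyfrac_eq0 => /eqP->; rewrite mul0r invr0 mulr0
      (_ : polyfrac 0 = 0) ?mul0r //; apply/eqP; rewrite polyfrac_eq0 rpred0.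
  apply/asboolP; exists (d + e)%N, (f * g'), (g * f'); split.
  + exact: dhomogM.
  + exact: dhomogM.
  + by rewrite -polyfrac_eq0 polyfracM mulf_neq0 ?polyfrac_eq0.
  by rewrite !polyfracM invf_div mulf_div.
Qed.

HB.instance Definition _ :=
  GRing.isDivringClosed.Build _ is_ratfun is_ratfun_closed.

Definition funfield : Type := {a : {fraction coordring} | is_ratfun a}.
HB.instance Definition _ := [isSub of funfield for @sval _ _].
HB.instance Definition _ := [Choice of funfield by <:].
HB.instance Definition _ := [SubChoice_isSubComNzRing of funfield by <:].

Lemma ratfun_valD (a b : funfield) : val (a + b) = val a + val b.
Proof. by []. Qed.
Lemma ratfun_valM (a b : funfield) : val (a * b) = val a * val b.
Proof. by []. Qed.

Lemma is_ratfunV a : is_ratfun a -> is_ratfun a^-1.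
Proof. by move=> ra; rewrite -[is_ratfun _]/(_ \in is_ratfun) rpredV. Qed.

Definition funfield_inv (a : funfield) : funfield :=
  exist (fun b => is_ratfun b) (val a)^-1 (is_ratfunV (valP a)).

Lemma funfield_mulV (a : funfield) : a != 0 -> funfield_inv a * a = 1.
Proof.
move=> a0; apply: val_inj; rewrite rmorphM rmorph1 /= mulVf //.
Qed.

Lemma funfield_inv0 : funfield_inv 0 = 0.
Proof. by apply: val_inj; rewrite /= invr0. Qed.

HB.instance Definition _ :=
  GRing.ComNzRing_isField.Build funfield funfield_mulV funfield_inv0.

Lemma homogC (c : K) : (c%:MP : {mpoly K[n.+1]}) \is 0.-homog.
Proof. by rewrite -[c%:MP]alg_mpolyC; apply: dhomogZ; exact: dhomog1. Qed.

Lemma polyfrac1 : polyfrac 1 = 1.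
Proof. by rewrite /polyfrac !rmorph1. Qed.

Lemma constf_ratfun (c : K) : is_ratfun (polyfrac c%:MP).
Proof.
apply/asboolP; exists 0%N, c%:MP, 1; split; first exact: homogC.
- exact: homogC.
- exact: (idealr_closed_nontrivial vanish_idealr).1.
by rewrite polyfrac1 divr1.
Qed.

Definition constf (c : K) : funfield :=
  exist (fun b => is_ratfun b) _ (constf_ratfun c).

(* The local ring of [X] along an irreducible subset [Y] (e.g. a point). *)
Definition regular_along (Y : set (pspace K n)) (phi : funfield) : Prop :=
  exists d f g, [/\ f \is d.-homog, g \is d.-homog,
    (exists2 y, Y y & peval g y != 0) & val phi = polyfrac f / polyfrac g].

Definition takes_value (phi : funfield) (x : pspace K n) (a : K) : Prop :=
  exists d f g, [/\ f \is d.-homog, g \is d.-homog, peval g x != 0,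
    val phi = polyfrac f / polyfrac g & a = peval f x / peval g x].

Definition normal_variety : Prop :=
  forall x (phi : funfield) (p : {poly funfield}), pts X x ->
    p \is monic -> (forall i, regular_along [set x] p`_i) -> root p phi ->
    regular_along [set x] phi.

Definition prime_divisor (Y : set (pspace K n)) : Prop :=
  [/\ irred_closed Y, Y `<=` pts X, Y <> pts X &
      forall Z, irred_closed Z -> Y `<=` Z -> Z `<=` pts X ->
        Z = Y \/ Z = pts X].

Definition codim_ge2 (C : set (pspace K n)) : Prop :=
  forall Y, irred_closed Y -> Y `<=` C ->
    exists Z, [/\ irred_closed Z, Y `<=` Z, Z `<=` pts X, Z <> Y & Z <> pts X].

Definition primediv : Type :=
  {Y : set (pspace K n) | `[< prime_divisor Y >]}.
HB.instance Definition _ := Choice.on primediv.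

Definition uniformizer (Y : set (pspace K n)) (t : funfield) : Prop :=
  [/\ regular_along Y t, t != 0, ~ regular_along Y t^-1 &
      forall s, regular_along Y s -> ~ regular_along Y s^-1 ->
        regular_along Y (s / t)].

(* If [X] is normal, the local ring O of [X] along a prime divisor [Y] is a
   discrete valuation ring, and these say  ord_Y phi >= k, i.e. phi is in
   t^k O, and  ord_Y phi = k, i.e. phi is t^k times a unit of O, for one or
   equivalently any uniformizer t. *)
Definition ord_ge (Y : set (pspace K n)) (phi : funfield) (k : int) : Prop :=
  forall t, uniformizer Y t -> regular_along Y (phi * t ^ (- k)).
Definition has_ord (Y : set (pspace K n)) (phi : funfield) (k : int) : Prop :=
  [/\ phi != 0, ord_ge Y phi k & ord_ge Y phi^-1 (- k)].

Definition wdiv : Type := {freeg primediv}.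
HB.instance Definition _ := GRing.Lmodule.on wdiv.

Definition wcoef (D : wdiv) (Y : primediv) : int := coeff Y D.
Definition wprime (Y : primediv) : wdiv := << Y >>.

Definition is_div (phi : funfield) (D : wdiv) : Prop :=
  phi != 0 /\ forall Y, has_ord (val Y) phi (wcoef D Y).

Definition principal (D : wdiv) : Prop := exists phi, is_div phi D.

Definition Cl : zmodType := zquot (principal : set wdiv).
Definition dclass (D : wdiv) : Cl := zproj _ D.

(* Gamma(X, O(D)), the phi with div phi + D >= 0, and phi = 0. *)
Definition global_section (D : wdiv) (phi : funfield) : Prop :=
  forall Y, ord_ge (val Y) phi (- wcoef D Y).

Lemma constf0 : constf 0 = 0.
Proof.
by apply: val_inj; apply/eqP; rewrite /= polyfrac_eq0 mpolyC0 rpred0.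
Qed.

Lemma constf1 : constf 1 = 1.
Proof. by apply: val_inj; exact: polyfrac1. Qed.

Lemma constfB : {morph constf : a b / a - b}.
Proof. by move=> a b; apply: val_inj; rewrite /= mpolyCB polyfracB. Qed.

Lemma constfM : {morph constf : a b / a * b}.
Proof. by move=> a b; apply: val_inj; rewrite /= mpolyCM polyfracM. Qed.

Section LocalRing.
Variable Y : set (pspace K n).
Hypotheses (Yirr : irred_closed Y) (YX : Y `<=` pts X).

Lemma regular_denom d (g : {mpoly K[n.+1]}) : g \is d.-homog ->
  (exists2 y, Y y & peval g y != 0) -> polyfrac g != 0.
Proof.
move=> gh [y Yy gy]; rewrite polyfrac_eq0; apply/(notin_vanishP gh).
by exists y => //; exact: YX.
Qed.

Lemma regular_alongD a b :
  regular_along Y a -> regular_along Y b -> regular_along Y (a + b).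
Proof.
move=> [d [f [g [fh gh gY aE]]]] [e [f' [g' [fh' gh' gY' bE]]]].
exists (d + e)%N, (f * g' + f' * g), (g * g'); split.
- by apply: rpredD; [|rewrite addnC]; exact: dhomogM.
- exact: dhomogM.
- have [y Yy /andP[gy gy']] := irred_nonvanish Yirr gh gh' gY gY'.
  by exists y => //; rewrite /peval mevalM mulf_neq0.
have g0 := regular_denom gh gY; have g0' := regular_denom gh' gY'.
by rewrite ratfun_valD aE bE (addf_div _ _ g0 g0') polyfracD !polyfracM.
Qed.

Lemma regular_alongM a b :
  regular_along Y a -> regular_along Y b -> regular_along Y (a * b).
Proof.
move=> [d [f [g [fh gh gY aE]]]] [e [f' [g' [fh' gh' gY' bE]]]].
exists (d + e)%N, (f * f'), (g * g'); split; try exact: dhomogM.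
  have [y Yy /andP[gy gy']] := irred_nonvanish Yirr gh gh' gY gY'.
  by exists y => //; rewrite /peval mevalM mulf_neq0.
by rewrite ratfun_valM aE bE !polyfracM mulf_div.
Qed.

Lemma regular_along_const c : regular_along Y (constf c).
Proof.
have [_ [y Yy] _] := Yirr.
exists 0%N, c%:MP, 1; split; try exact: homogC.
  by exists y => //; rewrite /peval meval1 oner_eq0.
by rewrite polyfrac1 divr1.
Qed.

End LocalRing.

Lemma global_section0 D : global_section D 0.
Proof.
move=> Y t _; rewrite mul0r.
have [Yirr YX _ _] := asboolP _ (valP Y).
by rewrite -constf0; exact: regular_along_const.
Qed.

Lemma global_sectionB D a b :
  global_section D a -> global_section D b -> global_section D (a - b).
Proof.
move=> Da Db Y t tY; have [Yirr YX _ _] := asboolP _ (valP Y).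
rewrite mulrBl; apply: regular_alongD => //; first exact: Da.
have <- : constf (-1) * (b * t ^ (- - wcoef D Y)) = - (b * t ^ (- - wcoef D Y)).
  by rewrite -(sub0r 1) constfB constf0 constf1 sub0r mulN1r.
by apply: regular_alongM => //; [exact: regular_along_const|exact: Db].
Qed.

Lemma global_section1 : global_section 0 1.
Proof.
move=> Y t _; have [Yirr YX _ _] := asboolP _ (valP Y).
rewrite /wcoef coeff0 !oppr0 expr0z mulr1 -constf1.
exact: regular_along_const.
Qed.

Lemma global_sectionM D E a b :
  global_section D a -> global_section E b -> global_section (D + E) (a * b).
Proof.
move=> Da Eb Y t tY; have [Yirr YX _ _] := asboolP _ (valP Y).
have t0 : t != 0 by case: tY.
rewrite /wcoef coeffD !opprK expfzDr // mulrACA -[coeff Y D]opprK -[coeff Y E]opprK.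
by apply: regular_alongM => //; [exact: Da|exact: Eb].
Qed.

(* The data of the standard construction: a subgroup K of WDiv(X) mapping onto
   Cl(X) and, on the subgroup K0 of principal divisors in K, a character chi
   to K(X)^* with div(chi(E)) = E. *)
Record cox_datum := CoxDatum {
  cd_group : set wdiv;
  cd_char : wdiv -> funfield;
  cd_group0 : cd_group 0;
  cd_groupB : forall D E, cd_group D -> cd_group E -> cd_group (D - E);
  cd_groupCl : forall D, exists2 E, cd_group E & dclass E = dclass D;
  cd_charD : forall D E, cd_group D -> principal D ->
    cd_group E -> principal E -> cd_char (D + E) = cd_char D * cd_char E;
  cd_char_div : forall E, cd_group E -> principal E -> is_div (cd_char E) E }.

Section CoxRing.
Variable delta : cox_datum.

(* The direct sum of Gamma(X, O(D)) over D in K, as a subring of the group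
   algebra K(X)[WDiv(X)]. *)
Definition is_section : pred (group_alg funfield wdiv) := fun s =>
  `[< forall D, global_section D (gcoef D s) /\
        (gcoef D s != 0 -> cd_group delta D) >].

Lemma is_section_gmon D a : cd_group delta D -> global_section D a ->
  gmon a D \in is_section.
Proof.
move=> gD Da; apply/asboolP => E; rewrite gcoef_gmon; case: eqP => [<-|_].
  by [].
by split; [exact: global_section0|rewrite eqxx].
Qed.

Lemma is_section_zmod : zmod_closed is_section.
Proof.
split.
  apply/asboolP => D; rewrite /gcoef coeff0; split; last by rewrite eqxx.
  exact: global_section0.
move=> s t /asboolP sS /asboolP tS; apply/asboolP => D.
have [Ds sD] := sS D; have [Dt tD] := tS D.
rewrite /gcoef coeffB -!/(gcoef _ _); split; first exact: global_sectionB.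
have [->|s0 _] := eqVneq (gcoef D s) 0; last exact: sD.
by rewrite sub0r oppr_eq0; exact: tD.
Qed.

HB.instance Definition _ :=
  GRing.isZmodClosed.Build _ is_section is_section_zmod.

Lemma cd_groupD D E :
  cd_group delta D -> cd_group delta E -> cd_group delta (D + E).
Proof.
move=> gD gE; rewrite -[E]opprK -[- E]sub0r.
by do 2!apply: cd_groupB => //; exact: cd_group0.
Qed.

Lemma group_algE (s : group_alg funfield wdiv) :
  s = \sum_(D <- dom s) gmon (gcoef D s) D.
Proof. by rewrite [RHS](freeg_sumE s). Qed.

Lemma is_section_subring : subring_closed is_section.
Proof.
split; last 2 first.
- exact: is_section_zmod.2.
- move=> s t /asboolP sS /asboolP tS.
  rewrite (group_algE s) (group_algE t) mulr_suml big_seq rpred_sum // => D Ds.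
  rewrite mulr_sumr big_seq rpred_sum // => E Et.
  rewrite [_ * _]group_alg_mul_gmon; apply: is_section_gmon.
    apply: cd_groupD; first by apply: (sS D).2; rewrite -mem_dom.
    by apply: (tS E).2; rewrite -mem_dom.
  by apply: global_sectionM; [exact: (sS D).1|exact: (tS E).1].
- by apply: is_section_gmon; [exact: cd_group0|exact: global_section1].
Qed.

HB.instance Definition _ :=
  GRing.isSubringClosed.Build _ is_section is_section_subring.

Definition section_ring : Type := {s : group_alg funfield wdiv | is_section s}.
HB.instance Definition _ := [isSub of section_ring for @sval _ _].
HB.instance Definition _ := [Choice of section_ring by <:].
HB.instance Definition _ := [SubChoice_isSubComNzRing of section_ring by <:].

(* The section phi in degree D; meaningful for D in K and phi in
   Gamma(X, O(D)), and 0 otherwise. *)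
Definition hsection (phi : funfield) (D : wdiv) : section_ring :=
  insubd (0 : section_ring) (gmon phi D).

Definition cox_relation : set section_ring :=
  [set r | exists E, [/\ cd_group delta E, principal E &
             r = 1 - hsection (cd_char delta E) (- E)]].

Definition cox_ring : comPzRingType := rquot cox_relation.

Definition cox_section (phi : funfield) (D : wdiv) : cox_ring :=
  rproj _ (hsection phi D).

(* The part of degree w: the image of the sum of the Gamma(X, O(D)) over the D
   of class w. *)
Definition cox_part (w : Cl) : set cox_ring :=
  [set r | exists s : section_ring,
     (forall D, gcoef D (val s) != 0 -> dclass D = w) /\ r = rproj _ s].

Definition canonical_section (E : primediv) : cox_ring :=
  cox_section 1 (wprime E).

End CoxRing.

End FunctionField.

Section Morphisms.
Variables (K : closedFieldType) (n m : nat).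

(* [pi] is a morphism on [A]: locally given by homogeneous polynomials of the
   same degree without common zero (their value vector spans a line). *)
Definition regular_map (A : set (pspace K n)) (pi : pspace K n -> pspace K m) :
    Prop :=
  forall x, A x -> exists W d (F : 'I_m.+1 -> {mpoly K[n.+1]}),
    [/\ zopen W, W x, (forall i, F i \is d.-homog) &
        forall y, A y -> W y -> val (pi y) = <[\row_i peval (F i) y]>%VS].

End Morphisms.

Section Modification.
Variables (K : closedFieldType) (n2 n1 : nat).
Variables (X2 : projvar K n2) (X1 : projvar K n1).
Variable pi : pspace K n2 -> pspace K n1.

Definition isomorphic_over (A : set (pspace K n2)) (B : set (pspace K n1)) :
    Prop :=
  exists rho : pspace K n1 -> pspace K n2,
    [/\ forall x, A x -> B (pi x) /\ rho (pi x) = x,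
        forall y, B y -> A (rho y) /\ pi (rho y) = y,
        regular_map A pi & regular_map B rho].

Definition birational : Prop :=
  exists W2 W1, [/\ zopen W2, zopen W1,
    (pts X2 `&` W2) !=set0, (pts X1 `&` W1) !=set0 &
    isomorphic_over (pts X2 `&` W2) (pts X1 `&` W1)].

(* Morphisms of projective varieties are proper. Only the restriction of [pi]
   to [X2] matters. *)
Definition modification : Prop :=
  [/\ forall x, pts X2 x -> pts X1 (pi x), regular_map (pts X2) pi &
      birational].

(* Covers the smallest such C; nothing below depends on the choice. *)
Definition center (C : set (pspace K n1)) : Prop :=
  [/\ zclosed C, C `<=` pts X1, codim_ge2 X1 C &
      isomorphic_over (pts X2 `\` pi @^-1` C) (pts X1 `\` C)].

Definition exceptional (E : primediv X2) : Prop :=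
  ~ prime_divisor X1 (zclosure (pi @` val E)).

(* pi being birational, no degrees of residue field extensions occur. *)
Definition push_prime (Y : primediv X2) : wdiv X1 :=
  if insub (zclosure (pi @` val Y)) is Some Z then wprime Z else 0.

Definition pushforward (D : wdiv X2) : wdiv X1 :=
  fglift (push_prime : _ -> {freeg primediv X1}) D.

(* Under the identification of X2 \ pi^-1(C) with X1 \ C, the rational
   functions [phi2] and [phi1] restrict to the same one. *)
Definition same_restriction (C : set (pspace K n1))
    (phi2 : funfield X2) (phi1 : funfield X1) : Prop :=
  forall x, pts X2 x -> ~ C (pi x) ->
    forall a, takes_value phi2 x a <-> takes_value phi1 (pi x) a.

(* The Cox ring depends on the chosen group and character, up to non-canonical
   isomorphism if the class group has torsion. Restricting sections to the
   common open subset makes sense for choices agreeing there, e.g. those given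
   by the divisors avoiding a smooth point x of X2 \ pi^-1(C), resp. pi(x), and
   the functions normalized to 1 at this point. The exceptional prime divisors
   E belong to K, so that 1 in Gamma(X2, O(E)) is the canonical section. *)
Definition compatible (C : set (pspace K n1)) (delta2 : cox_datum X2)
    (delta1 : cox_datum X1) : Prop :=
  [/\ forall D, cd_group delta2 D -> cd_group delta1 (pushforward D),
      forall E, cd_group delta2 E -> principal E ->
        same_restriction C (cd_char delta2 E) (cd_char delta1 (pushforward E)) &
      forall E, exceptional E -> cd_group delta2 (wprime E)].

End Modification.

Definition finitely_generated_group (M : zmodType) : Prop :=
  exists m (g : 'I_m -> M), forall x, exists c : 'I_m -> int,
    x = \sum_i g i *~ c i.

Record gr_algebra (K : fieldType) := GrAlgebra {
  gr_deg : zmodType;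
  gr_ring : comPzRingType;
  gr_const : K -> gr_ring;
  gr_part : gr_deg -> set gr_ring }.
Arguments gr_const {K} A c : rename.
Arguments gr_part {K A} m a : rename.

Section GradedAlgebras.
Variable K : fieldType.
Implicit Types A B : gr_algebra K.

Definition is_graded_algebra A : Prop :=
  [/\ zmod_morphism (gr_const A) /\ monoid_morphism (gr_const A),
      forall c, gr_part 0 (gr_const A c),
      forall m, gr_part (A := A) m 0 /\
        (forall a b, gr_part m a -> gr_part m b -> gr_part (A := A) m (a - b)),
      forall m n a b, gr_part m a -> gr_part n b ->
        gr_part (A := A) (m + n) (a * b) &
      (forall a, exists (s : seq (gr_deg A)) (f : gr_deg A -> gr_ring A),
         (forall m, gr_part m (f m)) /\ a = \sum_(m <- s) f m) /\
      (forall (s : seq (gr_deg A)) (f : gr_deg A -> gr_ring A), uniq s ->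
         (forall m, gr_part m (f m)) -> \sum_(m <- s) f m = 0 ->
         forall m, m \in s -> f m = 0)].

Definition graded_morphism A B (psi : {rmorphism gr_ring A -> gr_ring B})
    (psi' : {additive gr_deg A -> gr_deg B}) : Prop :=
  [/\ is_graded_algebra A, is_graded_algebra B,
      forall c, psi (gr_const A c) = gr_const B c &
      forall m a, gr_part m a -> gr_part (psi' m) (psi a)].

Definition graded_isomorphism A B (psi : {rmorphism gr_ring A -> gr_ring B})
    (psi' : {additive gr_deg A -> gr_deg B}) : Prop :=
  [/\ graded_morphism psi psi', bijective psi, bijective psi' &
      forall m a, gr_part (psi' m) (psi a) -> gr_part m a].

Definition finitely_generated_algebra A : Prop :=
  exists m (g : 'I_m -> gr_ring A), forall S : set (gr_ring A),
    (forall c, S (gr_const A c)) -> (forall i, S (g i)) ->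
    (forall a b, S a -> S b -> S (a + b)) ->
    (forall a b, S a -> S b -> S (a * b)) -> forall a, S a.

Variables (A : gr_algebra K) (I : Type) (f : I -> gr_ring A) (d : I -> gr_deg A).

Definition unit_relation : set (gr_ring A) := [set r | exists i, r = f i - 1].
Definition unit_degree : set (gr_deg A) := [set e | exists i, e = d i].

(* A / <f_i - 1>, graded by the degree group modulo <d_i>, for [f_i] of degree
   [d_i]: the part of degree u is the image of the sum of the parts of A of
   degrees mapping to u. *)
Definition gr_quotient : gr_algebra K :=
  @GrAlgebra K (zquot unit_degree) (rquot unit_relation)
    (fun c => rproj _ (gr_const A c))
    (fun u => [set r | exists s : seq (gr_ring A),
       (forall a, a \in s -> exists2 m, zproj _ m = u & gr_part m a) /\
       r = rproj _ (\sum_(a <- s) a)]).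

Definition gr_proj : {rmorphism gr_ring A -> gr_ring gr_quotient} :=
  @rproj (gr_ring A) unit_relation.
Definition gr_proj_deg : {additive gr_deg A -> gr_deg gr_quotient} :=
  @zproj (gr_deg A) unit_degree.

End GradedAlgebras.

Definition cox_algebra (K : closedFieldType) n (X : projvar K n)
    (delta : cox_datum X) : gr_algebra K :=
  @GrAlgebra K (Cl X) (cox_ring delta)
    (fun c => cox_section delta (constf X c) 0) (@cox_part K n X delta).

(* Main.v *)
(** The open sets U = X2 \ pi^-1(C) and X1 \ C are isomorphic, which identifies the
    two function fields. Since C has codimension at least two, Z |-> Z meet (X1 \ C)
    identifies the prime divisors of X1 with those of X2 meeting U, the local rings
    agree, and the prime divisors of X2 inside pi^-1(C) are exactly the exceptional
    ones. Hence the push forward preserves principal divisors and sections. By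
    noetherianity there are finitely many exceptional divisors E, and every nonzero
    rational function has an order along each of them (a noetherian local domain
    with nonzero principal maximal ideal is a discrete valuation ring). So a section
    on X1 lifts to a section of D + F with F exceptional, which gives surjectivity,
    and D is principal up to exceptional divisors once its push forward is principal.

    For the kernel, the latter allows one, modulo the f_i - 1, to move the components
    of an element whose push forwards have the same class w into a single section
    phi of one divisor D. If the push forward of the element vanishes, so does that
    of phi, because Gamma(X1, O(D')) embeds into the Cox ring; hence phi = 0. *)
Require Import Defs.
From HB Require Import structures.
From mathcomp Require Import all_boot all_order all_algebra.
From mathcomp Require Import generic_quotient ring_quotient fraction.
From mathcomp Require Import boolp classical_sets.
From mathcomp Require Import freeg mpoly.

Set Implicit Arguments.
Unset Strict Implicit.
Unset Printing Implicit Defensive.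

Import GRing.Theory.
Local Open Scope ring_scope.
Local Open Scope classical_set_scope.

(** * Noetherianity of polynomial rings *)

(** Three obstacles shape the argument. Setting [f_i = 1] trivializes the section 1 only in
    effective exceptional degrees. An exceptional correction [G] of arbitrary sign is therefore
    written as the difference of [G + F] and [F], both effective, and one of them is added on each
    side of a comparison. Next, a presentation by generators of an ideal does not show that a
    nonzero section survives in the Cox ring. An additive functional that divides out the character
    reads off the component of a given class and kills the relations; it also proves that the sum of
    the graded parts is direct. Finally, directness for the quotient of the Cox ring of X2 is pulled
    back from X1 along the injective [psi], so injectivity has to precede the grading. The function
    fields are compared through values at points: a rational function is determined by its values on
    a nonempty open set, hence locally constructed pullbacks agree. Compatibility of the characters
    makes this comparison respect the Cox relations. Noetherianity is used in sequential form: some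
    member of any sequence of polynomials lies in the ideal of its predecessors. *)

Lemma monotone_subsequence (f : nat -> nat) :
  exists2 phi, {homo phi : i j / (i < j)%N} &
    {homo f \o phi : i j / (i <= j)%N}.
Proof.
(* A position where [f] is minimal on the tail from [n]; taking such positions repeatedly gives the
   subsequence. *)
have tail_min n : exists m, (n <= m)%N /\ forall k, (n <= k)%N -> (f m <= f k)%N.
  pose P v := `[< exists2 k, (n <= k)%N & f k = v >].
  have exP : exists v, P v by exists (f n); apply/asboolP; exists n.
  case: (ex_minnP exP) => v /asboolP[m nm <-] mmin.
  by exists m; split=> // k nk; apply: mmin; apply/asboolP; exists k.
have [g gP] := choice tail_min.
pose phi := fix phi i := if i is j.+1 then g (phi j).+1 else g 0%N.
have phiS i : (phi i < phi i.+1)%N := (gP (phi i).+1).1.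
have phi_min i k : (phi i <= k)%N -> (f (phi i) <= f k)%N.
  case: i => [|i] lek; apply: (gP _).2 => //.
  exact: leq_trans (gP _).1 lek.
exists phi; first exact: (homo_ltn ltn_trans phiS).
apply: homo_leq => [//|? ? ?|i]; first exact: leq_trans.
by apply: phi_min; exact: ltnW.
Qed.

(** One coordinate at a time, pass to a subsequence on which it is monotone; this keeps the
    coordinates already treated monotone. The first two terms of the last subsequence are
    comparable. *)
Lemma dickson n (m : nat -> 'X_{1..n}) : exists i j, (i < j)%N /\ (m i <= m j)%MM.
Proof.
have [phi phiI phiM] : exists2 phi, {homo phi : i j / (i < j)%N} &
    forall k : 'I_n, (k < n)%N -> {homo (fun i => m (phi i) k) : i j / (i <= j)%N}.
  suff H d : exists2 phi, {homo phi : i j / (i < j)%N} &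
      forall k : 'I_n, (k < d)%N -> {homo (fun i => m (phi i) k) : i j / (i <= j)%N}.
    exact: H.
  elim: d => [|d [phi phiI phiM]]; first by exists id.
  have [dn|nd] := ltnP d n; last first.
    by exists phi => // k _; apply: phiM; exact: leq_trans (ltn_ord k) nd.
  have [psi psiI psiM] := monotone_subsequence (fun i => m (phi i) (Ordinal dn)).
  exists (phi \o psi) => [i j ij|k]; first by apply/phiI/psiI.
  rewrite ltnS leq_eqVlt => /orP[/eqP kd|kd] i j ij.
    by rewrite (_ : k = Ordinal dn); [exact: psiM|exact: val_inj].
  by apply: phiM => //; exact: (homo_leq _ leq_trans (fun i => ltnW (psiI _ _ (ltnSn i)))).
exists (phi 0%N), (phi 1%N); split; first exact: phiI.
by apply/mnm_lepP => k; exact: phiM.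
Qed.

Section Hilbert.
Variables (F : fieldType) (n : nat) (f : nat -> {mpoly F[n]}).

Definition in_prefix_ideal (k : nat) (p : {mpoly F[n]}) : Prop :=
  exists c : nat -> {mpoly F[n]}, p = \sum_(i < k) c i * f i.

Lemma in_prefix_ideal_lin k a p q : in_prefix_ideal k p -> in_prefix_ideal k q ->
  in_prefix_ideal k (p - a * q).
Proof.
move=> [c ->] [d ->]; exists (fun i => c i - a * d i).
by rewrite mulr_sumr -sumrB; apply: eq_bigr => i _; rewrite mulrBl mulrA.
Qed.

Lemma in_prefix_ideal0 k : in_prefix_ideal k 0.
Proof. by exists (fun=> 0); rewrite big1 // => i _; rewrite mul0r. Qed.

Lemma in_prefix_idealW k l p : (k <= l)%N ->
  in_prefix_ideal k p -> in_prefix_ideal l p.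
Proof.
move=> kl [c ->]; exists (fun i => if (i < k)%N then c i else 0).
rewrite (big_ord_widen _ (fun i => c i * f i) kl) big_mkcond /=.
by apply: eq_bigr => i _; case: ifP; rewrite ?mul0r.
Qed.

Lemma in_prefix_ideal_self k l : (k < l)%N -> in_prefix_ideal l (f k).
Proof.
move=> kl; exists (fun i => (i == k)%:R).
rewrite (bigD1 (Ordinal kl)) //= eqxx mul1r big1 ?addr0 // => i.
by rewrite -val_eqE /= => /negPf->; rewrite mul0r.
Qed.

(* If [f k] is never in the ideal generated by its predecessors, choose in each
   class [f k + (f 0, ..., f k.-1)] an element [g k] of minimal leading
   monomial. By Dickson some leading monomial divides a later one, and
   cancelling it contradicts minimality. *)
Lemma hilbert_basis : exists k, in_prefix_ideal k (f k).
Proof.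
apply: contrapT => /forallNP fN.
have minlead k : exists g, in_prefix_ideal k (f k - g) /\
    forall g', in_prefix_ideal k (f k - g') -> ~~ (mlead g' < mlead g)%O.
  pose P m := exists2 g, in_prefix_ideal k (f k - g) & mlead g = m.
  have : P (mlead (f k)) by exists (f k); rewrite ?subrr //; exact: in_prefix_ideal0.
  elim/(well_founded_ind (@ltom_wf n)): (mlead (f k)) => m IH [g gI gm].
  have [[m' m'm Pm']|nex] := pselect (exists2 m', (m' < m)%O & P m').
    exact: IH Pm'.
  exists g; split=> // g' g'I; apply/negP => g'g; apply: nex.
  by exists (mlead g'); [rewrite -gm|exists g'].
have [g gP] := choice minlead.
have [i [j [ij le_lead]]] := dickson (fun k => mlead (g k)).
have g0 k : g k != 0.
  by apply/eqP => gk0; apply: (fN k); have [] := gP k; rewrite gk0 subr0.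
have gI : in_prefix_ideal j (g i).
  have [giI _] := gP i.
  rewrite -[g i](subKr (f i)) -[f i - g i]mul1r.
  apply: in_prefix_ideal_lin; first exact: in_prefix_ideal_self.
  exact: in_prefix_idealW (ltnW ij) giI.
pose m := (mlead (g j) - mlead (g i))%MM.
pose c := mleadc (g j) / mleadc (g i).
have ci0 : mleadc (g i) != 0 by rewrite mleadc_eq0.
have cj0 : mleadc (g j) != 0 by rewrite mleadc_eq0.
pose q := c *: 'X_[m] : {mpoly F[n]}; pose h := q * g i.
have c0 : c != 0 by rewrite mulf_neq0 ?invr_eq0.
have lead_q : mlead q = m by rewrite mleadZ // mleadXm.
have leadc_q : mleadc q = c by rewrite mleadcZE mleadXm mcoeffX eqxx mulr1.
have q0 : q != 0 by rewrite -mleadc_eq0 leadc_q.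
have lead_h : mlead h = mlead (g j) by rewrite mleadM // lead_q submK.
have [gjI gjmin] := gP j.
have hI : in_prefix_ideal j (f j - (g j - h)).
  rewrite opprB addrCA addrC -[h]opprK -mulNr.
  exact: in_prefix_ideal_lin.
have := gjmin _ hI; rewrite -Order.TotalTheory.leNgt => le_gj.
have lead_eq : mlead (g j - h) = mlead (g j).
  apply: Order.POrderTheory.le_anti; rewrite le_gj andbT.
  by apply: Order.POrderTheory.le_trans (mleadB_le _ _) _; rewrite lead_h Order.JoinTheory.joinxx.
have : g j - h != 0.
  apply/eqP => gjh; apply: (fN j).
  by move: hI; rewrite gjh subr0.
rewrite -mleadc_eq0 lead_eq mcoeffB.
suff -> : h@_(mlead (g j)) = mleadc (g j) by rewrite subrr eqxx.
by have := mleadcM q (g i); rewrite leadc_q divfK // lead_q submK.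
Qed.

End Hilbert.

Section HomogeneousBasis.
Variables (F : fieldType) (n : nat).

Lemma pihomogM_homog D d (c f : {mpoly F[n]}) : f \is d.-homog ->
  pihomog mdeg D (c * f) = if (d <= D)%N then pihomog mdeg (D - d) c * f else 0.
Proof.
move=> fh; rewrite {1}[c](@pihomog_partitionE _ _ mdeg (maxn (msize c) D.+1)) ?leq_maxl //.
rewrite mulr_suml raddf_sum /=.
have piE e : pihomog mdeg D (pihomog mdeg e c * f) =
    if (e + d == D)%N then pihomog mdeg e c * f else 0.
  have eh : pihomog mdeg e c * f \is (e + d).-homog by apply: dhomogM => //; exact: pihomogP.
  by case: eqP => [<-|/eqP ne]; [exact: pihomog_dE|exact: pihomog_ne0 ne eh].
under eq_bigr do rewrite piE.
have [dD|Dd] := leqP d D; last first.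
  by rewrite big1 // => e _; rewrite gtn_eqF // ltn_addl.
have lt : (D - d < maxn (msize c) D.+1)%N by rewrite leq_max ltnS leq_subr orbT.
rewrite (bigD1 (Ordinal lt)) //= subnK // eqxx big1 ?addr0 // => e.
by rewrite -val_eqE /= -(eqn_add2r d) subnK // => /negPf->.
Qed.

(** Take the component of degree [d k] in the relation for [f k]. The last clause is stated for
    every form [g] because the coefficients will also be multiplied by denominators having the
    degrees of the [f i]; a coefficient is 0 when [d i] exceeds [d k]. *)
Lemma hilbert_basis_homog (d : nat -> nat) (f : nat -> {mpoly F[n]}) :
  (forall k, f k \is (d k).-homog) ->
  exists k (c : nat -> {mpoly F[n]}), f k = \sum_(i < k) c i * f i /\
    forall i g, g \is (d i).-homog -> c i * g \is (d k).-homog.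
Proof.
move=> fh; have [k [c fk]] := hilbert_basis f.
exists k, (fun i => if (d i <= d k)%N then pihomog mdeg (d k - d i) (c i) else 0); split.
  rewrite -[LHS](pihomog_dE (fh k)) {1}fk raddf_sum /=.
  apply: eq_bigr => i _; rewrite (pihomogM_homog _ _ (fh i)).
  by case: ifP => // _; rewrite mul0r.
move=> i g gh; case: ifP => [le|_]; last by rewrite mul0r dhomog0.
by rewrite -{2}(subnK le); apply: dhomogM => //; exact: pihomogP.
Qed.

End HomogeneousBasis.

(** * Zariski topology *)

Section ZariskiTopology.
Variables (K : closedFieldType) (n : nat).
Implicit Types (Z A O : set (pspace K n)) (x : pspace K n).

Lemma pevalM (p q : {mpoly K[n.+1]}) x : peval (p * q) x = peval p x * peval q x.
Proof. exact: mevalM. Qed.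

Lemma pevalB (p q : {mpoly K[n.+1]}) x : peval (p - q) x = peval p x - peval q x.
Proof. exact: mevalB. Qed.

Lemma pevalD (p q : {mpoly K[n.+1]}) x : peval (p + q) x = peval p x + peval q x.
Proof. exact: mevalD. Qed.

Lemma zclosedP Z : zclosed Z <-> forall x, ~ Z x ->
  exists d p, [/\ p \is d.-homog, forall z, Z z -> peval p z = 0 & peval p x != 0].
Proof.
split=> [[T [Th ->]] x /= /existsNP[p /not_implyP[Tp px]]|sepZ].
  have [d ph] := Th p Tp; exists d, p; split=> // [z|]; first exact.
  exact/eqP.
exists [set p | (exists d, p \is d.-homog) /\ forall z, Z z -> peval p z = 0].
split=> [p [] //|]; apply/seteqP; split=> [x Zx p [_]|x /= px]; first exact.
apply: contrapT => /sepZ[d [p [ph pZ]]]; rewrite px ?eqxx //.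
by split=> //; exists d.
Qed.

Lemma zclosedI Z1 Z2 : zclosed Z1 -> zclosed Z2 -> zclosed (Z1 `&` Z2).
Proof.
move=> /zclosedP Z1c /zclosedP Z2c; apply/zclosedP => x /not_andP[] Zx.
  by have [d [p [ph pZ px]]] := Z1c _ Zx; exists d, p; split=> // z [? _]; exact: pZ.
by have [d [p [ph pZ px]]] := Z2c _ Zx; exists d, p; split=> // z [_ ?]; exact: pZ.
Qed.

(* The trace of [O] on [A] is relatively open; [O] need not be contained in [A]. *)
Definition open_in A O : Prop := forall x, A x -> O x ->
  exists d p, [/\ p \is d.-homog, peval p x != 0 &
    forall y, A y -> peval p y != 0 -> O y].

Lemma open_inI A O1 O2 : open_in A O1 -> open_in A O2 -> open_in A (O1 `&` O2).
Proof.
move=> o1 o2 x Ax [O1x O2x].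
have [d [p [ph px pO]]] := o1 x Ax O1x; have [e [q [qh qx qO]]] := o2 x Ax O2x.
exists (d + e)%N, (p * q); split; first exact: dhomogM.
  by rewrite pevalM mulf_neq0.
by move=> y Ay; rewrite pevalM mulf_eq0 negb_or => /andP[py qy]; split; [exact: pO|exact: qO].
Qed.

Lemma open_inW A A' O : A' `<=` A -> open_in A O -> open_in A' O.
Proof.
move=> A'A oO x A'x Ox; have [d [p [ph px pO]]] := oO x (A'A _ A'x) Ox.
by exists d, p; split=> // y /A'A; exact: pO.
Qed.

Lemma open_in_trans A A' O : open_in A A' -> open_in A' O -> open_in A (A' `&` O).
Proof.
move=> oA oO x Ax [A'x Ox].
have [d [p [ph px pA]]] := oA x Ax A'x; have [e [q [qh qx qO]]] := oO x A'x Ox.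
exists (d + e)%N, (p * q); split; first exact: dhomogM.
  by rewrite pevalM mulf_neq0.
move=> y Ay; rewrite pevalM mulf_eq0 negb_or => /andP[/(pA _ Ay) A'y qy].
by split=> //; exact: qO.
Qed.

Lemma open_in_setC A Z : zclosed Z -> open_in A (~` Z).
Proof.
move=> /zclosedP sepZ x _ /sepZ[d [p [ph pZ px]]]; exists d, p; split=> // y _ py Zy.
by rewrite pZ // eqxx in py.
Qed.

Lemma open_in_zopen A W : zopen W -> open_in A W.
Proof. by move=> Wo; rewrite -[W]setCK; exact: open_in_setC. Qed.

Lemma open_in_nonvanishing A d (p : {mpoly K[n.+1]}) :
  p \is d.-homog -> open_in A [set x | peval p x != 0].
Proof. by move=> ph x _ /= px; exists d, p; split. Qed.

Lemma open_in_zclosed A Z : zclosed A -> Z `<=` A -> open_in A (~` Z) -> zclosed Z.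
Proof.
move=> /zclosedP Ac ZA oZ; apply/zclosedP => x Zx.
have [Ax|/Ac[d [p [ph pA px]]]] := pselect (A x); last first.
  by exists d, p; split=> // z /ZA; exact: pA.
have [d [p [ph px pZ]]] := oZ x Ax Zx; exists d, p; split=> // z Zz.
by apply/eqP/negPn/negP => /pZ /(_ Zz)[]; exact: ZA.
Qed.

Lemma zclosureP A x : zclosure A x <->
  forall d p, p \is d.-homog -> (forall z, A z -> peval p z = 0) -> peval p x = 0.
Proof.
split=> [Ax d p ph pA|px Z /zclosedP Zc AZ].
  by apply: (Ax [set z | peval p z = 0]) => //; exact: zclosed_zeros ph.
apply: contrapT => /Zc[d [p [ph pZ]]]; rewrite (px d) ?eqxx // => z /AZ; exact: pZ.
Qed.

Lemma zclosure_zclosed A : zclosed (zclosure A).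
Proof.
apply/zclosedP => x /existsNP[Z /not_implyP[Zc /not_implyP[AZ Zx]]].
have [d [p [ph pZ px]]] := (zclosedP _).1 Zc _ Zx.
by exists d, p; split=> // z Az; apply: pZ; exact: Az.
Qed.

Lemma subset_zclosure A : A `<=` zclosure A.
Proof. by move=> x Ax Z _; exact. Qed.

Lemma zclosure_sub A Z : zclosed Z -> A `<=` Z -> zclosure A `<=` Z.
Proof. by move=> Zc AZ x; exact. Qed.

Lemma zclosureS A B : A `<=` B -> zclosure A `<=` zclosure B.
Proof. by move=> AB x Ax Z Zc BZ; apply: Ax => // y /AB; exact: BZ. Qed.

(** Stated by relatively open subsets so that it makes sense for sets that are not closed, such as
    images and traces on open sets. *)
Definition irred_set A : Prop := A !=set0 /\
  forall O1 O2, open_in A O1 -> open_in A O2 ->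
    A `&` O1 !=set0 -> A `&` O2 !=set0 -> A `&` (O1 `&` O2) !=set0.

Lemma irred_closedP Z : irred_closed Z <-> zclosed Z /\ irred_set Z.
Proof.
split=> [Zirr|[Zc [Z0 Zirr]]].
  have [Zc Z0 _] := Zirr; split=> //; split=> // O1 O2 o1 o2 [x [Zx Ox]] [y [Zy Oy]].
  have [d [p [ph px pO]]] := o1 x Zx Ox; have [e [q [qh qy qO]]] := o2 y Zy Oy.
  have [z Zz /andP[pz qz]] : exists2 z, Z z & (peval p z != 0) && (peval q z != 0).
    by apply: irred_nonvanish Zirr ph qh _ _; [exists x|exists y].
  by exists z; split=> //; split; [exact: pO|exact: qO].
split=> // Z1 Z2 c1 c2 ZZ; apply: contrapT => /not_orP[N1 N2].
have meets V : ~ Z `<=` V -> Z `&` ~` V !=set0.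
  by move=> /existsNP[x /not_implyP[]]; exists x.
have [z [Zz []]] := Zirr _ _ (open_in_setC c1) (open_in_setC c2) (meets _ N1) (meets _ N2).
by have [] := ZZ z Zz.
Qed.

Lemma irred_set_dense A O : irred_set A -> open_in A O -> A `&` O !=set0 ->
  A `<=` zclosure (A `&` O).
Proof.
move=> [_ Airr] oO AO x Ax; apply/zclosureP => d p ph pAO.
apply/eqP/negPn/negP => px.
have [] := Airr _ _ oO (open_in_nonvanishing (A := A) ph) AO; first by exists x.
by move=> y [Ay [Oy /=]]; rewrite pAO ?eqxx.
Qed.

Lemma irred_closed_dense Z O : irred_closed Z -> open_in Z O -> Z `&` O !=set0 ->
  zclosure (Z `&` O) = Z.
Proof.
move=> /irred_closedP[Zc Zirr] oO ZO; apply/seteqP; split.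
  by apply: zclosure_sub => // x [].
exact: irred_set_dense.
Qed.

Lemma irred_set_open A O : irred_set A -> open_in A O -> A `&` O !=set0 ->
  irred_set (A `&` O).
Proof.
move=> [_ Airr] oO AO; split=> // O1 O2 o1 o2 [x [[Ax Ox] O1x]] [y [[Ay Oy] O2y]].
have sub O' : open_in (A `&` O) O' -> open_in A (O `&` O').
  move=> oO' z Az [Oz O'z].
  have [d [p [ph pz pO]]] := oO z Az Oz; have [e [q [qh qz qO]]] := oO' z (conj Az Oz) O'z.
  exists (d + e)%N, (p * q); split; first exact: dhomogM.
    by rewrite pevalM mulf_neq0.
  move=> w Aw; rewrite pevalM mulf_eq0 negb_or => /andP[/(pO _ Aw) Ow qw].
  by split=> //; apply: qO.
have [||z [Az [[Oz O1z] [_ O2z]]]] := Airr _ _ (sub _ o1) (sub _ o2).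
- by exists x.
- by exists y.
by exists z.
Qed.

Lemma irred_set_closure A : irred_set A -> irred_closed (zclosure A).
Proof.
move=> [[x Ax] Airr]; apply/irred_closedP; split; first exact: zclosure_zclosed.
have AcA := @subset_zclosure A.
have meets O : open_in (zclosure A) O -> zclosure A `&` O !=set0 -> A `&` O !=set0.
  move=> oO [y [cAy Oy]]; have [d [p [ph py pO]]] := oO y cAy Oy.
  apply: contrapT => /forallNP AO; move: py; rewrite ((zclosureP _ _).1 cAy d) ?eqxx // => z Az.
  apply/eqP/negPn/negP => pz; apply: (AO z); split=> //.
  by apply: pO => //; exact: AcA.
split=> [|O1 O2 o1 o2 /(meets _ o1) m1 /(meets _ o2) m2]; first by exists x; exact: AcA.
have [z [Az Oz]] := Airr _ _ (open_inW AcA o1) (open_inW AcA o2) m1 m2.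
by exists z; split=> //; exact: AcA.
Qed.

(** Induction on the list, splitting off the first member from the union of the others. That union
    is closed because products of separating forms separate. *)
Lemma irred_sub_cover Z (L : seq (set (pspace K n))) : irred_closed Z ->
  (forall V, V \in L -> zclosed V) ->
  (forall x, Z x -> exists2 V, V \in L & V x) -> exists2 V, V \in L & Z `<=` V.
Proof.
move=> [Zc [x Zx] Zirr].
elim: L => [|V L IH] Lc ZL; first by have [] := ZL x Zx.
pose U : set (pspace K n) := [set y | exists2 W, W \in L & W y].
have Uc : zclosed U.
  have {}Lc W : W \in L -> zclosed W by move=> WL; apply: Lc; rewrite inE WL orbT.
  rewrite {}/U; elim: {IH ZL} L Lc => [|W L IHL] Lc.
    (* The constant 1 has no zeros and cuts out the empty union. *)
    exists [set 1]; split=> [p ->|]; first by exists 0%N; exact: dhomog1.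
    apply/seteqP; split=> [y [] //|y /= /(_ 1 erefl) /eqP].
    by rewrite /peval meval1 oner_eq0.
  apply/zclosedP => y Wy.
  have [d [p [ph pL py]]] : exists d p, [/\ p \is d.-homog,
      forall z, (exists2 W, W \in L & W z) -> peval p z = 0 & peval p y != 0].
    apply: (zclosedP _).1 => [|[V' V'L V'y]].
      by apply: IHL => V' V'L; apply: Lc; rewrite inE V'L orbT.
    by apply: Wy; exists V' => //; rewrite inE V'L orbT.
  have [e [q [qh qW qy]]] : exists d p, [/\ p \is d.-homog,
      forall z, W z -> peval p z = 0 & peval p y != 0].
    apply: (zclosedP _).1 => [|W'y]; first by apply: Lc; rewrite inE eqxx.
    by apply: Wy; exists W => //; rewrite inE eqxx.
  exists (d + e)%N, (p * q); split; [exact: dhomogM| |by rewrite pevalM mulf_neq0].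
  move=> z [V']; rewrite inE pevalM => /orP[/eqP->|V'L] V'z.
    by rewrite qW ?mulr0.
  by rewrite pL ?mul0r //; exists V'.
have [|y Zy|ZV|ZU] := Zirr V U _ Uc; first by apply: Lc; rewrite inE eqxx.
- have [W] := ZL y Zy; rewrite inE => /orP[/eqP->|WL] Wy; first by left.
  by right; exists W.
- by exists V; rewrite // inE eqxx.
have [||W WL ZW] := IH; first by move=> W WL; apply: Lc; rewrite inE WL orbT.
  exact: ZU.
by exists W; rewrite // inE WL orbT.
Qed.

(** In an infinite strictly descending chain choose [p k] vanishing on the next set but not on
    [Z k]. Some [p k] is a combination of earlier [p i], and these all vanish on [Z k]. *)
Lemma zclosed_minimal (P : set (pspace K n) -> Prop) :
  (forall Z, P Z -> zclosed Z) -> (exists Z, P Z) ->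
  exists Z, P Z /\ forall Z', P Z' -> Z' `<=` Z -> Z' = Z.
Proof.
move=> Pc [Z0 PZ0]; apply: contrapT => /forallNP nmin.
have smaller (Z : {Z | P Z}) : exists Z' : {Z | P Z},
    sval Z' `<=` sval Z /\ ~ sval Z `<=` sval Z'.
  have /not_andP[/(_ (svalP Z)) //|/existsNP[Z' /not_implyP[PZ' /not_implyP[Z'Z neq]]]] :=
    nmin (sval Z).
  by exists (exist _ Z' PZ'); split=> // ZZ'; apply: neq; apply/seteqP.
have [s sP] := choice smaller.
pose Z := fix Z k := if k is k'.+1 then s (Z k') else exist P Z0 PZ0.
have desc i j : (i <= j)%N -> sval (Z j) `<=` sval (Z i).
  elim: j => [|j IH]; first by rewrite leqn0 => /eqP->.
  rewrite leq_eqVlt => /orP[/eqP-> //|/IH]; apply: subset_trans.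
  exact: (sP _).1.
have sep k : exists p, (forall z, sval (Z k.+1) z -> peval p z = 0) /\
    exists2 x, sval (Z k) x & peval p x != 0.
  have /existsNP[x /not_implyP[Zx Zx']] := (sP (Z k)).2.
  have [d [p [ph pZ px]]] := (zclosedP _).1 (Pc _ (svalP (s (Z k)))) x Zx'.
  by exists p; split=> //; exists x.
have [p pP] := choice sep.
have [k [c pk]] := hilbert_basis p.
have [_ [x Zx /eqP[]]] := pP k.
rewrite pk /peval raddf_sum big1 //= => i _.
rewrite mevalM -[_.@[_]]/(peval _ _) -/(peval (p i) x) (pP i).1 ?mulr0 //.
exact: desc Zx.
Qed.

(** A minimal closed set without a decomposition is nonempty and reducible, so it is the union of
    two smaller closed sets whose lists can be concatenated. The list may be redundant. *)
Lemma irreducible_components Z : zclosed Z ->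
  exists2 L : seq (set (pspace K n)), forall V, V \in L -> irred_closed V /\ V `<=` Z &
    forall x, Z x -> exists2 V, V \in L & V x.
Proof.
pose decomp Z := exists2 L : seq (set (pspace K n)),
    forall V, V \in L -> irred_closed V /\ V `<=` Z &
    forall x, Z x -> exists2 V, V \in L & V x.
move=> Zc; rewrite -/(decomp Z); apply: contrapT => ndec.
have [||V [[Vc nV] Vmin]] := @zclosed_minimal (fun Z => zclosed Z /\ ~ decomp Z).
- by move=> ? [].
- by exists Z.
have sub V' : zclosed V' -> ~ V `<=` V' -> decomp (V `&` V').
  move=> V'c VV'; apply: contrapT => nd; apply: VV'.
  have <- : V `&` V' = V.
    by apply: Vmin => [|x []//]; split=> //; exact: zclosedI.
  by move=> x [].
apply: nV.
have [V0|/forallNP V0] := pselect (V !=set0); last first.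
  by exists [::] => // x /V0.
have [Virr|nirr] := pselect (irred_closed V).
  exists [:: V] => [W|x Vx]; first by rewrite inE => /eqP->; split.
  by exists V; rewrite ?inE.
have [Z1 [Z2 [c1 c2 VZ [N1 N2]]]] : exists Z1 Z2,
    [/\ zclosed Z1, zclosed Z2, V `<=` Z1 `|` Z2 & ~ V `<=` Z1 /\ ~ V `<=` Z2].
  apply: contrapT => nex; apply: nirr; split=> // Z1 Z2 c1 c2 VZ.
  by apply: contrapT => /not_orP N; apply: nex; exists Z1, Z2.
have [L1 L1P L1c] := sub _ c1 N1; have [L2 L2P L2c] := sub _ c2 N2.
exists (L1 ++ L2) => [W|x Vx].
  by rewrite mem_cat => /orP[/L1P|/L2P] [Wirr WV]; split=> // y /WV[].
have [Zx|Zx] := VZ x Vx.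
  by have [W WL Wx] := L1c x (conj Vx Zx); exists W; rewrite // mem_cat WL.
by have [W WL Wx] := L2c x (conj Vx Zx); exists W; rewrite // mem_cat WL orbT.
Qed.

End ZariskiTopology.

(** * Rational functions and regular maps *)

Section Values.
Variables (K : closedFieldType) (n : nat) (X : projvar K n).
Implicit Types (phi psi : funfield X) (x : pspace K n).

Lemma pts_irred_set : irred_set (pts X).
Proof. by have [] := (irred_closedP _).1 (pts_irred X). Qed.

Lemma polyfrac_neq0 d (g : {mpoly K[n.+1]}) x :
  g \is d.-homog -> pts X x -> peval g x != 0 -> polyfrac X g != 0.
Proof.
by move=> gh Xx gx; rewrite polyfrac_eq0; apply/(notin_vanishP _ gh); exists x.
Qed.

Lemma takes_value_fraction phi d (f g : {mpoly K[n.+1]}) x :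
  f \is d.-homog -> g \is d.-homog -> val phi = polyfrac X f / polyfrac X g ->
  peval g x != 0 -> takes_value phi x (peval f x / peval g x).
Proof. by move=> fh gh pE gx; exists d, f, g. Qed.

Lemma funfield_fraction phi : exists d f g, [/\ f \is d.-homog, g \is d.-homog,
  exists2 x, pts X x & peval g x != 0 & val phi = polyfrac X f / polyfrac X g].
Proof.
have /asboolP[d [f [g [fh gh gX pE]]]] := valP phi.
by exists d, f, g; split=> //; apply/(notin_vanishP _ gh).
Qed.

Definition defined_at phi : set (pspace K n) := [set x | exists a, takes_value phi x a].

Lemma defined_at_open A phi : open_in A (defined_at phi).
Proof.
move=> x _ [a [d [f [g [fh gh gx pE _]]]]]; exists d, g; split=> // y _ gy.
by exists (peval f y / peval g y); exact: (takes_value_fraction fh gh pE gy).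
Qed.

Lemma defined_at_nonempty phi : pts X `&` defined_at phi !=set0.
Proof.
have [d [f [g [fh gh [x Xx gx] pE]]]] := funfield_fraction phi.
by exists x; split=> //; exists (peval f x / peval g x); exact: (takes_value_fraction fh gh pE gx).
Qed.

Lemma regular_alongE Y phi : regular_along Y phi <-> Y `&` defined_at phi !=set0.
Proof.
split=> [[d [f [g [fh gh [y Yy gy] pE]]]]|[y [Yy [a [d [f [g [fh gh gy pE _]]]]]]]].
  by exists y; split=> //; exists (peval f y / peval g y); exact: (takes_value_fraction fh gh pE gy).
by exists d, f, g; split=> //; exists y.
Qed.

Lemma eq_fractions d e (f g f' g' : {mpoly K[n.+1]}) x :
  g \is d.-homog -> g' \is e.-homog -> pts X x ->
  peval g x != 0 -> peval g' x != 0 ->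
  (polyfrac X f / polyfrac X g == polyfrac X f' / polyfrac X g') =
  (f * g' - f' * g \in vanish X).
Proof.
move=> gh gh' Xx gx gx'.
have g0 := polyfrac_neq0 gh Xx gx; have g0' := polyfrac_neq0 gh' Xx gx'.
rewrite (eqr_div _ _ g0 g0').
by rewrite -subr_eq0 -!polyfracM -polyfracB polyfrac_eq0.
Qed.

Lemma takes_value_uniq phi x a b : pts X x ->
  takes_value phi x a -> takes_value phi x b -> a = b.
Proof.
move=> Xx [d [f [g [fh gh gx pE ->]]]] [e [f' [g' [fh' gh' gx' pE' ->]]]].
move: pE; rewrite {}pE' => /esym/eqP; rewrite (eq_fractions _ _ gh gh' Xx) //.
move=> /asboolP /(_ x (vpick (val x)) Xx (memv_pick _)).
rewrite -[LHS]/(peval _ x) pevalB !pevalM => /eqP; rewrite subr_eq0 => /eqP fg.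
by apply/eqP; rewrite eqr_div // fg.
Qed.

Lemma takes_value_const c x : takes_value (constf X c) x c.
Proof.
exists 0%N, c%:MP, 1; split; rewrite ?/peval ?meval1 ?oner_eq0 //; try exact: homogC.
  by rewrite polyfrac1 divr1.
by rewrite mevalC divr1.
Qed.

Lemma takes_valueD phi psi x a b : pts X x ->
  takes_value phi x a -> takes_value psi x b -> takes_value (phi + psi) x (a + b).
Proof.
move=> Xx [d [f [g [fh gh gx pE ->]]]] [e [f' [g' [fh' gh' gx' pE' ->]]]].
exists (d + e)%N, (f * g' + f' * g), (g * g'); split.
- by apply: rpredD; [|rewrite addnC]; exact: dhomogM.
- exact: dhomogM.
- by rewrite pevalM mulf_neq0.
- have g0 := polyfrac_neq0 gh Xx gx; have g0' := polyfrac_neq0 gh' Xx gx'.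
  by rewrite ratfun_valD pE pE' (addf_div _ _ g0 g0') polyfracD !polyfracM.
- by rewrite pevalD !pevalM addf_div.
Qed.

Lemma takes_valueM phi psi x a b :
  takes_value phi x a -> takes_value psi x b -> takes_value (phi * psi) x (a * b).
Proof.
move=> [d [f [g [fh gh gx pE ->]]]] [e [f' [g' [fh' gh' gx' pE' ->]]]].
exists (d + e)%N, (f * f'), (g * g'); split; try exact: dhomogM.
- by rewrite pevalM mulf_neq0.
- by rewrite ratfun_valM pE pE' !polyfracM mulf_div.
- by rewrite !pevalM mulf_div.
Qed.

Lemma irred_meet O1 O2 : open_in (pts X) O1 -> open_in (pts X) O2 ->
  pts X `&` O1 !=set0 -> pts X `&` O2 !=set0 -> pts X `&` (O1 `&` O2) !=set0.
Proof. exact: pts_irred_set.2. Qed.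

(** Otherwise the form [f * g' - f' * g] is nonzero on a nonempty open set, which by irreducibility
    meets [O] and the loci where both denominators are nonzero. Agreement is only asked where both
    functions have a value. *)
Lemma funfield_eq phi psi O : open_in (pts X) O -> pts X `&` O !=set0 ->
  (forall x a b, pts X x -> O x -> takes_value phi x a -> takes_value psi x b -> a = b) ->
  phi = psi.
Proof.
move=> oO XO agree.
have [d [f [g [fh gh gX pE]]]] := funfield_fraction phi.
have [e [f' [g' [fh' gh' gX' pE']]]] := funfield_fraction psi.
have og := open_in_nonvanishing (A := pts X) gh.
have og' := open_in_nonvanishing (A := pts X) gh'.
have XG : pts X `&` ([set x | peval g x != 0] `&` [set x | peval g' x != 0]) !=set0.
  by apply: irred_meet => //; [case: gX => x|case: gX' => x]; exists x.
have oG := open_inI og og'.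
have [x0 [Xx0 [/= gx0 gx0']]] := XG.
apply: val_inj; rewrite pE pE'; apply/eqP; rewrite (eq_fractions _ _ gh gh' Xx0) //.
apply/negPn/negP => nv.
have hh : f * g' - f' * g \is (d + e).-homog.
  by apply: rpredB; [|rewrite addnC]; exact: dhomogM.
have [x1 Xx1 nx1] := (notin_vanishP _ hh).1 nv.
have [|x [Xx [[[/= gx gx'] Ox] /= /negP]]] := irred_meet (open_inI oG oO)
    (open_in_nonvanishing (A := pts X) hh) (irred_meet oG oO XG XO).
  by exists x1.
apply; rewrite pevalB !pevalM subr_eq0 -eqr_div //; apply/eqP.
by apply: agree Xx Ox _ _; [exact: (takes_value_fraction fh gh pE gx)|exact: (takes_value_fraction fh' gh' pE' gx')].
Qed.

End Values.

Section RegularMaps.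
Variables (K : closedFieldType) (n m : nat).

Lemma dhomog_bigprod I (r : seq I) (d : I -> nat) (f : I -> {mpoly K[n.+1]}) :
  (forall i, f i \is (d i).-homog) -> \prod_(i <- r) f i \is (\sum_(i <- r) d i).-homog.
Proof.
move=> fh; elim/big_rec2: _ => [|i e p _ ph]; first exact: dhomog1.
exact: dhomogM.
Qed.

Lemma dhomog_comp d e (F : 'I_m.+1 -> {mpoly K[n.+1]}) (p : {mpoly K[m.+1]}) :
  (forall i, F i \is d.-homog) -> p \is e.-homog ->
  p \mPo [tuple F i | i < m.+1] \is (d * e).-homog.
Proof.
move=> Fh /dhomogP ph; rewrite comp_mpolyEX big_seq rpred_sum // => s /ph <-.
apply: dhomogZ; rewrite comp_mpolyX.
have -> : (d * mdeg s = \sum_i d * s i)%N by rewrite mdegE big_distrr.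
by apply: dhomog_bigprod => i; rewrite tnth_mktuple; exact: dhomogMn.
Qed.

Lemma peval_comp (F : 'I_m.+1 -> {mpoly K[n.+1]}) (p : {mpoly K[m.+1]}) x :
  peval (p \mPo [tuple F i | i < m.+1]) x = p.@[fun i => peval (F i) x].
Proof.
rewrite /peval comp_mpoly_meval; apply: meval_eq => i.
by rewrite tnth_mktuple.
Qed.

Variables (A : set (pspace K n)) (pi : pspace K n -> pspace K m).
Hypothesis pi_reg : regular_map A pi.

(** The vector of the [F i] at [y] spans the line [pi y], so it is a nonzero multiple [t] of the
    chosen homogeneous coordinates. The factor depends on [y] but not on the form [p]. *)
Lemma regular_map_local x : A x ->
  exists d (F : 'I_m.+1 -> {mpoly K[n.+1]}) e h,
    [/\ forall i, F i \is d.-homog, h \is e.-homog, peval h x != 0 &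
      forall y, A y -> peval h y != 0 -> exists2 t, t != 0 &
        forall c (p : {mpoly K[m.+1]}), p \is c.-homog ->
          peval (p \mPo [tuple F i | i < m.+1]) y = t ^+ c * peval p (pi y)].
Proof.
move=> Ax; have [W [d [F [Wo Wx Fh FE]]]] := pi_reg Ax.
have [e [h [hh hx hW]]] := open_in_zopen (A := A) Wo Ax Wx.
exists d, F, e, h; split=> // y Ay /(hW _ Ay) Wy.
have piE := FE y Ay Wy.
have [|t tE] := @memv_pspace _ _ (pi y) (\row_i peval (F i) y).
  by rewrite piE memv_line.
exists t => [|c p ph]; last first.
  by rewrite peval_comp -(homog_scale _ _ ph); apply: meval_eq => i; rewrite -tE mxE.
apply/eqP => t0; have := valP (pi y); rewrite piE dim_vline.
suff -> : \row_i peval (F i) y = 0 by rewrite eqxx.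
by apply/rowP => i; rewrite tE t0 mul0r mxE.
Qed.

Lemma regular_map_continuous e (p : {mpoly K[m.+1]}) : p \is e.-homog ->
  open_in A [set x | peval p (pi x) != 0].
Proof.
move=> ph x Ax /= px; have [d [F [c [h [Fh hh hx hF]]]]] := regular_map_local Ax.
exists (c + d * e)%N, (h * (p \mPo [tuple F i | i < m.+1])); split.
- by apply: dhomogM => //; exact: dhomog_comp.
- by have [t t0 tE] := hF x Ax hx; rewrite pevalM (tE _ _ ph) !mulf_neq0 ?expf_neq0.
move=> y Ay; rewrite pevalM mulf_eq0 negb_or => /andP[hy].
have [t t0 tE] := hF y Ay hy.
by rewrite (tE _ _ ph) mulf_eq0 negb_or => /andP[].
Qed.

Lemma open_in_preimage (B O : set (pspace K m)) :
  (forall x, A x -> B (pi x)) -> open_in B O -> open_in A (pi @^-1` O).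
Proof.
move=> AB oO x Ax Ox; have [d [p [ph px pO]]] := oO _ (AB _ Ax) Ox.
have [e [q [qh qx qO]]] := regular_map_continuous ph Ax px.
by exists e, q; split=> // y Ay /(qO _ Ay) /pO; apply; exact: AB.
Qed.

Lemma irred_set_image : irred_set A -> irred_set (pi @` A).
Proof.
move=> [[x Ax] Airr]; split; first by exists (pi x), x.
have Api y : A y -> (pi @` A) (pi y) by move=> Ay; exists y.
move=> O1 O2 /(open_in_preimage Api) o1 /(open_in_preimage Api) o2.
move=> [_ [[y Ay <-] O1y]] [_ [[z Az <-] O2z]].
have [||w [Aw [O1w O2w]]] := Airr _ _ o1 o2; [by exists y|by exists z|].
by exists (pi w).
Qed.

End RegularMaps.

Definition rmorphism_of (A B : pzRingType) (f : A -> B)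
    (fB : zmod_morphism f) (fM : monoid_morphism f) : {rmorphism A -> B} :=
  HB.pack f (GRing.isZmodMorphism.Build A B f fB) (GRing.isMonoidMorphism.Build A B f fM).

Definition additive_of (A B : zmodType) (f : A -> B) (fB : zmod_morphism f) :
    {additive A -> B} :=
  HB.pack f (GRing.isZmodMorphism.Build A B f fB).

(** Symmetric in the two sides, so that every transport lemma also serves for the inverse through
    [open_iso_sym]. *)
Record open_iso (K : closedFieldType) (n m : nat) (X : projvar K n) (X' : projvar K m)
    (A : set (pspace K n)) (B : set (pspace K m))
    (pi : pspace K n -> pspace K m) (rho : pspace K m -> pspace K n) : Prop := OpenIso {
  iso_subl : A `<=` pts X;
  iso_subr : B `<=` pts X';
  iso_openl : open_in (pts X) A;
  iso_openr : open_in (pts X') B;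
  iso_nonempty : A !=set0;
  iso_map : forall x, A x -> B (pi x);
  iso_inv : forall y, B y -> A (rho y);
  iso_mapK : forall x, A x -> rho (pi x) = x;
  iso_invK : forall y, B y -> pi (rho y) = y;
  iso_reg : regular_map A pi;
  iso_inv_reg : regular_map B rho }.

Lemma open_iso_sym (K : closedFieldType) (n m : nat) (X : projvar K n) (X' : projvar K m)
    A B pi rho : open_iso X X' A B pi rho -> open_iso X' X B A rho pi.
Proof. by case=> ? ? ? ? [x Ax] ? ? ? ? ? ?; split=> //; exists (pi x); auto. Qed.

(** * Isomorphisms of open subsets *)

Section FunctionTransport.
Variables (K : closedFieldType) (n m : nat) (X : projvar K n) (X' : projvar K m).
Variables (A : set (pspace K n)) (B : set (pspace K m)).
Variables (pi : pspace K n -> pspace K m) (rho : pspace K m -> pspace K n).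
Hypothesis iso : open_iso X X' A B pi rho.
Implicit Types (phi : funfield X) (psi : funfield X').

Let AX := iso_subl iso.
Let BX := iso_subr iso.

Lemma iso_meets O : open_in (pts X) O -> pts X `&` O !=set0 -> pts X `&` (A `&` O) !=set0.
Proof.
move=> oO XO; apply: irred_meet => //; first exact: iso_openl iso.
by have [x Ax] := iso_nonempty iso; exists x; split=> //; exact: AX.
Qed.

(** Compose numerator and denominator with local polynomials for [pi]; having equal degree, they
    acquire the same power of the scaling factor, which cancels. *)
Lemma pullback_local psi x b : A x -> takes_value psi (pi x) b ->
  exists phi, takes_value phi x b /\
    exists O, [/\ open_in (pts X) O, O x &
      forall y, A y -> O y -> exists2 a, takes_value phi y a & takes_value psi (pi y) a].
Proof.
move=> Ax [c [f [g [fh gh gx pE bE]]]].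
have [d [F [e [h [Fh hh hx hF]]]]] := regular_map_local (iso_reg iso) Ax.
pose comp p := p \mPo [tuple F i | i < m.+1].
have compV y : A y -> peval h y != 0 -> peval g (pi y) != 0 ->
    peval (comp g) y != 0 /\
    peval (comp f) y / peval (comp g) y = peval f (pi y) / peval g (pi y).
  move=> Ay hy gy; have [t t0 tE] := hF y Ay hy.
  rewrite (tE _ _ fh) (tE _ _ gh) mulf_neq0 ?expf_neq0 //; split=> //.
  by rewrite -mulf_div divff ?mul1r // expf_neq0.
have [cgx valx] := compV x Ax hx gx.
have cfh : comp f \is (d * c).-homog by exact: dhomog_comp.
have cgh : comp g \is (d * c).-homog by exact: dhomog_comp.
have ratP : is_ratfun (polyfrac X (comp f) / polyfrac X (comp g)).
  apply/asboolP; exists (d * c)%N, (comp f), (comp g); split=> //.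
  by apply/(notin_vanishP _ cgh); exists x => //; exact: AX.
pose phi : funfield X := exist (fun b => is_ratfun b) _ ratP.
exists phi; split.
  by rewrite bE -valx; exact: (takes_value_fraction (phi := phi) cfh cgh).
exists (A `&` ([set y | peval h y != 0] `&` [set y | peval g (pi y) != 0])); split.
- apply: open_in_trans; first exact: iso_openl iso.
  apply: open_inI; first exact: open_in_nonvanishing hh.
  exact: (regular_map_continuous (iso_reg iso) gh).
- by [].
move=> y Ay [_ [/= hy gy]]; have [cgy valy] := compV y Ay hy gy.
exists (peval f (pi y) / peval g (pi y)); last exact: (takes_value_fraction fh gh pE gy).
by rewrite -valy; exact: (takes_value_fraction (phi := phi) cfh cgh).
Qed.

Lemma pullback_defined psi : A `&` (pi @^-1` defined_at psi) !=set0.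
Proof.
have isoV := open_iso_sym iso.
have [|y [_ [By Dy]]] := irred_meet (iso_openr iso) (@defined_at_open _ _ _ (pts X') psi) _
    (defined_at_nonempty psi).
  by have [y By] := iso_nonempty isoV; exists y; split=> //; exact: BX.
by exists (rho y); split; [exact: (iso_inv iso By)|rewrite /= (iso_invK iso)].
Qed.

(** The local pullback at one point works everywhere: a local pullback at another point takes the
    same values on a nonempty open set and hence is the same rational function. *)
Lemma pullback psi : exists phi, forall x a, A x ->
  takes_value psi (pi x) a -> takes_value phi x a.
Proof.
have [x1 [Ax1 [b1 x1b1]]] := pullback_defined psi.
have [phi [_ [O1 [oO1 O1x1 agree1]]]] := pullback_local Ax1 x1b1.
exists phi => x0 b Ax0 x0b.
have [phi0 [phi0b [O0 [oO0 O0x0 agree0]]]] := pullback_local Ax0 x0b.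
suff -> : phi = phi0 by [].
apply: (@funfield_eq _ _ _ _ _ (A `&` (O1 `&` O0))).
- by apply: open_inI; [exact: iso_openl iso|exact: open_inI].
- apply: iso_meets; first exact: open_inI.
  by apply: irred_meet => //; [exists x1|exists x0]; split=> //; exact: AX.
move=> x a a' Xx [Ax [O1x O0x]] phia phi0a'.
have [c c1 c2] := agree1 x Ax O1x; have [c' c1' c2'] := agree0 x Ax O0x.
rewrite (takes_value_uniq Xx phia c1) (takes_value_uniq Xx phi0a' c1').
by apply: takes_value_uniq c2 c2'; exact/BX/(iso_map iso).
Qed.

(** The equivalence compares domains as well as values: on [A], [phi] is defined exactly where [psi]
    is defined at the image. Regularity along subsets is transported by this. *)
Definition same_function phi psi : Prop := forall x, A x ->
  forall a, takes_value phi x a <-> takes_value psi (pi x) a.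

Lemma same_function_inj phi psi psi' : same_function phi psi -> same_function phi psi' ->
  psi = psi'.
Proof.
move=> sp sp'; apply: (@funfield_eq _ _ _ _ _ B).
- exact: iso_openr iso.
- by have [y By] := iso_nonempty (open_iso_sym iso); exists y; split=> //; exact: BX.
move=> y a b Xy By; rewrite -(iso_invK iso By).
have Ay := iso_inv iso By.
by move=> /(sp _ Ay) pa /(sp' _ Ay); apply: takes_value_uniq pa; exact: AX.
Qed.

End FunctionTransport.

Section FunctionFieldIso.
Variables (K : closedFieldType) (n m : nat) (X : projvar K n) (X' : projvar K m).
Variables (A : set (pspace K n)) (B : set (pspace K m)).
Variables (pi : pspace K n -> pspace K m) (rho : pspace K m -> pspace K n).
Hypothesis iso : open_iso X X' A B pi rho.
Implicit Types (phi : funfield X) (psi : funfield X').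

Lemma same_functionV phi psi : same_function A pi phi psi -> same_function B rho psi phi.
Proof.
move=> s y By a; rewrite -{1}(iso_invK iso By).
by apply: iff_sym; apply: s; exact: (iso_inv iso By).
Qed.

(** Pulling back along the inverse transfers values in one direction only. For the other, pull the
    result back along [pi]; the outcome agrees with [phi] on [A] and so equals it. *)
Lemma same_function_ex phi : exists psi, same_function A pi phi psi.
Proof.
have [psi psiP] := pullback (open_iso_sym iso) phi.
have [phi' phi'P] := pullback iso psi.
have psiP' x a : A x -> takes_value phi x a -> takes_value psi (pi x) a.
  move=> Ax phia; apply: psiP; first exact: (iso_map iso Ax).
  by rewrite (iso_mapK iso).
exists psi => x Ax a; split; first exact: psiP'.
suff -> : phi = phi' by exact: phi'P.
apply: (@funfield_eq _ _ _ _ _ A); first exact: iso_openl iso.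
  by have [y Ay] := iso_nonempty iso; exists y; split=> //; exact: (iso_subl iso Ay).
move=> y b c Xy Ay pb pc; apply: takes_value_uniq Xy _ pc.
by apply: phi'P => //; exact: psiP'.
Qed.

(** Covers sums and products at once, which makes the transport of functions a ring homomorphism. *)
Lemma same_function_op phi1 phi2 phi3 psi1 psi2 psi3 psi' (op : K -> K -> K) :
  same_function A pi phi1 psi1 -> same_function A pi phi2 psi2 ->
  same_function A pi phi3 psi3 ->
  (forall x a b, pts X x -> takes_value phi1 x a -> takes_value phi2 x b ->
     takes_value phi3 x (op a b)) ->
  (forall x a b, pts X' x -> takes_value psi1 x a -> takes_value psi2 x b ->
     takes_value psi' x (op a b)) ->
  psi3 = psi'.
Proof.
move=> s1 s2 s3 op3 op'.
have isoV := open_iso_sym iso.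
apply: (@funfield_eq _ _ _ _ _ (B `&` (defined_at psi1 `&` defined_at psi2))).
- apply: open_inI; first exact: iso_openr iso.
  by apply: open_inI; exact: defined_at_open.
- apply: (iso_meets isoV); first by apply: open_inI; exact: defined_at_open.
  by apply: irred_meet; try exact: defined_at_open; exact: defined_at_nonempty.
move=> y a b X'y [By [[c c1] [d d2]]] ta tb.
have Ay := iso_inv iso By.
rewrite (takes_value_uniq X'y tb (op' _ _ _ X'y c1 d2)).
apply: takes_value_uniq X'y ta _.
have yE := iso_invK iso By.
rewrite -yE; apply/(s3 _ Ay); apply: op3; first exact: (iso_subl iso Ay).
  by apply/(s1 _ Ay); rewrite yE.
by apply/(s2 _ Ay); rewrite yE.
Qed.

Lemma same_function_const c : same_function A pi (constf X c) (constf X' c).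
Proof.
move=> x Ax a; split=> ta.
  have := takes_value_const X c x.
  move=> /(takes_value_uniq (iso_subl iso Ax) ta) ->; exact: takes_value_const.
have := takes_value_const X' c (pi x).
move=> /(takes_value_uniq (iso_subr iso (iso_map iso Ax)) ta) ->; exact: takes_value_const.
Qed.

Lemma funfield_iso : exists sigma : {rmorphism funfield X -> funfield X'},
  forall phi, same_function A pi phi (sigma phi).
Proof.
have [s sP] := choice same_function_ex.
have sD phi1 phi2 : s (phi1 + phi2) = s phi1 + s phi2.
  by apply: (same_function_op (sP _) (sP _) (sP _)) => x a b Xx; exact: takes_valueD.
have sM phi1 phi2 : s (phi1 * phi2) = s phi1 * s phi2.
  by apply: (same_function_op (sP _) (sP _) (sP _)) => x a b Xx; exact: takes_valueM.
have sC c : s (constf X c) = constf X' c.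
  exact: (same_function_inj iso (sP _) (same_function_const c)).
have sB : zmod_morphism s by move=> a b; apply/eqP; rewrite eq_sym subr_eq -sD subrK.
have s1 : monoid_morphism s by split; rewrite -?(constf1 X) ?sC ?constf1.
by exists (rmorphism_of sB s1).
Qed.

End FunctionFieldIso.

(** * Strict transforms of irreducible closed sets *)

Section DivisorTransport.
Variables (K : closedFieldType) (n m : nat) (X : projvar K n) (X' : projvar K m).
Variables (A : set (pspace K n)) (B : set (pspace K m)).
Variables (pi : pspace K n -> pspace K m) (rho : pspace K m -> pspace K n).
Hypothesis iso : open_iso X X' A B pi rho.
Implicit Types (phi : funfield X) (psi : funfield X').

Definition strict_transform (f : pspace K n -> pspace K m) (O Z : set (pspace K n)) :
  set (pspace K m) := zclosure (f @` (Z `&` O)).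

Let AX := iso_subl iso.
Let BX := iso_subr iso.

Variable Z : set (pspace K n).
Hypotheses (Zirr : irred_closed Z) (ZX : Z `<=` pts X) (ZA : Z `&` A !=set0).

Let Z' := strict_transform pi A Z.

Lemma open_in_iso : open_in Z A.
Proof. exact: open_inW ZX (iso_openl iso). Qed.

Lemma irred_set_trace : irred_set (Z `&` A).
Proof.
by apply: irred_set_open => //; [have [] := (irred_closedP _).1 Zirr|exact: open_in_iso].
Qed.

Lemma strict_transform_irred : irred_closed Z'.
Proof.
apply: irred_set_closure; apply: irred_set_image irred_set_trace => x [_ Ax].
have [W [d [F [Wo Wx Fh FE]]]] := iso_reg iso Ax.
by exists W, d, F; split=> // y [_ Ay]; exact: FE.
Qed.

Lemma strict_transform_sub : Z' `<=` pts X'.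
Proof.
apply: zclosure_sub; first by have [] := pts_irred X'.
by move=> _ [x [_ Ax] <-]; exact/BX/(iso_map iso).
Qed.

(** The closure adds no point of [B]: a form separating [rho y] from [Z], pulled back along [rho],
    gives a neighbourhood of [y] that misses the image. *)
Lemma strict_transform_trace : Z' `&` B = pi @` (Z `&` A).
Proof.
apply/seteqP; split=> [y [Z'y By]|_ [x [Zx Ax] <-]]; last first.
  by split; [apply: subset_zclosure; exists x|exact: (iso_map iso Ax)].
have Ay := iso_inv iso By; have yE := iso_invK iso By.
exists (rho y) => //; split=> //; apply: contrapT => nZ.
have [d [p [ph pZ py]]] := (zclosedP Z).1 ((irred_closedP _).1 Zirr).1 _ nZ.
have [e [q [qh qy qB]]] := open_in_trans (iso_openr iso)
  (regular_map_continuous (iso_inv_reg iso) ph) (BX By) (conj By py).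
move: qy; rewrite ((zclosureP _ _).1 Z'y e) ?eqxx // => _ [x [Zx Ax] <-].
apply/eqP/negPn/negP => /(qB _ (BX (iso_map iso Ax)))[_ /=].
by rewrite (iso_mapK iso Ax) pZ ?eqxx.
Qed.

Lemma strict_transform_meets : Z' `&` B !=set0.
Proof. by rewrite strict_transform_trace; have [x xZA] := ZA; exists (pi x), x. Qed.

Lemma strict_transform_inv_trace : rho @` (Z' `&` B) = Z `&` A.
Proof.
rewrite strict_transform_trace; apply/seteqP; split=> [_ [_ [x [Zx Ax] <-] <-]|x [Zx Ax]].
  by rewrite (iso_mapK iso).
by exists (pi x); [exists x|rewrite (iso_mapK iso)].
Qed.

Lemma strict_transformK : zclosure (rho @` (Z' `&` B)) = Z.
Proof. by rewrite strict_transform_inv_trace; apply: irred_closed_dense => //; exact: open_in_iso. Qed.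

(** By irreducibility of [Z], a function defined at some point of [Z] is defined at a point of its
    trace on [A], and there the two functions correspond pointwise. *)
Lemma regular_along_transform phi psi : same_function A pi phi psi ->
  regular_along Z phi <-> regular_along Z' psi.
Proof.
move=> s; rewrite !regular_alongE.
have meets k (V O : set (pspace K k)) (Y : projvar K k) (chi : funfield Y) :
    irred_closed V -> open_in V O -> V `&` O !=set0 ->
    V `&` defined_at chi !=set0 -> V `&` (O `&` defined_at chi) !=set0.
  by move=> /irred_closedP[_ [_]] Virr oO VO; apply: Virr => //; exact: defined_at_open.
split=> [/(meets _ _ _ _ _ Zirr open_in_iso ZA)[x [Zx [Ax [a xa]]]]|].
  exists (pi x); split; last by exists a; apply/s.
  by apply: subset_zclosure; exists x.
move=> /(meets _ _ _ _ _ strict_transform_irred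
  (open_inW strict_transform_sub (iso_openr iso)) strict_transform_meets).
move=> [y [Z'y [By [a ya]]]].
have : (rho @` (Z' `&` B)) (rho y) by exists y.
rewrite strict_transform_inv_trace => -[Zy Ay]; exists (rho y); split=> //.
by exists a; apply/(s _ Ay); rewrite (iso_invK iso By).
Qed.

End DivisorTransport.

(** An irreducible [V] containing the transform also meets [B], hence is recovered from its own
    transform back to [X]. Maximality is thereby reduced to that of [Z]. *)
Lemma strict_transform_prime (K : closedFieldType) (n m : nat) (X : projvar K n)
    (X' : projvar K m) A B pi rho Z : open_iso X X' A B pi rho ->
  prime_divisor X Z -> Z `&` A !=set0 -> prime_divisor X' (strict_transform pi A Z).
Proof.
move=> iso [Zirr ZX ZneqX Zmax] ZA; have isoV := open_iso_sym iso.
have AX := iso_subl iso; have BX := iso_subr iso.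
set Z' := strict_transform pi A Z.
have ZK : strict_transform rho B Z' = Z by exact: (strict_transformK iso).
have XA : pts X `&` A !=set0 by have [x [_ Ax]] := ZA; exists x; split=> //; exact: AX.
have Xirr := pts_irred X.
have XE : strict_transform rho B (pts X') = pts X.
  rewrite /strict_transform -[RHS](irred_closed_dense Xirr (iso_openl iso) XA).
  congr zclosure; apply/seteqP; split=> [_ [y [_ By] <-]|x [_ Ax]].
    by have Ay := iso_inv iso By; split=> //; exact: AX.
  exists (pi x); last exact: (iso_mapK iso Ax).
  by have Bx := iso_map iso Ax; split=> //; exact: BX.
split.
- exact: (strict_transform_irred iso).
- exact: (strict_transform_sub iso).
- by move=> Z'X; apply: ZneqX; rewrite -ZK Z'X.
move=> V Virr Z'V VX'.
have VB : V `&` B !=set0.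
  have [y [Z'y By]] := strict_transform_meets iso Zirr ZA.
  by exists y; split=> //; exact: Z'V.
have VK : strict_transform pi A (strict_transform rho B V) = V.
  exact: (strict_transformK isoV).
have [||||] := Zmax (strict_transform rho B V).
- exact: (strict_transform_irred isoV).
- by rewrite -ZK; apply: zclosureS => _ [y [Z'y By] <-]; exists y => //; split=> //; exact: Z'V.
- exact: (strict_transform_sub isoV).
- by left; rewrite -VK -/Z' /Z'; congr strict_transform.
move=> VE; right; apply/seteqP; split=> //.
rewrite -VK VE -XE.
suff -> : strict_transform pi A (strict_transform rho B (pts X')) = pts X' by [].
apply: (strict_transformK isoV) => //; first exact: pts_irred.
by have [y [_ By]] := VB; exists y; split=> //; exact: BX.
Qed.

(** * Orders along prime divisors *)

Section Orders.
Variables (K : closedFieldType) (n : nat) (X : projvar K n).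
Implicit Types (phi psi t u : funfield X) (k l : int).

Section Along.
Variable Y : set (pspace K n).
Hypotheses (Yirr : irred_closed Y) (YX : Y `<=` pts X).

Lemma regular_along0 : regular_along Y (0 : funfield X).
Proof. by rewrite -constf0; exact: regular_along_const. Qed.

Lemma regular_along1 : regular_along Y (1 : funfield X).
Proof. by rewrite -constf1; exact: regular_along_const. Qed.

Lemma regular_alongX phi i : regular_along Y phi -> regular_along Y (phi ^+ i).
Proof.
move=> pY; elim: i => [|i IH]; first exact: regular_along1.
by rewrite exprS; exact: regular_alongM.
Qed.

Lemma regular_alongXz phi k : regular_along Y phi -> regular_along Y phi^-1 ->
  regular_along Y (phi ^ k).
Proof. by case: k => i pY pVY; [|rewrite NegzE -exprz_inv]; exact: regular_alongX. Qed.

Lemma regular_along_sum I (r : seq I) (F : I -> funfield X) :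
  (forall i, regular_along Y (F i)) -> regular_along Y (\sum_(i <- r) F i).
Proof.
by move=> FY; elim/big_ind: _ => //; [exact: regular_along0|exact: regular_alongD].
Qed.

(* Otherwise the ideals generated by the numerators of the [phi / t ^ i] would
   form a strictly increasing chain. *)
Lemma bounded_divisibility phi t : phi != 0 -> t != 0 -> regular_along Y t ->
  ~ regular_along Y t^-1 -> exists i, ~ regular_along Y (phi / t ^+ i).
Proof.
move=> phi0 t0 tY tVY; apply: contrapT => /forallNP allY.
have frac i : exists w : nat * ({mpoly K[n.+1]} * {mpoly K[n.+1]}),
    [/\ w.2.1 \is w.1.-homog, w.2.2 \is w.1.-homog,
    exists2 y, Y y & peval w.2.2 y != 0 &
    val (phi / t ^+ i) = polyfrac X w.2.1 / polyfrac X w.2.2].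
  by have /contrapT[d [f [g fgP]]] := allY i; exists (d, (f, g)).
have [w wP] := choice frac.
have fh i : (w i).2.1 \is (w i).1.-homog by have [] := wP i.
have [k [c [fk ch]]] := hilbert_basis_homog fh.
have [fkh gkh gkY pkE] := wP k.
have gk0 := regular_denom YX gkh gkY.
(* The coefficient becomes regular after multiplication by the old denominator and division by that
   of index [k], which is nonzero at a point of [Y]. *)
have coefY i : exists2 a, regular_along Y a &
    val a = polyfrac X (c i * (w i).2.2) / polyfrac X (w k).2.2.
  have [_ gih _ _] := wP i.
  have ratP : is_ratfun (polyfrac X (c i * (w i).2.2) / polyfrac X (w k).2.2).
    apply/asboolP; exists (w k).1, (c i * (w i).2.2), (w k).2.2; split=> //; first exact: ch.
    by rewrite -polyfrac_eq0.
  exists (exist (fun b => is_ratfun b) _ ratP) => //.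
  by exists (w k).1, (c i * (w i).2.2), (w k).2.2; split=> //; exact: ch.
have [a aY aE] : exists2 a : nat -> funfield X, forall i, regular_along Y (a i) &
    forall i, val (a i) = polyfrac X (c i * (w i).2.2) / polyfrac X (w k).2.2.
  have coefY' i : exists a, regular_along Y a /\
      val a = polyfrac X (c i * (w i).2.2) / polyfrac X (w k).2.2.
    by have [a] := coefY i; exists a.
  by have [a aP] := choice coefY'; exists a => i; have [] := aP i.
have phiE : phi / t ^+ k = \sum_(i < k) a i * (phi / t ^+ i).
  apply: val_inj; rewrite pkE fk [RHS](raddf_sum val).
  rewrite (big_morph _ (@polyfracD _ _ X) (_ : polyfrac X 0 = 0)) ?mulr_suml; last first.
    by apply/eqP; rewrite polyfrac_eq0 rpred0.
  apply: eq_bigr => i _; have [_ gih giY piE] := wP i.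
  rewrite [RHS]ratfun_valM aE piE !polyfracM mulf_div.
  have gi0 := regular_denom YX gih giY.
  by rewrite [X in _ = X / _]mulrAC -mulf_div (divff gi0) mulr1.
apply: tVY.
(* Divide the relation for [phi / t ^+ k] by [phi / t ^+ k] and by [t]. Every [i] is below [k], so
   the remaining exponents are nonnegative and [t^-1] is regular, a contradiction. *)
suff -> : t^-1 = \sum_(i < k) a i * t ^+ (k - i.+1).
  apply: regular_along_sum => i; apply: regular_alongM => //; exact: regular_alongX.
have x0 : phi / t ^+ k != 0 := mulf_neq0 phi0 (invr_neq0 (expf_neq0 k t0)).
have divt i : (i < k)%N -> phi / t ^+ i / t = phi / t ^+ k * t ^+ (k - i.+1).
  move=> ik; rewrite -[LHS](divfK (expf_neq0 (k - i.+1) t0)); congr (_ * _).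
  by rewrite -!mulrA -!invfM mulrA -exprSr -exprD subnKC.
apply: (mulfI x0); rewrite mulr_sumr {1}phiE mulr_suml.
by apply: eq_bigr => i _; rewrite -mulrA divt // mulrCA.
Qed.

(** Divide by [t] as long as the result is regular, which must stop by [bounded_divisibility]. If
    the inverse of the last quotient were not regular, the defining property of a uniformizer would
    permit one more division. *)
Lemma uniformizer_factor_regular phi t : uniformizer Y t -> regular_along Y phi ->
  phi != 0 -> exists i u, [/\ phi = u * t ^+ i, regular_along Y u & regular_along Y u^-1].
Proof.
move=> [tY t0 tVY tmax] pY p0.
have [i0 i0P] := bounded_divisibility p0 t0 tY tVY.
have exP : exists i, `[< ~ regular_along Y (phi / t ^+ i) >] by exists i0; apply/asboolP.
case: (ex_minnP exP) => -[/asboolP[]|i /asboolP iP imin]; first by rewrite expr0 divr1.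
exists i, (phi / t ^+ i); split; first by rewrite (divfK (expf_neq0 i t0)).
  by apply: contrapT => /asboolP/imin; rewrite ltnn.
apply: contrapT => uV; apply: iP; rewrite exprSr invfM mulrA; apply: tmax => //.
by apply: contrapT => /asboolP/imin; rewrite ltnn.
Qed.

Lemma quotient_of_regular phi : exists a b,
  [/\ regular_along Y a, regular_along Y b, b != 0 & phi = a / b].
Proof.
have [d [f [g [fh gh [x Xx gx] pE]]]] := funfield_fraction phi.
have [_ [y Yy] _] := Yirr.
have [i yi] : exists i, hcoord y i != 0.
  apply: contrapT => /forallNP yi; have := valP y; rewrite /= -[\dim _ == _]/(_ == 1%N).
  have -> : val y = 0%VS; last by rewrite dimv0.
  apply/eqP; rewrite -vpick0; apply/eqP/rowP => i; rewrite mxE.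
  by apply/eqP/negPn/negP; exact: yi.
(* A common denominator of the degree of [f] and [g], not vanishing identically on [Y]. *)
pose h : {mpoly K[n.+1]} := 'X_i ^+ d.
have hh : h \is d.-homog.
  by rewrite -[d]mul1n; apply: dhomogMn; rewrite dhomogX; apply/eqP; exact: mdeg1.
have hy : peval h y != 0 by rewrite /peval rmorphXn /= mevalXU expf_neq0.
have hY : exists2 y, Y y & peval h y != 0 by exists y.
have h0 := regular_denom YX hh hY.
have g0 := polyfrac_neq0 gh Xx gx.
have ratP p : p \is d.-homog -> is_ratfun (polyfrac X p / polyfrac X h).
  by move=> ph; apply/asboolP; exists d, p, h; split; rewrite -?polyfrac_eq0.
exists (exist (fun b => is_ratfun b) _ (ratP _ fh)), (exist (fun b => is_ratfun b) _ (ratP _ gh)).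
split; first by exists d, f, h.
- by exists d, g, h.
- by apply/eqP => /(congr1 val)/eqP; apply/negP; exact: (mulf_neq0 g0 (invr_neq0 h0)).
by apply: val_inj; rewrite pE ratfun_valM /= invf_div mulrA (divfK h0).
Qed.

Lemma uniformizer_factor phi t : uniformizer Y t -> phi != 0 ->
  exists k u, [/\ phi = u * t ^ k, regular_along Y u & regular_along Y u^-1].
Proof.
move=> tu p0; have [a [b [aY bY b0 pE]]] := quotient_of_regular phi.
have a0 : a != 0 by apply: contraNneq p0 => a0; rewrite pE a0 mul0r.
have [i [u [aE uY uVY]]] := uniformizer_factor_regular tu aY a0.
have [j [v [bE vY vVY]]] := uniformizer_factor_regular tu bY b0.
have t0 : t != 0 by case: tu.
exists (i%:Z - j%:Z), (u / v); split.
- by rewrite pE aE bE expfzDr // -exprnN invfM mulrACA.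
- exact: regular_alongM.
- by rewrite invfM invrK; exact: regular_alongM.
Qed.

Lemma uniformizer_ratio t t' : uniformizer Y t -> uniformizer Y t' ->
  regular_along Y (t / t').
Proof. by move=> [tY _ tVY _] [_ _ _]; apply. Qed.

(** The exponent found for one uniformizer serves for all, since two uniformizers differ by a unit
    of the local ring. *)
Lemma has_ord_ex phi : phi != 0 -> exists k, has_ord Y phi k.
Proof.
move=> p0; have [[t tu]|noU] := pselect (exists t, uniformizer Y t); last first.
  (* Without a uniformizer the two order conditions are vacuous, and 0 is a placeholder. *)
  by exists 0; split=> // t tu; case: noU; exists t.
have [k [u [pE uY uVY]]] := uniformizer_factor tu p0.
have t0 : t != 0 by case: tu.
have ratioY t' : uniformizer Y t' ->
    regular_along Y (t / t') /\ regular_along Y (t / t')^-1.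
  by move=> tu'; rewrite invf_div; split; exact: uniformizer_ratio.
exists k; split=> // t' tu'; have [rY rVY] := ratioY t' tu'.
  rewrite pE -mulrA -exprz_inv -expfzMl; apply: regular_alongM => //.
  exact: regular_alongXz.
rewrite pE invfM opprK -mulrA invr_expz -exprz_inv -expfzMl mulrC [_^-1 * _]mulrC.
rewrite -[t' / t]invf_div; apply: regular_alongM => //.
by apply: regular_alongXz; rewrite ?invrK.
Qed.

Lemma ord_ge_le phi k l : l <= k -> ord_ge Y phi k -> ord_ge Y phi l.
Proof.
move=> lk pk t tu; have [tY t0 _ _] := tu.
have [i iE] : exists i : nat, k - l = i by exists (absz (k - l)); rewrite gez0_abs ?Num.Theory.subr_ge0.
have -> : - l = - k + i by rewrite -iE addKr.
rewrite expfzDr // mulrA; apply: regular_alongM => //; first exact: pk.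
exact: regular_alongX.
Qed.

Lemma ord_ge0 k : ord_ge Y (0 : funfield X) k.
Proof. by move=> t _; rewrite mul0r; exact: regular_along0. Qed.

Lemma ord_ge_ex phi : exists k, ord_ge Y phi k.
Proof.
have [->|/has_ord_ex[k []]] := eqVneq phi 0; last by exists k.
by exists 0; exact: ord_ge0.
Qed.

Lemma ord_geM phi psi k l :
  ord_ge Y phi k -> ord_ge Y psi l -> ord_ge Y (phi * psi) (k + l).
Proof.
move=> pk pl t tu; have [_ t0 _ _] := tu.
by rewrite opprD expfzDr // mulrACA; apply: regular_alongM; [|exact: pk|exact: pl].
Qed.

Lemma has_ordM phi psi k l :
  has_ord Y phi k -> has_ord Y psi l -> has_ord Y (phi * psi) (k + l).
Proof.
move=> [p0 pk pVk] [q0 ql qVl]; split; first exact: (mulf_neq0 p0 q0).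
  exact: ord_geM.
by rewrite invfM opprD; exact: ord_geM.
Qed.

Lemma has_ordV phi k : has_ord Y phi k -> has_ord Y phi^-1 (- k).
Proof. by move=> [p0 pk pVk]; split; [exact: (invr_neq0 p0)|exact: pVk|rewrite invrK opprK]. Qed.

Lemma has_ord1 : has_ord Y (1 : funfield X) 0.
Proof.
have o1 : ord_ge Y (1 : funfield X) 0.
  by move=> t _; rewrite oppr0 expr0z mulr1; exact: regular_along1.
by split; [exact: oner_neq0|exact: o1|rewrite invr1 oppr0].
Qed.

End Along.

Lemma primediv_irred (E : primediv X) : irred_closed (val E) /\ val E `<=` pts X.
Proof. by have [] := asboolP _ (valP E). Qed.

Lemma primediv_max (E : primediv X) V : irred_closed V -> val E `<=` V ->
  V `<=` pts X -> V <> pts X -> V = val E.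
Proof. by have [_ _ _ Emax] := asboolP _ (valP E) => Vi EV VX VneqX; have [] := Emax V Vi EV VX. Qed.

(** A prime divisor inside [T] lies in an irreducible piece of [T], a proper subset of X, and equals
    it by maximality. [pmap insub] retains the pieces that are prime divisors. *)
Lemma finite_primedivs T : zclosed T -> T `<=` pts X -> T <> pts X ->
  exists L : seq (primediv X), forall E, val E `<=` T -> E \in L.
Proof.
move=> Tc TX TneqX; have [L LP Lc] := irreducible_components Tc.
exists (pmap insub L) => E ET.
have [Eirr EX] := primediv_irred E.
have [V VL EV] : exists2 V, V \in L & val E `<=` V.
  by apply: irred_sub_cover => // [V /LP[/irred_closedP[]]|x /ET/Lc].
have [Virr VT] := LP V VL.
rewrite mem_pmap_sub; suff <- : V = val E by [].
apply: primediv_max => //; first exact: subset_trans VT TX.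
by move=> VX; apply: TneqX; apply/seteqP; split=> //; rewrite -VX.
Qed.

Implicit Types D : wdiv X.

Lemma is_divM phi psi D E : is_div phi D -> is_div psi E -> is_div (phi * psi) (D + E).
Proof.
move=> [p0 pD] [q0 qE]; split=> [|Y]; first exact: (mulf_neq0 p0 q0).
have [Yirr YX] := primediv_irred Y.
by rewrite /wcoef coeffD; exact: has_ordM.
Qed.

Lemma is_divV phi D : is_div phi D -> is_div phi^-1 (- D).
Proof.
move=> [p0 pD]; split=> [|Y]; first exact: (invr_neq0 p0).
by rewrite /wcoef coeffN; exact: has_ordV.
Qed.

Lemma is_div1 : is_div (1 : funfield X) 0.
Proof.
split=> [|Y]; first exact: oner_neq0.
by rewrite /wcoef coeff0; have [Yi _] := primediv_irred Y; exact: has_ord1.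
Qed.

Lemma principal0 : principal (0 : wdiv X).
Proof. by exists 1; exact: is_div1. Qed.

Lemma principalN D : principal D -> principal (- D).
Proof. by move=> [phi /is_divV]; exists phi^-1. Qed.

Lemma principalD D E : principal D -> principal E -> principal (D + E).
Proof. by move=> [phi pD] [psi qE]; exists (phi * psi); exact: is_divM. Qed.

Lemma principalB D E : principal D -> principal E -> principal (D - E).
Proof. by move=> pD /principalN; exact: principalD. Qed.

Lemma is_div_section phi D : is_div phi D -> global_section (- D) phi.
Proof. by move=> [_ pD] Y; rewrite /wcoef coeffN opprK; have [] := pD Y. Qed.

Lemma dclass0 : dclass (0 : wdiv X) = 0.
Proof. exact: raddf0. Qed.

Lemma dclassD D E : dclass (D + E) = dclass D + dclass E.
Proof. exact: raddfD. Qed.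

Lemma dclassB D E : dclass (D - E) = dclass D - dclass E.
Proof. exact: raddfB. Qed.

(** Principal divisors are already a subgroup, so the generated subgroup in the definition of [Cl]
    is no larger. *)
Lemma dclass_eq D E : dclass D = dclass E <-> principal (D - E).
Proof.
have eqE : (dclass D == dclass E) = (D - E \in subgroup_gen (@principal K n X)).
  exact: eqmodE.
split=> [/eqP|pDE].
  rewrite eqE => /asboolP[s [sP ->]].
  rewrite big_seq; elim/big_ind: _ => [||c /sP]; first exact: principal0.
    exact: principalD.
  have pMn (F : wdiv X) i : principal F -> principal (F *+ i).
    by move=> pF; elim: i => [|i IH]; [rewrite mulr0n; exact: principal0|rewrite mulrS; exact: principalD].
  case: c => -[i|i] F /= pF; first exact: pMn.
  by rewrite NegzE mulrNz; apply/principalN/pMn.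
apply/eqP; rewrite eqE; apply/asboolP; exists [:: (1, D - E)].
by rewrite big_seq1 /= mulr1z; split=> // c; rewrite inE => /eqP->.
Qed.

End Orders.

(** * Universal properties of the quotients *)

Section Quotients.

Lemma zproj_eq (M : zmodType) (T : set M) x y :
  (zproj T x == zproj T y) = (x - y \in subgroup_gen T).
Proof. exact: eqmodE. Qed.

Lemma zproj_surj (M : zmodType) (T : set M) (w : zquot T) : exists m, zproj T m = w.
Proof. by exists (repr (w : Quotient.quot (subgroup_gen_zmod T))); exact: reprK. Qed.

Lemma rproj_surj (A : comPzRingType) (T : set A) (w : rquot T) : exists a, rproj T a = w.
Proof. by exists (rquot_repr w); exact: rquot_reprK. Qed.

Lemma subgroup_gen_ker (M N : zmodType) (T : set M) (f : {additive M -> N}) :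
  (forall x, T x -> f x = 0) -> forall x, x \in subgroup_gen T -> f x = 0.
Proof.
move=> fT x /asboolP[s [sT ->]]; rewrite raddf_sum big_seq big1 // => c /sT /fT fc.
by rewrite raddfMz fc mul0rz.
Qed.

Lemma ideal_gen_ker (A B : comPzRingType) (T : set A) (f : {rmorphism A -> B}) :
  (forall x, T x -> f x = 0) -> forall x, x \in ideal_gen T -> f x = 0.
Proof.
move=> fT x /asboolP[s [sT ->]]; rewrite rmorph_sum big_seq big1 // => c /sT /fT fc.
by rewrite rmorphM fc mulr0.
Qed.

Lemma ideal_gen_rel (A : comPzRingType) (T : set A) x : T x -> rproj T x = 0.
Proof.
move=> Tx; rewrite -(raddf0 (rproj T)); apply/eqP; rewrite rproj_eq subr0.
apply/asboolP; exists [:: (1, x)]; rewrite big_seq1 mul1r; split=> // c.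
by rewrite inE => /eqP->.
Qed.

Lemma subgroup_gen_rel (M : zmodType) (T : set M) x : T x -> zproj T x = 0.
Proof.
move=> Tx; rewrite -(raddf0 (zproj T)); apply/eqP; rewrite zproj_eq subr0.
apply/asboolP; exists [:: (1, x)]; rewrite big_seq1 mulr1z; split=> // c.
by rewrite inE => /eqP->.
Qed.

Lemma zquot_lift (M N : zmodType) (T : set M) (f : {additive M -> N}) :
  (forall x, T x -> f x = 0) ->
  exists g : {additive zquot T -> N}, forall x, g (zproj T x) = f x.
Proof.
move=> fT; have [g gP] := choice (@zproj_surj M T).
have fg x : f (g (zproj T x)) = f x.
  apply/eqP; rewrite -subr_eq0 -raddfB; apply/eqP; apply: subgroup_gen_ker fT _ _.
  by rewrite -zproj_eq gP.
have hB : zmod_morphism (fun w => f (g w)).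
  by move=> w v; rewrite -(gP w) -(gP v) -raddfB !fg raddfB.
by exists (additive_of hB) => x /=.
Qed.

Lemma rquot_lift (A B : comPzRingType) (T : set A) (f : {rmorphism A -> B}) :
  (forall x, T x -> f x = 0) ->
  exists g : {rmorphism rquot T -> B}, forall x, g (rproj T x) = f x.
Proof.
move=> fT; have [g gP] := choice (@rproj_surj A T).
have fg x : f (g (rproj T x)) = f x.
  apply/eqP; rewrite -subr_eq0 -raddfB; apply/eqP; apply: ideal_gen_ker fT _ _.
  by rewrite -rproj_eq gP.
have hB : zmod_morphism (fun w => f (g w)).
  by move=> w v; rewrite -(gP w) -(gP v) -raddfB !fg raddfB.
have hM : monoid_morphism (fun w => f (g w)).
  split; first by rewrite -(rmorph1 (rproj T)) fg rmorph1.
  move=> w v; rewrite -[in LHS](gP w) -[in LHS](gP v).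
  by rewrite -[_ * _](rmorphM (rproj T)) fg rmorphM.
by exists (rmorphism_of hB hM) => x /=.
Qed.

End Quotients.

(** * Functoriality of the group algebra *)

Section GroupAlgebraMap.
Variables (F F' : fieldType) (M M' : zmodType).
Variables (sigma : {rmorphism F -> F'}) (p : {additive M -> M'}).

Definition group_alg_map (s : group_alg F M) : group_alg F' M' :=
  \sum_(D <- dom s) gmon (sigma (gcoef D s)) (p D).

Lemma gmonD (G : fieldType) (N : zmodType) (a b : G) (D : N) :
  gmon (a + b) D = gmon a D + gmon b D.
Proof. by rewrite /gmon -freegUD. Qed.

Lemma gmon0 (G : fieldType) (N : zmodType) (D : N) : gmon (0 : G) D = 0.
Proof. exact: freegU0. Qed.

(** Enlarging the index list allows [s], [t] and [s + t] to be summed over the same list. *)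
Lemma group_alg_mapE (S : seq M) s : uniq S -> {subset dom s <= S} ->
  group_alg_map s = \sum_(D <- S) gmon (sigma (gcoef D s)) (p D).
Proof.
move=> uS sub; rewrite [RHS](bigID (mem (dom s))) /= addrC big1 ?add0r => [|D].
  rewrite -big_filter; apply/perm_big/uniq_perm; rewrite ?uniq_dom ?filter_uniq //.
  by move=> D; rewrite mem_filter; case: (boolP (D \in dom s)) => // /sub->.
by move=> /coeff_outdom; rewrite /gcoef => ->; rewrite rmorph0 gmon0.
Qed.

Lemma group_alg_mapD : {morph group_alg_map : s t / s + t}.
Proof.
move=> s t; pose S := undup (dom s ++ dom t).
have uS : uniq S by exact: undup_uniq.
have subs : {subset dom s <= S} by move=> D Ds; rewrite mem_undup mem_cat Ds.
have subt : {subset dom t <= S} by move=> D Dt; rewrite mem_undup mem_cat Dt orbT.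
have subst : {subset dom (s + t) <= S} by move=> D /domD_subset; rewrite mem_undup.
rewrite (group_alg_mapE uS subs) (group_alg_mapE uS subt) (group_alg_mapE uS subst).
by rewrite -big_split; apply: eq_bigr => D _; rewrite /gcoef coeffD rmorphD gmonD.
Qed.

Lemma group_alg_map_gmon a D : group_alg_map (gmon a D) = gmon (sigma a) (p D).
Proof.
rewrite (@group_alg_mapE [:: D]) //; first by rewrite big_seq1 gcoef_gmon eqxx.
move=> E; rewrite mem_dom -[coeff _ _]/(gcoef E (gmon a D)) gcoef_gmon inE [E == D]eq_sym.
by case: (D == E) => //; rewrite eqxx.
Qed.

Lemma group_alg_map0 : group_alg_map 0 = 0.
Proof. by rewrite /group_alg_map dom0 big_nil. Qed.

Lemma group_alg_mapM : {morph group_alg_map : s t / s * t}.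
Proof.
elim/group_alg_ind => [|s1 s2 H1 H2|a D] t.
- by rewrite !(mul0r, group_alg_map0).
- by rewrite mulrDl !group_alg_mapD mulrDl H1 H2.
elim/group_alg_ind: t => [|t1 t2 H1 H2|b E].
- by rewrite !(mulr0, group_alg_map0).
- by rewrite mulrDr !group_alg_mapD mulrDr H1 H2.
by rewrite [X in group_alg_map X]group_alg_mul_gmon !group_alg_map_gmon [RHS]group_alg_mul_gmon rmorphM raddfD.
Qed.

Lemma group_alg_map1 : group_alg_map 1 = 1.
Proof. by rewrite [X in group_alg_map X]/(gmon 1 0) group_alg_map_gmon rmorph1 raddf0. Qed.

End GroupAlgebraMap.

(** * Cox rings *)

Section CoxRingTheory.
Variables (K : closedFieldType) (n : nat) (X : projvar K n) (delta : cox_datum X).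
Implicit Types (phi psi : funfield X) (D E : wdiv X).

Local Notation grp := (cd_group delta).
Local Notation chi := (cd_char delta).

Lemma cd_groupN D : grp D -> grp (- D).
Proof. by move=> gD; rewrite -sub0r; apply: cd_groupB gD; exact: cd_group0. Qed.

Lemma cd_char_neq0 E : grp E -> principal E -> chi E != 0.
Proof. by move=> gE pE; have [] := cd_char_div gE pE. Qed.

Lemma cd_char0 : chi 0 = 1.
Proof.
have g0 := cd_group0 delta; have p0 := principal0 X.
have c0 := cd_char_neq0 g0 p0.
by apply: (mulfI c0); rewrite mulr1 -(cd_charD g0 p0 g0 p0) addr0.
Qed.

Lemma cd_char_section E : grp E -> principal E -> global_section (- E) (chi E).
Proof. by move=> gE pE; exact: is_div_section (cd_char_div gE pE). Qed.

Lemma global_sectionD D phi psi :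
  global_section D phi -> global_section D psi -> global_section D (phi + psi).
Proof.
move=> pD qD; rewrite -[psi]opprK -[- psi]sub0r.
exact: (global_sectionB pD (global_sectionB (@global_section0 _ _ _ D) qD)).
Qed.

Lemma hsection_val D phi : grp D -> global_section D phi ->
  val (hsection delta phi D) = gmon phi D.
Proof.
move=> gD pD; have sD : is_section delta (gmon phi D) := is_section_gmon gD pD.
by rewrite /hsection val_insubd sD.
Qed.

Lemma sectionP (s : section_ring delta) D :
  global_section D (gcoef D (val s)) /\ (gcoef D (val s) != 0 -> grp D).
Proof. by have /asboolP := valP s. Qed.

Lemma sectionE (s : section_ring delta) :
  s = \sum_(D <- dom (val s)) hsection delta (gcoef D (val s)) D.
Proof.
apply: val_inj; rewrite raddf_sum /= {1}(group_algE (val s)).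
apply: eq_big_seq => D; rewrite mem_dom => sD.
by have [pD /(_ sD) gD] := sectionP s D; rewrite hsection_val.
Qed.

Lemma hsectionD D phi psi : grp D -> global_section D phi -> global_section D psi ->
  hsection delta (phi + psi) D = hsection delta phi D + hsection delta psi D.
Proof.
move=> gD pD qD; apply: val_inj.
rewrite [RHS]raddfD (hsection_val gD (global_sectionD pD qD)) gmonD.
by rewrite -(hsection_val gD pD) -(hsection_val gD qD).
Qed.

Lemma hsectionM D E phi psi : grp D -> grp E -> global_section D phi -> global_section E psi ->
  hsection delta (phi * psi) (D + E) = hsection delta phi D * hsection delta psi E.
Proof.
move=> gD gE pD qE; apply: val_inj.
rewrite (hsection_val (cd_groupD gD gE) (global_sectionM pD qE)) [RHS]rmorphM.
transitivity (gmon phi D * gmon psi E); first by rewrite [RHS]group_alg_mul_gmon.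
by rewrite -(hsection_val gD pD) -(hsection_val gE qE).
Qed.

Lemma hsection0 D : hsection delta 0 D = 0.
Proof. by apply: val_inj; rewrite /hsection val_insubd gmon0; case: ifP. Qed.

Lemma hsection1 : hsection delta 1 0 = 1.
Proof.
apply: val_inj.
by rewrite (hsection_val (cd_group0 delta) (@global_section1 _ _ X)).
Qed.

Lemma cox_sectionD D phi psi : grp D -> global_section D phi -> global_section D psi ->
  cox_section delta (phi + psi) D = cox_section delta phi D + cox_section delta psi D.
Proof. by move=> gD pD qD; rewrite /cox_section (hsectionD gD pD qD) raddfD. Qed.

Lemma cox_sectionM D E phi psi : grp D -> grp E -> global_section D phi -> global_section E psi ->
  cox_section delta (phi * psi) (D + E) = cox_section delta phi D * cox_section delta psi E.
Proof. by move=> gD gE pD qE; rewrite /cox_section (hsectionM gD gE pD qE) rmorphM. Qed.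

Lemma cox_section0 D : cox_section delta 0 D = 0.
Proof. by rewrite /cox_section hsection0 raddf0. Qed.

Lemma cox_section_sum I (r : seq I) (P : pred I) (F : I -> funfield X) D : grp D ->
  (forall i, P i -> global_section D (F i)) ->
  global_section D (\sum_(i <- r | P i) F i) /\
  cox_section delta (\sum_(i <- r | P i) F i) D = \sum_(i <- r | P i) cox_section delta (F i) D.
Proof.
move=> gD FD; elim: r => [|i r [IH1 IH2]].
  by rewrite !big_nil; split; [exact: global_section0|exact: cox_section0].
rewrite !big_cons; case: ifP => [Pi|_]; last by split.
by split; [exact: (global_sectionD (FD _ Pi) IH1)|rewrite (cox_sectionD gD (FD _ Pi) IH1) IH2].
Qed.

Lemma cox_section1 E : grp E -> principal E -> cox_section delta (chi E) (- E) = 1.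
Proof.
move=> gE pE; apply/eqP; rewrite eq_sym -subr_eq0; apply/eqP.
rewrite /cox_section -(rmorph1 (rproj (@cox_relation _ _ _ delta))) -raddfB.
by apply: ideal_gen_rel; exists E.
Qed.

Lemma global_section_shift D D0 phi : grp (D - D0) -> principal (D - D0) ->
  global_section D phi -> global_section D0 (phi * chi (D - D0)).
Proof.
move=> gE pE pD; have := global_sectionM pD (cd_char_section gE pE).
by rewrite opprB addrCA subrr addr0.
Qed.

(** Multiplication by the section [chi (D - D0)] of [D0 - D], which is 1 in the Cox ring. *)
Lemma cox_section_shift D D0 phi : grp D -> grp D0 -> principal (D - D0) ->
  global_section D phi ->
  cox_section delta phi D = cox_section delta (phi * chi (D - D0)) D0.
Proof.
move=> gD gD0 pE pD; have gE := cd_groupB gD gD0.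
rewrite -[LHS]mulr1 -(cox_section1 gE pE).
rewrite -(cox_sectionM gD (cd_groupN gE) pD (cd_char_section gE pE)).
by rewrite opprB addrCA subrr addr0.
Qed.

Lemma cox_decomp (r : cox_ring delta) : exists (S : seq (wdiv X)) (phi : wdiv X -> funfield X),
  [/\ forall D, D \in S -> grp D, forall D, global_section D (phi D) &
      r = \sum_(D <- S) cox_section delta (phi D) D].
Proof.
have [s <-] := rproj_surj r.
exists (dom (val s)), (fun D => gcoef D (val s)); split.
- by move=> D; rewrite mem_dom; exact: (sectionP s D).2.
- by move=> D; exact: (sectionP s D).1.
by rewrite {1}(sectionE s) raddf_sum.
Qed.

End CoxRingTheory.

Lemma rquot_lift_additive (A : comPzRingType) (N : zmodType) (T : set A)
    (f : {additive A -> N}) : (forall x, x \in ideal_gen T -> f x = 0) ->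
  exists g : {additive rquot T -> N}, forall x, g (rproj T x) = f x.
Proof.
move=> fT; have [g gP] := choice (@rproj_surj A T).
have fg x : f (g (rproj T x)) = f x.
  by apply/eqP; rewrite -subr_eq0 -raddfB; apply/eqP/fT; rewrite -rproj_eq gP.
have hB : zmod_morphism (fun w => f (g w)).
  move=> w v; rewrite -[in LHS](gP w) -[in LHS](gP v).
  by rewrite -[_ - _](raddfB (rproj T)) fg raddfB.
by exists (additive_of hB) => x /=.
Qed.

Lemma sum_by_class (I W : eqType) (V : nmodType) (S : seq I) (ws : seq W) (cl : I -> W)
    (F : I -> V) : uniq ws -> (forall i, i \in S -> cl i \in ws) ->
  \sum_(i <- S) F i = \sum_(w <- ws) \sum_(i <- S | cl i == w) F i.
Proof.
move=> uws Sws; rewrite (exchange_big_dep predT) //= big_seq [RHS]big_seq.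
apply: eq_bigr => i /Sws iws; rewrite (eq_bigl (pred1 (cl i))) => [|w]; last exact: eq_sym.
by rewrite -big_filter filter_pred1_uniq // big_seq1.
Qed.

Section CoxGrading.
Variables (K : closedFieldType) (n : nat) (X : projvar K n) (delta : cox_datum X).
Implicit Types (phi psi : funfield X) (D E : wdiv X).

Local Notation grp := (cd_group delta).
Local Notation chi := (cd_char delta).

Section CoefficientAt.
Variables (D0 : wdiv X) (gD0 : grp D0).

(** The factor that turns a section of [D] into one of [D0], and 0 outside the class of [D0]. The
    regular module [^o] makes [fglift] multiply it by the coefficient. *)
Let weight D : (funfield X)^o :=
  if `[< grp D /\ principal (D - D0) >] then chi (D - D0) else 0.

(* Identifies the part of degree [dclass D0] with the sections of [D0] by dividing
   out [chi]; it annihilates the Cox relations. *)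
Let total (s : section_ring delta) : funfield X := fglift weight (val s).

Let total_zmod : zmod_morphism total.
Proof. by move=> s t; rewrite /total raddfB; exact: (lift_is_additive weight (val s) (val t)). Qed.

HB.instance Definition _ :=
  GRing.isZmodMorphism.Build (section_ring delta) (funfield X) total total_zmod.

Let total_hsection D phi : grp D -> global_section D phi ->
  total (hsection delta phi D) = phi * weight D.
Proof. by move=> gD pD; rewrite /total (hsection_val gD pD); exact: (liftU weight phi D). Qed.

(** The cocycle rule of the character; both sides vanish together since [E] is principal. It is the
    reason why [total] annihilates [1 - chi E] placed in degree [- E]. *)
Let weight_shift D E : grp D -> grp E -> principal E ->
  weight D = chi E * weight (D - E).
Proof.
move=> gD gE pE; rewrite /weight.
have swap : D - E - D0 = D - D0 - E by rewrite addrAC.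
case: asboolP => [[_ pD]|nD].
  have pDE : grp (D - E) /\ principal (D - E - D0).
    by split; [exact: cd_groupB|rewrite swap; exact: principalB].
  rewrite (asboolT pDE) -cd_charD //; first by rewrite swap [E + _]addrC subrK.
    by apply: cd_groupB => //; exact: cd_groupB.
  by rewrite swap; exact: principalB.
rewrite asboolF ?mulr0 // => -[_ pDE]; apply: nD; split=> //.
by rewrite -[D - D0](subrK E) -swap; exact: principalD.
Qed.

Let total_relation s E : grp E -> principal E ->
  total (s * (1 - hsection delta (chi E) (- E))) = 0.
Proof.
move=> gE pE; rewrite (sectionE s) mulr_suml raddf_sum big_seq big1 // => D.
rewrite mem_dom => sD; have [pD /(_ sD) gD] := sectionP s D.
have gNE := cd_groupN gE; have cE := cd_char_section gE pE.
rewrite mulrBr mulr1 raddfB -(hsectionM gD gNE pD cE).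
rewrite [X in X - _](total_hsection gD pD).
rewrite [X in _ - X](total_hsection (cd_groupD gD gNE) (global_sectionM pD cE)).
by rewrite (weight_shift gD gE pE) mulrA subrr.
Qed.

(** Only additivity of the functional is claimed. It yields the embedding of sections of one divisor
    into the Cox ring and the independence of parts of different classes. *)
Lemma cox_coef_ex : exists c : {additive cox_ring delta -> funfield X},
  forall D phi, grp D -> global_section D phi ->
    c (cox_section delta phi D) =
    if `[< principal (D - D0) >] then phi * chi (D - D0) else 0.
Proof.
have [|c cP] := @rquot_lift_additive _ _ (@cox_relation _ _ _ delta) total.
  move=> _ /asboolP[s [sT ->]]; rewrite raddf_sum big_seq big1 // => d /sT[E [gE pE ->]].
  exact: total_relation.
exists c => D phi gD pD; rewrite /cox_section cP [LHS](total_hsection gD pD) /weight.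
have -> : `[< grp D /\ principal (D - D0) >] = `[< principal (D - D0) >].
  by apply/asbool_equiv_eq; split=> [[]|].
by case: asbool => //; rewrite mulr0.
Qed.

End CoefficientAt.

Lemma cox_section_eq0 D phi : grp D -> global_section D phi ->
  cox_section delta phi D = 0 -> phi = 0.
Proof.
move=> gD pD s0; have [c cP] := cox_coef_ex gD.
have := cP D phi gD pD; rewrite s0 raddf0 subrr asboolT; last exact: principal0.
by rewrite cd_char0 mulr1.
Qed.

(** All components in the class [w] can be shifted into the single representative [D] and added
    there, so homogeneous elements may be handled as single sections. *)
Lemma cox_partP D w (r : cox_ring delta) : grp D -> dclass D = w ->
  cox_part w r <-> exists2 phi, global_section D phi & r = cox_section delta phi D.
Proof.
move=> gD Dw; split=> [[s [sw ->]]|[phi pD ->]].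
  have sP E : E \in dom (val s) ->
      [/\ grp E, principal (E - D) & global_section E (gcoef E (val s))].
    rewrite mem_dom => sE; have [pE /(_ sE) gE] := sectionP s E.
    by split=> //; apply/dclass_eq; rewrite Dw; exact: sw.
  pose phi E := gcoef E (val s) * chi (E - D).
  have phiD E : E \in dom (val s) -> global_section D (phi E).
    by move=> /sP[gE pE sE]; exact: (global_section_shift (cd_groupB gE gD) pE sE).
  have [] := cox_section_sum (dom (val s)) (P := mem (dom (val s))) gD phiD.
  rewrite -!big_seq => sumD sumE; exists (\sum_(E <- dom (val s)) phi E) => //.
  rewrite sumE {1}(sectionE s) raddf_sum; apply: eq_big_seq => E /sP[gE pE sE].
  exact: (cox_section_shift gE gD pE sE).
exists (hsection delta phi D); split=> // E.
by rewrite (hsection_val gD pD) gcoef_gmon; case: (D =P E) => [<- //|_]; rewrite eqxx.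
Qed.

Lemma cd_group_class w : exists2 D, grp D & dclass D = w.
Proof.
have [D <-] := zproj_surj w; have [E gE ED] := cd_groupCl delta D.
by exists E.
Qed.

Lemma global_section_const c : global_section (0 : wdiv X) (constf X c).
Proof.
move=> Y t _; rewrite /wcoef coeff0 !oppr0 expr0z mulr1.
by have [Yi _] := primediv_irred Y; exact: regular_along_const.
Qed.

Lemma cox_graded : is_graded_algebra (cox_algebra delta).
Proof.
have g0 := cd_group0 delta; have cK := global_section_const.
have partB w (a b : cox_ring delta) : cox_part w a -> cox_part w b -> cox_part w (a - b).
  have [D gD Dw] := cd_group_class w.
  move=> /(cox_partP _ gD Dw)[phi pD ->] /(cox_partP _ gD Dw)[psi qD ->].
  apply/(cox_partP _ gD Dw); exists (phi - psi); first exact: (global_sectionB pD qD).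
  apply/eqP; rewrite subr_eq -(cox_sectionD gD (global_sectionB pD qD) qD).
  by rewrite subrK.
have part0 w : cox_part w (0 : cox_ring delta).
  have [D gD Dw] := cd_group_class w; apply/(cox_partP _ gD Dw).
  by exists 0; [exact: global_section0|rewrite cox_section0].
have partD w (a b : cox_ring delta) : cox_part w a -> cox_part w b -> cox_part w (a + b).
  by move=> wa wb; rewrite -[b]opprK -[- b]sub0r; exact: (partB _ _ _ wa (partB _ _ _ (part0 w) wb)).
split=> /=.
- split=> [a b|]; last split=> [|a b].
  + apply/eqP; rewrite eq_sym subr_eq -(cox_sectionD g0 (cK _) (cK _)).
    by rewrite constfB subrK.
  + by rewrite constf1 /cox_section hsection1 rmorph1.
  + by rewrite constfM -[in LHS](addr0 0) (cox_sectionM g0 g0 (cK a) (cK b)).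
- by move=> c; apply/(cox_partP _ g0); [exact: raddf0|exists (constf X c)].
- by move=> w; split; [exact: part0|exact: partB].
- move=> w v a b; have [D gD Dw] := cd_group_class w; have [E gE Ev] := cd_group_class v.
  move=> /(cox_partP _ gD Dw)[phi pD ->] /(cox_partP _ gE Ev)[psi qE ->].
  apply/(cox_partP _ (cd_groupD gD gE)); first by rewrite dclassD Dw Ev.
  by exists (phi * psi); [exact: (global_sectionM pD qE)|rewrite (cox_sectionM gD gE pD qE)].
split=> [r|s f us fP sum0 w ws].
  have [S [phi [gS pS ->]]] := cox_decomp r.
  exists (undup [seq dclass D | D <- S]).
  exists (fun w => \sum_(D <- S | dclass D == w) cox_section delta (phi D) D).
  split; last first.
    by apply: sum_by_class => [|D DS]; [exact: undup_uniq|rewrite mem_undup map_f].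
  move=> w; rewrite big_seq_cond; elim/big_ind: _ => [||D /andP[DS /eqP Dw]].
  - exact: part0.
  - exact: partD.
  by apply/(cox_partP _ (gS _ DS) Dw); exists (phi D).
have [D gD Dw] := cd_group_class w; have [c cP] := cox_coef_ex gD.
have [phi pD fw] := (cox_partP _ gD Dw).1 (fP w).
(* The functional at [D] kills the summands of other degrees, whose divisors are not equivalent to
   [D], and returns [phi] in degree [w]. *)
have := congr1 c sum0; rewrite raddf0 raddf_sum (bigD1_seq w) //= big1 ?addr0 => [|v vw].
  rewrite fw (cP D phi gD pD) subrr asboolT ?cd_char0 ?mulr1; last exact: principal0.
  by move=> ->; exact: cox_section0.
have [E gE Ev] := cd_group_class v.
have [psi qE ->] := (cox_partP _ gE Ev).1 (fP v).
rewrite (cP E psi gE qE) asboolF // => /dclass_eq; rewrite Ev Dw => /eqP.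
by rewrite (negPf vw).
Qed.

End CoxGrading.

(** * Graded isomorphisms from bijections *)

Section GradedMorphisms.
Variable K : fieldType.
Implicit Types A B : gr_algebra K.

Lemma gr_part_sum A m I (r : seq I) (P : pred I) (F : I -> gr_ring A) : is_graded_algebra A ->
  (forall i, P i -> gr_part m (F i)) -> gr_part m (\sum_(i <- r | P i) F i).
Proof.
move=> [_ _ Apart _ _] FP; have [p0 pB] := Apart m.
elim/big_ind: _ => // a b pa pb.
by rewrite -[b]opprK -[- b]sub0r; apply: (pB _ _ pa); exact: pB.
Qed.

(** The prescribed degree [m] is put into the index list; its component may be an empty sum. *)
Lemma graded_decomp A (m : gr_deg A) (a : gr_ring A) : is_graded_algebra A ->
  exists (s : seq (gr_deg A)) (f : gr_deg A -> gr_ring A),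
    [/\ uniq s, m \in s, forall m, gr_part m (f m) & a = \sum_(m <- s) f m].
Proof.
move=> Agr; have [_ _ _ _ [dec _]] := Agr.
have [s [f [fP ->]]] := dec a.
exists (undup (m :: s)), (fun w => \sum_(m <- s | m == w) f m); split.
- exact: undup_uniq.
- by rewrite mem_undup inE eqxx.
- by move=> w; apply: gr_part_sum => // i /eqP->.
by apply: sum_by_class => [|w ws]; [exact: undup_uniq|rewrite mem_undup inE ws orbT].
Qed.

(** Subtracting [a] from its component in degree [m] gives homogeneous-looking terms [h w] with sum
    0: their images lie in the degrees [psi' w]. Directness in [B] and injectivity then force
    [f m = a]. *)
Lemma graded_bij_iso A B (psi : {rmorphism gr_ring A -> gr_ring B})
    (psi' : {additive gr_deg A -> gr_deg B}) :
  graded_morphism psi psi' -> bijective psi -> bijective psi' ->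
  graded_isomorphism psi psi'.
Proof.
move=> psigr bij bij'; split=> // m a pa; have [Agr Bgr _ psiP] := psigr.
have [s [f [us ms fP aE]]] := graded_decomp m a Agr.
have [_ _ Bpart _ [_ Buniq]] := Bgr.
have [g psiK gK] := bij'.
pose h w := f w - (if w == m then a else 0).
have sumh : \sum_(w <- s) h w = 0.
  rewrite sumrB -aE (bigD1_seq m) //= eqxx big1 ?addr0 ?subrr // => w.
  by move=> /negPf->.
have hP w : gr_part (psi' w) (psi (h w)).
  rewrite rmorphB; apply: (Bpart _).2; first exact: psiP.
  by case: eqP => [->|_] //; rewrite rmorph0; exact: (Bpart _).1.
suff : h m = 0 by rewrite /h eqxx => /eqP; rewrite subr_eq0 => /eqP <-.
apply: (bij_inj bij); rewrite rmorph0.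
have := Buniq [seq psi' w | w <- s] (fun w => psi (h (g w))) _ _ _ (psi' m).
rewrite psiK; apply; last exact: map_f.
- by rewrite map_inj_uniq //; exact: bij_inj.
- by move=> v; have := hP (g v); rewrite gK.
rewrite big_map (eq_bigr (fun w => psi (h w))) => [|w _]; last by rewrite psiK.
by rewrite -rmorph_sum sumh rmorph0.
Qed.

End GradedMorphisms.

(** * Divisors under a modification *)

Lemma wdiv_support_ind (K : closedFieldType) (n : nat) (X : projvar K n)
    (P : wdiv X -> Prop) (Q : primediv X -> Prop) :
  P 0 -> (forall D E, P D -> P E -> P (D - E)) -> (forall Y, Q Y -> P (wprime Y)) ->
  forall D, (forall Y, wcoef D Y != 0 -> Q Y) -> P D.
Proof.
move=> P0 PB Pp D DQ; have PN E : P E -> P (- E) by move=> PE; rewrite -sub0r; exact: PB.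
have PD E F : P E -> P F -> P (E + F) by move=> PE PF; rewrite -[F]opprK; apply/PB/PN.
have Pn E i : P E -> P (E *+ i).
  by move=> PE; elim: i => [|i IH]; [rewrite mulr0n|rewrite mulrS; exact: PD].
rewrite -[D]freeg_sumE big_seq; elim/big_ind: _ => // Y; rewrite mem_dom => /DQ QY.
rewrite -[coeff Y D]intz -freegU_mulz; case: (coeff Y D) => i; first exact/Pn/Pp.
by rewrite NegzE mulrNz; apply/PN/Pn/Pp.
Qed.

Lemma wdiv_ind (K : closedFieldType) (n : nat) (X : projvar K n) (P : wdiv X -> Prop) :
  P 0 -> (forall D E, P D -> P E -> P (D - E)) -> (forall Y, P (wprime Y)) -> forall D, P D.
Proof.
by move=> P0 PB Pp D; apply: (@wdiv_support_ind _ _ _ P (fun=> True)) => // Y _; exact: Pp.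
Qed.

Section ModificationGeometry.
Variables (K : closedFieldType) (n2 n1 : nat).
Variables (X2 : projvar K n2) (X1 : projvar K n1).
Variable pi : pspace K n2 -> pspace K n1.
Hypothesis modpi : modification X2 X1 pi.
Variable C : set (pspace K n1).
Hypothesis centerC : center X2 X1 pi C.

Local Notation A := (pts X2 `\` pi @^-1` C).
Local Notation B := (pts X1 `\` C).

Lemma center_open_iso : exists rho, open_iso X2 X1 A B pi rho.
Proof.
have [piX pireg _] := modpi; have [Cc CX codimC [rho [piAB rhoBA regpi regrho]]] := centerC.
exists rho; apply: OpenIso.
- by move=> x [].
- by move=> y [].
- move=> x Xx [_ Cx].
  have [d [p [ph px pC]]] := open_in_preimage pireg piX (open_in_setC (A := pts X1) Cc) Xx Cx.
  by exists d, p; split=> // y Xy py; split=> //; exact: pC.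
- move=> y Xy [_ Cy]; have [d [p [ph py pC]]] := open_in_setC (A := pts X1) Cc Xy Cy.
  by exists d, p; split=> // z Xz pz; split=> //; exact: pC.
(* If [C] contained X1, the codimension condition applied to X1 itself would give a subset
   containing X1, contained in X1 and different from it. *)
- have [y By] : B !=set0.
    apply: contrapT => /forallNP B0.
    have XC : pts X1 `<=` C.
      by move=> y Xy; apply: contrapT => Cy; apply: (B0 y).
    have [Z [_ XZ ZX ZneqX _]] := codimC _ (pts_irred X1) XC.
    by apply: ZneqX; apply/seteqP.
  by exists (rho y); exact: (rhoBA y By).1.
- by move=> x /piAB[].
- by move=> y /rhoBA[].
- by move=> x /piAB[].
- by move=> y /rhoBA[].
- exact: regpi.
- exact: regrho.
Qed.

Variable rho : pspace K n1 -> pspace K n2.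
Hypothesis iso : open_iso X2 X1 A B pi rho.

(** The trace on [A] is dense in [Y] and [pi] is continuous on all of X2. This matches [push_prime],
    which uses the image of all of [Y], with the strict transform. *)
Lemma zclosure_image (Y : set (pspace K n2)) : irred_closed Y -> Y `<=` pts X2 ->
  Y `&` A !=set0 -> zclosure (pi @` Y) = strict_transform pi A Y.
Proof.
move=> Yirr YX YA; have [piX pireg _] := modpi.
apply/seteqP; split; last by apply: zclosureS => _ [x [Yx _] <-]; exists x.
apply: zclosure_sub; first exact: zclosure_zclosed.
move=> _ [x Yx <-]; apply/zclosureP => d p ph pA.
apply/eqP/negPn/negP => px.
have opx := open_inW YX (regular_map_continuous pireg ph).
have [_ [_ Yi]] := (irred_closedP Y).1 Yirr.
have [] := Yi _ _ opx (open_inW YX (iso_openl iso)) _ YA.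
  by exists x.
by move=> y [Yy [/= py Ay]]; rewrite pA ?eqxx // in py; exists y.
Qed.

(** A divisor meeting [A] has a prime divisor as strict transform; the image of any other lies in
    [C], where the codimension condition excludes prime divisors. *)
Lemma trace_exceptional (Y : primediv X2) : exceptional X1 pi Y <-> ~ (val Y `&` A !=set0).
Proof.
have [Yirr YX] := primediv_irred Y.
split=> [excY YA|YA pY].
  apply: excY; rewrite zclosure_image //; apply: (strict_transform_prime iso) => //.
  exact: (asboolP _ (valP Y)).
have [Cc CX codimC _] := centerC.
have YC : zclosure (pi @` val Y) `<=` C.
  apply: zclosure_sub => // _ [x Yx <-]; apply: contrapT => Cx; apply: YA.
  by exists x; split=> //; split=> //; exact: YX.
have [Yirr' _ _ Ymax] := pY.
have [Z [Zirr YZ ZX ZneqY ZneqX]] := codimC _ Yirr' YC.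
by have [] := Ymax Z Zirr YZ ZX.
Qed.

Lemma push_prime_exceptional (Y : primediv X2) :
  exceptional X1 pi Y -> push_prime X1 pi Y = 0.
Proof. by move=> exY; rewrite /push_prime; case: insubP => // Z /asboolP /exY. Qed.

(** A relation instead of a map, so that no value has to be invented for exceptional divisors. *)
Definition strict_pair (Y : primediv X2) (Z : primediv X1) : Prop :=
  val Y `&` A !=set0 /\ strict_transform pi A (val Y) = val Z.

Lemma strict_pair_ex (Y : primediv X2) :
  ~ exceptional X1 pi Y -> exists Z, strict_pair Y Z.
Proof.
move=> /trace_exceptional/contrapT YA.
have pZ : prime_divisor X1 (strict_transform pi A (val Y)).
  by apply: (strict_transform_prime iso) => //; exact: (asboolP _ (valP Y)).
by exists (exist (fun V => `[< prime_divisor X1 V >]) _ (asboolT pZ)).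
Qed.

(** No prime divisor of X1 lies in [C], so each has a strict transform under the inverse [rho]. *)
Lemma strict_pair_inv (Z : primediv X1) : exists Y, strict_pair Y Z.
Proof.
have [Zirr ZX] := primediv_irred Z; have isoV := open_iso_sym iso.
have ZB : val Z `&` B !=set0.
  apply: contrapT => ZB; have [Cc CX codimC _] := centerC.
  have ZC : val Z `<=` C.
    move=> y Zy; apply: contrapT => Cy; apply: ZB.
    by exists y; split=> //; split=> //; exact: ZX.
  have [V [Virr ZV VX VneqZ VneqX]] := codimC _ Zirr ZC.
  by apply: VneqZ; exact: (primediv_max Virr ZV VX VneqX).
have pY : prime_divisor X2 (strict_transform rho B (val Z)).
  by apply: (strict_transform_prime isoV) => //; exact: (asboolP _ (valP Z)).
exists (exist (fun V => `[< prime_divisor X2 V >]) _ (asboolT pY)); split.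
  exact: (strict_transform_meets isoV).
exact: (strict_transformK isoV).
Qed.

Lemma push_prime_strict Y Z : strict_pair Y Z -> push_prime X1 pi Y = wprime Z.
Proof.
move=> [YA YZ]; have [Yirr YX] := primediv_irred Y.
by rewrite /push_prime zclosure_image // YZ valK.
Qed.

Lemma strict_pair_nonexceptional Y Z : strict_pair Y Z -> ~ exceptional X1 pi Y.
Proof. by move=> [YA _] /trace_exceptional. Qed.

Lemma strict_pair_inj Y Y' Z : strict_pair Y Z -> strict_pair Y' Z -> Y = Y'.
Proof.
move=> [YA YZ] [YA' YZ']; apply: val_inj.
have [Yirr YX] := primediv_irred Y; have [Yirr' YX'] := primediv_irred Y'.
have := strict_transformK iso Yirr YX YA.
by rewrite -/(strict_transform pi A _) YZ -YZ' (strict_transformK iso Yirr' YX' YA').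
Qed.

Lemma pushforwardB : zmod_morphism (@pushforward K n2 n1 X2 X1 pi).
Proof. by move=> D E; exact: (lift_is_additive (@push_prime K n2 n1 X2 X1 pi)). Qed.

HB.instance Definition _ :=
  GRing.isZmodMorphism.Build (wdiv X2) (wdiv X1) (@pushforward K n2 n1 X2 X1 pi) pushforwardB.

Lemma wcoefB (n : nat) (X : projvar K n) (D E : wdiv X) Y :
  wcoef (D - E) Y = wcoef D Y - wcoef E Y.
Proof. exact: coeffB. Qed.

Lemma wcoef_prime (n : nat) (X : projvar K n) (Y Y' : primediv X) :
  wcoef (wprime Y) Y' = (Y == Y')%:R.
Proof. by rewrite /wcoef coeffU mul1r. Qed.

Lemma pushforward_prime (Y : primediv X2) : pushforward X1 pi (wprime Y) = push_prime X1 pi Y.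
Proof. by rewrite [LHS]liftU scale1r. Qed.

Lemma wdiv_eq (n : nat) (X : projvar K n) (D E : wdiv X) : wcoef D =1 wcoef E -> D = E.
Proof. by move=> DE; apply/eqP/freeg_eqP. Qed.

Lemma wcoef_pushforward Y Z D : strict_pair Y Z ->
  wcoef (pushforward X1 pi D) Z = wcoef D Y.
Proof.
move=> YZ; elim/wdiv_ind: D => [|D E HD HE|Y'].
- by rewrite raddf0 /wcoef !coeff0.
- by rewrite raddfB !wcoefB HD HE.
rewrite pushforward_prime wcoef_prime.
have [exY'|/strict_pair_ex[Z' YZ']] := pselect (exceptional X1 pi Y').
  rewrite push_prime_exceptional // /wcoef coeff0; case: eqP => // Y'Y.
  by case: (strict_pair_nonexceptional YZ); rewrite -Y'Y.
rewrite (push_prime_strict YZ') wcoef_prime; congr (_%:R); congr nat_of_bool.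
apply/eqP/eqP => [Z'Z|Y'Y]; first by apply: strict_pair_inj YZ' _; rewrite Z'Z.
by apply: val_inj; rewrite -YZ'.2 -YZ.2 Y'Y.
Qed.

Lemma pushforward_surj (D1 : wdiv X1) : exists D2 : wdiv X2, pushforward X1 pi D2 = D1.
Proof.
elim/wdiv_ind: D1 => [|_ _ [D <-] [E <-]|Z].
- by exists 0; rewrite raddf0.
- by exists (D - E); rewrite raddfB.
have [Y YZ] := strict_pair_inv Z; exists (wprime Y).
by rewrite pushforward_prime (push_prime_strict YZ).
Qed.

Definition exceptional_wdiv (D : wdiv X2) : Prop :=
  forall Y, wcoef D Y != 0 -> exceptional X1 pi Y.

Lemma pushforward_exceptional D : exceptional_wdiv D -> pushforward X1 pi D = 0.
Proof.
move=> exD; apply: wdiv_eq => Z; have [Y YZ] := strict_pair_inv Z.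
rewrite (wcoef_pushforward _ YZ) [RHS]coeff0; apply/eqP/negPn/negP => /exD.
exact: strict_pair_nonexceptional YZ.
Qed.

(** Exceptional prime divisors all lie in the proper closed subset of X2 above [C], so there are
    finitely many and arbitrary coefficients define a divisor. *)
Lemma exceptional_wdiv_ex (c : primediv X2 -> int) : exists F,
  exceptional_wdiv F /\ forall Y, exceptional X1 pi Y -> wcoef F Y = c Y.
Proof.
have [Cc CX codimC _] := centerC; have [piX pireg _] := modpi.
have [|||L LP] := @finite_primedivs _ _ X2 (pts X2 `&` pi @^-1` C).
- have [Xc _] := (irred_closedP _).1 (pts_irred X2).
  apply: (open_in_zclosed Xc) => [x []//|x Xx nx].
  have [||d [p [ph px pC]]] := iso_openl iso (x := x) => //.
    by split=> // Cx; apply: nx.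
  by exists d, p; split=> // y Xy py [_ Cy]; have [_] := pC y Xy py.
- by move=> x [].
- move=> XE; have [x [Xx Cx]] := iso_nonempty iso.
  by move: Xx; rewrite -XE => -[].
(* The list may have repetitions and further entries, hence [undup] and the filter. *)
pose F : wdiv X2 := \sum_(Y <- undup L | `[< exceptional X1 pi Y >]) << c Y *g Y >>.
have FE Y : wcoef F Y = if `[< exceptional X1 pi Y >] then c Y else 0.
  rewrite /wcoef /F raddf_sum /=.
  case: asboolP => [exY|nY]; last first.
    rewrite big1 // => Y' /asboolP exY'; rewrite coeffU; case: eqP => [Y'Y|_]; last by rewrite mulr0.
    by case: nY; rewrite -Y'Y.
  have YL : Y \in undup L.
    rewrite mem_undup; apply: LP => x Yx; have [_ YX] := primediv_irred Y.
    split; first exact: YX.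
    apply: contrapT => Cx; apply: ((trace_exceptional Y).1 exY).
    by exists x; split=> //; split=> //; exact: YX.
  rewrite big_mkcond (bigD1_seq Y) ?undup_uniq //= asboolT // coeffU eqxx mulr1.
  rewrite big1 ?addr0 // => Y' /negPf Y'Y; case: ifP => // _.
  by rewrite coeffU Y'Y mulr0.
exists F; split=> [Y|Y exY]; rewrite FE; last by rewrite asboolT.
by case: asboolP => // _; rewrite eqxx.
Qed.

End ModificationGeometry.

Section DivisorsUnderModification.
Variables (K : closedFieldType) (n2 n1 : nat).
Variables (X2 : projvar K n2) (X1 : projvar K n1).
Variable pi : pspace K n2 -> pspace K n1.
Hypothesis modpi : modification X2 X1 pi.
Variable C : set (pspace K n1).
Hypothesis centerC : center X2 X1 pi C.

Local Notation A := (pts X2 `\` pi @^-1` C).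
Local Notation B := (pts X1 `\` C).

Variable rho : pspace K n1 -> pspace K n2.
Hypothesis iso : open_iso X2 X1 A B pi rho.
Variable sigma : {rmorphism funfield X2 -> funfield X1}.
Hypothesis sigmaP : forall phi, same_function A pi phi (sigma phi).

Local Notation push := (@pushforward K n2 n1 X2 X1 pi).

Lemma same_restrictionP (phi : funfield X2) (psi : funfield X1) :
  same_function A pi phi psi -> same_restriction pi C phi psi.
Proof. by move=> s x Xx Cx; apply: s. Qed.

Lemma sigma_uniq (phi : funfield X2) (psi : funfield X1) : same_restriction pi C phi psi -> psi = sigma phi.
Proof.
move=> s; apply: (same_function_inj iso) (sigmaP phi).
by move=> x [Xx Cx]; exact: s.
Qed.

Lemma sigma_surj psi : exists phi, sigma phi = psi.
Proof.
have isoV := open_iso_sym iso.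
have [phi s] := same_function_ex isoV psi; exists phi.
exact: (same_function_inj iso (sigmaP phi) (same_functionV isoV s)).
Qed.

Section StrictPair.
Variables (Y : primediv X2) (Z : primediv X1).
Hypothesis YZ : strict_pair pi C Y Z.

Lemma regular_along_sigma phi :
  regular_along (val Z) (sigma phi) = regular_along (val Y) phi.
Proof.
have [YA <-] := YZ; have [Yirr YX] := primediv_irred Y.
apply/esym/propext; exact: (regular_along_transform iso Yirr YX YA (sigmaP phi)).
Qed.

Lemma uniformizer_sigma t : uniformizer (val Z) (sigma t) = uniformizer (val Y) t.
Proof.
rewrite /uniformizer fmorph_eq0 -fmorphV !regular_along_sigma.
apply/propext; split=> -[tY t0 tVY tmax]; split=> // s.
  have := tmax (sigma s); rewrite -fmorphV !regular_along_sigma => tmaxs sY /(tmaxs sY).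
  by rewrite -rmorphM regular_along_sigma.
(* Testing a uniformizer on X1 needs all functions of X1; surjectivity of [sigma] provides their
   counterparts on X2. *)
have [s' <-] := sigma_surj s; rewrite -fmorphV -rmorphM !regular_along_sigma.
exact: tmax.
Qed.

Lemma ord_ge_sigma phi k : ord_ge (val Z) (sigma phi) k <-> ord_ge (val Y) phi k.
Proof.
split=> pk t.
  rewrite -uniformizer_sigma => /pk.
  by rewrite -fmorphXz -rmorphM regular_along_sigma.
have [t' <-] := sigma_surj t; rewrite uniformizer_sigma => /pk.
by rewrite -fmorphXz -rmorphM regular_along_sigma.
Qed.

Lemma has_ord_sigma phi k : has_ord (val Z) (sigma phi) k <-> has_ord (val Y) phi k.
Proof.
split=> -[p0 pk pVk]; split.
- by rewrite fmorph_eq0 in p0.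
- exact/ord_ge_sigma.
- by rewrite -fmorphV in pVk; exact/ord_ge_sigma.
- by rewrite fmorph_eq0.
- exact/ord_ge_sigma.
- by rewrite -fmorphV; exact/ord_ge_sigma.
Qed.

End StrictPair.

Lemma is_div_push phi D : is_div phi D -> is_div (sigma phi) (push D).
Proof.
move=> [p0 pD]; split=> [|Z]; first by rewrite fmorph_eq0.
have [Y YZ] := strict_pair_inv centerC iso Z.
rewrite (wcoef_pushforward modpi centerC iso D YZ).
exact/(has_ord_sigma YZ).
Qed.

Lemma principal_push D : principal D -> principal (push D).
Proof. by move=> [phi /is_div_push]; exists (sigma phi). Qed.

Lemma global_section_push phi D : global_section D phi -> global_section (push D) (sigma phi).
Proof.
move=> pD Z; have [Y YZ] := strict_pair_inv centerC iso Z.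
by rewrite (wcoef_pushforward modpi centerC iso D YZ); apply/(ord_ge_sigma YZ).
Qed.

Lemma wcoefD (n : nat) (X : projvar K n) (D E : wdiv X) Y :
  wcoef (D + E) Y = wcoef D Y + wcoef E Y.
Proof. exact: coeffD. Qed.

Lemma exceptional_coefficient D F Y Z : exceptional_wdiv X1 pi F -> strict_pair pi C Y Z ->
  wcoef (D + F) Y = wcoef (push D) Z.
Proof.
move=> exF YZ; rewrite (wcoef_pushforward modpi centerC iso D YZ) wcoefD.
suff -> : wcoef F Y = 0 by rewrite addr0.
apply/eqP/negPn/negP => /exF; exact: (strict_pair_nonexceptional modpi centerC iso YZ).
Qed.

Lemma global_section_pull phi D : global_section (push D) (sigma phi) ->
  exists2 F, exceptional_wdiv X1 pi F & global_section (D + F) phi.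
Proof.
move=> pD.
have ordY (Y : primediv X2) : exists k, ord_ge (val Y) phi k.
  by have [Yirr YX] := primediv_irred Y; exact: ord_ge_ex.
have [c cP] := choice ordY.
(* With these coefficients, [- wcoef (D + F) Y] equals the lower bound [c Y] along every exceptional
   [Y]. *)
have [F [exF FE]] := exceptional_wdiv_ex modpi centerC iso (fun Y => - c Y - wcoef D Y).
exists F => // Y; have [exY|nexY] := pselect (exceptional X1 pi Y).
  by rewrite wcoefD FE // addrC subrK opprK.
have [Z YZ] := strict_pair_ex modpi centerC iso nexY.
by rewrite (exceptional_coefficient D exF YZ); apply/(ord_ge_sigma YZ).
Qed.

Lemma is_div_pull phi D : is_div (sigma phi) (push D) ->
  exists2 F, exceptional_wdiv X1 pi F & is_div phi (D + F).
Proof.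
move=> [p0 pD]; rewrite fmorph_eq0 in p0.
have ordY (Y : primediv X2) : exists k, has_ord (val Y) phi k.
  by have [Yirr YX] := primediv_irred Y; exact: has_ord_ex.
have [c cP] := choice ordY.
(* Here [D + F] must have exactly the order [c Y] of [phi] as coefficient at every exceptional
   [Y]. *)
have [F [exF FE]] := exceptional_wdiv_ex modpi centerC iso (fun Y => c Y - wcoef D Y).
exists F => //; split=> // Y; have [exY|nexY] := pselect (exceptional X1 pi Y).
  by rewrite wcoefD FE // addrC subrK.
have [Z YZ] := strict_pair_ex modpi centerC iso nexY.
by rewrite (exceptional_coefficient D exF YZ); apply/(has_ord_sigma YZ).
Qed.

Lemma principal_pull D : principal (push D) ->
  exists2 F, exceptional_wdiv X1 pi F & principal (D + F).
Proof.
move=> [psi pD]; have [phi phiE] := sigma_surj psi; rewrite -phiE in pD.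
by have [F exF DF] := is_div_pull pD; exists F => //; exists phi.
Qed.

End DivisorsUnderModification.

Lemma inj_surj_bijective (T U : Type) (f : T -> U) :
  injective f -> (forall u, exists t, f t = u) -> bijective f.
Proof.
move=> inj surj; have [g gK] := choice surj.
by exists g => // t; apply: inj; rewrite gK.
Qed.

(** * The grading of the quotient algebra *)

Section QuotientGrading.
Variables (K : fieldType) (A B : gr_algebra K) (I : Type).
Variables (f : I -> gr_ring A) (d : I -> gr_deg A).
Variables (psi : {rmorphism gr_ring (gr_quotient f d) -> gr_ring B}).
Variables (psi' : {additive gr_deg (gr_quotient f d) -> gr_deg B}).
Hypotheses (Agr : is_graded_algebra A) (Bgr : is_graded_algebra B).
Hypothesis psiP : forall u r, gr_part u r -> gr_part (psi' u) (psi r).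
Hypotheses (psi_inj : injective psi) (psi'_inj : injective psi').

(** Everything except directness descends from [A]. Directness is read off in [B], since [psi] and
    [psi'] are injective and respect degrees. *)
Lemma gr_quotient_graded : is_graded_algebra (gr_quotient f d).
Proof.
have [[Kz Km] K0 Apart AM [Adec Auniq]] := Agr.
have [_ _ _ _ [_ Buniq]] := Bgr.
split.
- split; [move=> a b|split=> [|a b]] => /=.
  + by rewrite Kz raddfB.
  + by rewrite Km.1 rmorph1.
  + by rewrite Km.2 rmorphM.
- move=> c; exists [:: gr_const A c]; rewrite big_seq1; split=> // a.
  by rewrite inE => /eqP->; exists 0; rewrite ?raddf0.
- move=> u; split; first by exists [::]; rewrite big_nil raddf0.
  move=> _ _ [s [sP ->]] [t [tP ->]]; exists (s ++ [seq - b | b <- t]); split.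
    move=> a; rewrite mem_cat => /orP[/sP //|/mapP[b /tP[m mu bm] ->]].
    by exists m => //; rewrite -sub0r; apply: (Apart m).2 => //; exact: (Apart m).1.
  by rewrite big_cat big_map sumrN raddfB.
- move=> u v _ _ [s [sP ->]] [t [tP ->]].
  exists [seq a * b | a <- s, b <- t]; split.
    move=> _ /allpairsP[[a b] /= [/sP[m mu am] /tP[k kv bk] ->]].
    by exists (m + k); [rewrite -mu -kv; exact: raddfD|exact: AM].
  rewrite big_allpairs_dep -rmorphM; congr (rproj _ _).
  by rewrite mulr_suml; apply: eq_bigr => a _; rewrite mulr_sumr.
split=> [r|s g us gP sum0 u us'].
  have [a <-] := rproj_surj r; have [s [g [gP ->]]] := Adec a.
  exists (undup [seq zproj (unit_degree d) m | m <- s]).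
  exists (fun u => rproj _ (\sum_(m <- s | zproj (unit_degree d) m == u) g m)); split.
    move=> u; exists [seq g m | m <- s & zproj (unit_degree d) m == u].
    rewrite big_map big_filter; split=> // b /mapP[m].
    by rewrite mem_filter => /andP[/eqP mu _] ->; exists m.
  rewrite -raddf_sum; congr (rproj _ _).
  by apply: sum_by_class => [|m ms]; [exact: undup_uniq|rewrite mem_undup map_f].
(* A left inverse of [psi'], with value 0 off the image. The family [k] on the degrees of [B] is
   therefore set to 0 there. *)
have [h hK] : exists h, cancel psi' h.
  have [|h hP] := @choice _ _ (fun v w => forall u, psi' u = v -> w = u).
    move=> v; have [[w <-]|nex] := pselect (exists w, psi' w = v).
      by exists w => w' /psi'_inj.
    by exists 0 => w wv; case: nex; exists w.
  by exists h => w; exact: hP.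
pose k v := if psi' (h v) == v then psi (g (h v)) else 0.
have kE w : k (psi' w) = psi (g w) by rewrite /k hK eqxx.
have kP v : gr_part v (k v).
  rewrite /k; case: (psi' (h v) =P v) => [hv|_].
    by have := psiP (gP (h v)); rewrite hv.
  by have [_ _ Bpart _ _] := Bgr; have [] := Bpart v.
apply: psi_inj; rewrite rmorph0 -kE.
apply: (Buniq [seq psi' w | w <- s] k) => //; last exact: map_f.
  by rewrite map_inj_uniq.
rewrite big_map (eq_bigr (fun w => psi (g w))) => [|w _]; last exact: kE.
by rewrite -rmorph_sum sum0 rmorph0.
Qed.

End QuotientGrading.

Section ExceptionalInduction.
Variables (K : closedFieldType) (n : nat) (X : projvar K n).

(** Closure under sums replaces closure under differences, as the section 1 is available in
    effective degrees. *)
Lemma effective_wdiv_ind (P : wdiv X -> Prop) (Q : primediv X -> Prop) :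
  P 0 -> (forall D E, P D -> P E -> P (D + E)) -> (forall Y, Q Y -> P (wprime Y)) ->
  forall D, (forall Y, wcoef D Y != 0 -> Q Y) -> (forall Y, (0 <= wcoef D Y)%R) -> P D.
Proof.
move=> P0 PD Pp D DQ D0.
have Pn E i : P E -> P (E *+ i).
  by move=> PE; elim: i => [|i IH]; [rewrite mulr0n|rewrite mulrS; exact: PD].
rewrite -[D]freeg_sumE big_seq; elim/big_ind: _ => // Y; rewrite mem_dom => /DQ QY.
rewrite -[coeff Y D]intz -freegU_mulz; have := D0 Y; rewrite /wcoef.
by case: (coeff Y D) => // i _; exact/Pn/Pp.
Qed.

Lemma effective_section D : (forall Y, (0 <= wcoef D Y)%R) -> global_section D (1 : funfield X).
Proof.
move=> D0 Y; have [Yirr YX] := primediv_irred Y; have [_ o1 _] := has_ord1 X Yirr.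
by apply: (ord_ge_le Yirr _ o1); rewrite Num.Theory.oppr_le0.
Qed.

End ExceptionalInduction.

(** * The push forward maps *)

Section PushForward.
Variables (K : closedFieldType) (n2 n1 : nat).
Variables (X2 : projvar K n2) (X1 : projvar K n1).
Variable pi : pspace K n2 -> pspace K n1.
Hypothesis modpi : modification X2 X1 pi.
Variable C : set (pspace K n1).
Hypothesis centerC : center X2 X1 pi C.

Local Notation A := (pts X2 `\` pi @^-1` C).
Local Notation B := (pts X1 `\` C).

Variable rho : pspace K n1 -> pspace K n2.
Hypothesis iso : open_iso X2 X1 A B pi rho.
Variable sigma : {rmorphism funfield X2 -> funfield X1}.
Hypothesis sigmaP : forall phi, same_function A pi phi (sigma phi).
Variables (delta1 : cox_datum X1) (delta2 : cox_datum X2).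
Hypothesis compat : compatible pi C delta2 delta1.

Local Notation push := (@pushforward K n2 n1 X2 X1 pi).
Local Notation excwdiv := (exceptional_wdiv X1 pi).
Local Notation grp2 := (cd_group delta2).
Local Notation grp1 := (cd_group delta1).

Lemma grp_push D : grp2 D -> grp1 (push D).
Proof. by have [gP _ _] := compat; exact: gP. Qed.

Lemma sigma_char E : grp2 E -> principal E ->
  sigma (cd_char delta2 E) = cd_char delta1 (push E).
Proof. by have [_ cP _] := compat => gE pE; exact/esym/(sigma_uniq iso sigmaP)/cP. Qed.

Lemma grp_exceptional F : excwdiv F -> grp2 F.
Proof.
move=> exF; have [_ _ gE] := compat.
by apply: wdiv_support_ind exF => //; [exact: cd_group0|exact: cd_groupB].
Qed.

Lemma sigma_const c : sigma (constf X2 c) = constf X1 c.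
Proof. exact: (same_function_inj iso (sigmaP _) (same_function_const iso c)). Qed.

Lemma push_class_ex : exists pi_Cl : {additive Cl X2 -> Cl X1},
  forall D, pi_Cl (dclass D) = dclass (push D).
Proof.
have fB : zmod_morphism (fun D : wdiv X2 => dclass (push D)).
  by move=> D E /=; rewrite raddfB dclassB.
apply: (zquot_lift (T := @principal K n2 X2) (f := additive_of fB)) => D pD /=.
apply: (@subgroup_gen_rel _ (@principal K n1 X1)).
exact: (principal_push modpi centerC iso sigmaP pD).
Qed.

Lemma is_section_push (s : section_ring delta2) :
  is_section delta1 (group_alg_map sigma push (val s)).
Proof.
rewrite -[is_section _ _]/(_ \in is_section delta1).
rewrite /group_alg_map big_seq rpred_sum // => D.
rewrite mem_dom => sD; have [pD /(_ sD) gD] := sectionP s D.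
apply: is_section_gmon; first exact: grp_push.
exact: (global_section_push modpi centerC iso sigmaP pD).
Qed.

Definition push_section (s : section_ring delta2) : section_ring delta1 :=
  exist (fun t => is_section delta1 t) _ (is_section_push s).

Lemma push_section_zmod : zmod_morphism push_section.
Proof.
have pD : {morph push_section : s t / s + t}.
  by move=> s t; apply: val_inj; exact: group_alg_mapD.
by move=> s t; apply/eqP; rewrite eq_sym subr_eq -pD subrK.
Qed.

Lemma push_section_monoid : monoid_morphism push_section.
Proof.
split; first by apply: val_inj; exact: group_alg_map1.
by move=> s t; apply: val_inj; exact: group_alg_mapM.
Qed.

HB.instance Definition _ :=
  GRing.isZmodMorphism.Build _ _ push_section push_section_zmod.
HB.instance Definition _ :=
  GRing.isMonoidMorphism.Build _ _ push_section push_section_monoid.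

Lemma push_hsection D phi : grp2 D -> global_section D phi ->
  push_section (hsection delta2 phi D) = hsection delta1 (sigma phi) (push D).
Proof.
move=> gD pD; apply: val_inj.
rewrite (hsection_val (grp_push gD) (global_section_push modpi centerC iso sigmaP pD)).
by rewrite /= (hsection_val gD pD) group_alg_map_gmon.
Qed.

(** By [sigma_char], the relation attached to a principal [E] is sent to the one attached to
    [push E], so the map of section rings descends. *)
Lemma push_cox_ex : exists pi_R : {rmorphism cox_ring delta2 -> cox_ring delta1},
  forall D phi, grp2 D -> global_section D phi ->
    pi_R (cox_section delta2 phi D) = cox_section delta1 (sigma phi) (push D).
Proof.
pose toR1 : {rmorphism section_ring delta2 -> cox_ring delta1} :=
  @rproj _ (@cox_relation _ _ _ delta1) \o push_section.
have [|pi_R piP] := rquot_lift (T := @cox_relation _ _ _ delta2) (f := toR1).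
  move=> _ [E [gE pE ->]]; rewrite /toR1 /= push_section_zmod push_section_monoid.1.
  rewrite (push_hsection (cd_groupN gE) (cd_char_section gE pE)).
  apply: ideal_gen_rel; exists (push E).
  split; [exact: grp_push|exact: (principal_push modpi centerC iso sigmaP pE)|].
  by rewrite (sigma_char gE pE) raddfN.
exists pi_R => D phi gD pD.
by rewrite /cox_section piP /toR1 /= (push_hsection gD pD).
Qed.

End PushForward.

(** * Surjectivity, factorization and kernel *)

Section CoxPushForward.
Variables (K : closedFieldType) (n2 n1 : nat).
Variables (X2 : projvar K n2) (X1 : projvar K n1).
Variable pi : pspace K n2 -> pspace K n1.
Hypothesis modpi : modification X2 X1 pi.
Variable C : set (pspace K n1).
Hypothesis centerC : center X2 X1 pi C.

Local Notation A := (pts X2 `\` pi @^-1` C).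
Local Notation B := (pts X1 `\` C).

Variable rho : pspace K n1 -> pspace K n2.
Hypothesis iso : open_iso X2 X1 A B pi rho.
Variable sigma : {rmorphism funfield X2 -> funfield X1}.
Hypothesis sigmaP : forall phi, same_function A pi phi (sigma phi).
Variables (delta1 : cox_datum X1) (delta2 : cox_datum X2).
Hypothesis compat : compatible pi C delta2 delta1.

Local Notation push := (@pushforward K n2 n1 X2 X1 pi).
Local Notation exc := (@exceptional K n2 n1 X2 X1 pi).
Local Notation excwdiv := (@exceptional_wdiv K n2 n1 X2 X1 pi).
Local Notation grp2 := (cd_group delta2).
Local Notation grp1 := (cd_group delta1).

Variable pi_Cl : {additive Cl X2 -> Cl X1}.
Hypothesis pi_ClP : forall D, pi_Cl (dclass D) = dclass (push D).
Variable pi_R : {rmorphism cox_ring delta2 -> cox_ring delta1}.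
Hypothesis pi_RP : forall D phi, grp2 D -> global_section D phi ->
  pi_R (cox_section delta2 phi D) = cox_section delta1 (sigma phi) (push D).

Lemma push_class_surj w : exists v, pi_Cl v = w.
Proof.
have [D1 <-] := zproj_surj w; have [D2 <-] := pushforward_surj modpi centerC iso D1.
by exists (dclass D2); rewrite pi_ClP.
Qed.

Lemma push_cox_part w r : cox_part w r -> cox_part (pi_Cl w) (pi_R r).
Proof.
have [D gD Dw] := cd_group_class delta2 w.
move=> /(cox_partP _ gD Dw)[phi pD ->]; rewrite (pi_RP gD pD).
apply/(cox_partP _ (grp_push compat gD)); first by rewrite -pi_ClP Dw.
exists (sigma phi) => //; exact: (global_section_push modpi centerC iso sigmaP pD).
Qed.

Lemma push_cox_graded :
  @graded_morphism K (cox_algebra delta2) (cox_algebra delta1) pi_R pi_Cl.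
Proof.
split; [exact: cox_graded|exact: cox_graded| |exact: push_cox_part].
move=> c /=; rewrite (pi_RP (cd_group0 delta2) (@global_section_const _ _ X2 c)).
by rewrite (sigma_const iso sigmaP) raddf0.
Qed.

Lemma push_add_exceptional D F : excwdiv F -> push (D + F) = push D.
Proof. by move=> exF; rewrite raddfD /= (pushforward_exceptional modpi centerC iso exF) addr0. Qed.

(* Move [phi] to the degree [push D2] for some [D2] in the group of [delta2];
   its preimage under [sigma] then has the right order along all non-exceptional
   divisors, and exceptional divisors may be added to [D2]. *)
Lemma push_cox_section_surj D phi : grp1 D -> global_section D phi ->
  exists s, pi_R s = cox_section delta1 phi D.
Proof.
move=> gD pD; have [D' D'E] := pushforward_surj modpi centerC iso D.
have [D2 gD2 D2E] := cd_groupCl delta2 D'.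
have pE : principal (D - push D2).
  by apply/dclass_eq; rewrite -D'E -!pi_ClP D2E.
have gpD2 := grp_push compat gD2.
rewrite (cox_section_shift gD gpD2 pE pD).
have pD2 := global_section_shift (cd_groupB gD gpD2) pE pD.
have [phi2 phi2E] := sigma_surj iso sigmaP (phi * cd_char delta1 (D - push D2)).
rewrite -phi2E in pD2 *.
have [F exF pF] := global_section_pull modpi centerC iso sigmaP pD2.
exists (cox_section delta2 phi2 (D2 + F)).
rewrite (pi_RP (cd_groupD gD2 (grp_exceptional compat exF)) pF).
by rewrite (push_add_exceptional D2 exF).
Qed.

Lemma push_cox_surj r : exists s, pi_R s = r.
Proof.
have [S [phi [gS pS ->]]] := cox_decomp r.
rewrite big_seq; elim/big_ind: _ => [|_ _ [s <-] [t <-]|D /gS gD].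
- by exists 0; rewrite rmorph0.
- by exists (s + t); rewrite rmorphD.
exact: push_cox_section_surj.
Qed.

Variables (l : nat) (E : 'I_l -> primediv X2).
Hypothesis EP : forall Y, exc Y <-> exists i, Y = E i.

Let f (i : 'I_l) : gr_ring (cox_algebra delta2) := canonical_section delta2 (E i).
Let degf (i : 'I_l) : gr_deg (cox_algebra delta2) := dclass (wprime (E i)).
Local Notation quo := (rproj (unit_relation f)).

Lemma exc_canonical i : exceptional X1 pi (E i).
Proof. by apply/EP; exists i. Qed.

Lemma wprime_exceptional Y : exc Y -> excwdiv (wprime Y).
Proof. by move=> exY Y'; rewrite wcoef_prime; case: (Y =P Y') => [<- //|_]; rewrite eqxx. Qed.

Lemma wprime_effective (Y Y' : primediv X2) : (0 <= wcoef (wprime Y) Y')%R.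
Proof. by rewrite wcoef_prime; case: eqP. Qed.

(** The canonical section is 1 in degree [E i]; its push forward is 1 in degree 0, since exceptional
    divisors push forward to 0. *)
Lemma push_cox_factor : exists psi : {rmorphism gr_ring (gr_quotient f degf) -> cox_ring delta1},
  forall r, psi (quo r) = pi_R r.
Proof.
apply: (@rquot_lift _ _ (unit_relation f) pi_R) => _ [i ->].
have exE := wprime_exceptional (@exc_canonical i).
rewrite rmorphB rmorph1 /f /canonical_section.
rewrite (pi_RP (grp_exceptional compat exE) (effective_section (wprime_effective _))).
rewrite rmorph1 (pushforward_exceptional modpi centerC iso exE).
by rewrite /cox_section hsection1 rmorph1 subrr.
Qed.

Lemma push_class_factor : exists psi' : {additive gr_deg (gr_quotient f degf) -> Cl X1},
  forall w, psi' (zproj (unit_degree degf) w) = pi_Cl w.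
Proof.
apply: (@zquot_lift _ _ (unit_degree degf) pi_Cl) => _ [i ->].
have exE := wprime_exceptional (@exc_canonical i).
by rewrite /degf pi_ClP (pushforward_exceptional modpi centerC iso exE) dclass0.
Qed.

Lemma zproj_exceptional F : excwdiv F -> zproj (unit_degree degf) (dclass F) = 0.
Proof.
move=> exF; pose P F := zproj (unit_degree degf) (dclass F) = 0.
suff : P F by [].
apply: (@wdiv_support_ind _ _ _ P exc) => // [|D D' D0 D'0|Y /EP[i ->]].
- by rewrite /P dclass0 raddf0.
- by rewrite /P dclassB [LHS]raddfB [X in X - _]D0 [X in _ - X]D'0 subr0.
by apply: subgroup_gen_rel; exists i.
Qed.

(** A divisor with principal push forward is principal up to an exceptional divisor, and exceptional
    classes vanish in the quotient. *)
Lemma zproj_push_inj w : pi_Cl w = 0 -> zproj (unit_degree degf) w = 0.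
Proof.
have [D <-] := zproj_surj w; rewrite -/(dclass D) pi_ClP => D0.
have /dclass_eq : dclass (push D) = dclass 0 by rewrite D0 dclass0.
rewrite subr0 => /(principal_pull modpi centerC iso sigmaP)[F exF pF].
have : dclass (D + F) = dclass 0 by apply/dclass_eq; rewrite subr0.
rewrite dclassD dclass0 => /(congr1 (zproj (unit_degree degf))).
by rewrite raddfD raddf0 [X in _ + X](zproj_exceptional exF) addr0.
Qed.

(** The section 1 of an effective exceptional divisor is a product of canonical sections. *)
Lemma quo_exceptional F : excwdiv F -> (forall Y, (0 <= wcoef F Y)%R) ->
  quo (cox_section delta2 1 F) = 1.
Proof.
move=> exF F0.
(* Group membership and the section condition are carried along because multiplicativity of
   [cox_section] requires them. *)
pose P F := [/\ grp2 F, global_section F (1 : funfield X2) & quo (cox_section delta2 1 F) = 1].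
suff [] : P F by [].
apply: effective_wdiv_ind exF F0.
- split; [exact: cd_group0|exact: global_section1|].
  by rewrite /cox_section hsection1 !rmorph1.
- move=> D D' [gD pD D1] [gD' pD' D1']; split; first exact: cd_groupD.
    by rewrite -[1]mulr1; exact: global_sectionM.
  rewrite -[X in cox_section _ X _]mulr1 (cox_sectionM gD gD' pD pD').
  by rewrite [LHS]rmorphM [X in X * _]D1 [X in _ * X]D1' mulr1.
move=> Y exY; have [i Yi] := (EP Y).1 exY; split.
- exact: (grp_exceptional compat (wprime_exceptional exY)).
- exact: (effective_section (wprime_effective Y)).
apply/eqP; rewrite -subr_eq0 -(rmorph1 quo) -raddfB; apply/eqP.
by apply: ideal_gen_rel; exists i; rewrite Yi.
Qed.

Lemma quo_add_exceptional D phi F : grp2 D -> global_section D phi ->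
  excwdiv F -> (forall Y, (0 <= wcoef F Y)%R) ->
  global_section (D + F) phi /\
  quo (cox_section delta2 phi (D + F)) = quo (cox_section delta2 phi D).
Proof.
move=> gD pD exF F0; have gF := grp_exceptional compat exF.
have F1 := effective_section F0.
split; first by rewrite -[phi]mulr1; exact: global_sectionM.
rewrite -[X in cox_section _ X (_ + _)]mulr1 (cox_sectionM gD gF pD F1).
by rewrite [LHS]rmorphM [X in _ * X](quo_exceptional exF F0) mulr1.
Qed.

(* If [push D] and [push D0] are equivalent then so are [D] and [D0] up to
   exceptional divisors, and the effective ones are invisible in the quotient. *)
Lemma quo_move D D0 phi : grp2 D -> grp2 D0 -> global_section D phi ->
  dclass (push D) = dclass (push D0) ->
  exists F psi, [/\ excwdiv F, forall Y, (0 <= wcoef F Y)%R, global_section (D0 + F) psi &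
    quo (cox_section delta2 phi D) = quo (cox_section delta2 psi (D0 + F))].
Proof.
move=> gD gD0 pD /dclass_eq; rewrite -raddfB => /(principal_pull modpi centerC iso sigmaP).
move=> [G exG pG].
(* Absolute values make both [F] and [G + F] effective; [D + (G + F)] and [D0 + F] still differ by
   the principal divisor [D - D0 + G]. *)
have [F [exF FE]] := exceptional_wdiv_ex modpi centerC iso (fun Y => `|wcoef G Y|%R).
have F0 Y : (0 <= wcoef F Y)%R.
  have [/FE ->|nexY] := pselect (exc Y); first exact: Num.Theory.normr_ge0.
  by case: (eqVneq (wcoef F Y) 0) => [->|/exF].
have exGF : excwdiv (G + F).
  move=> Y; have [//|nexY] := pselect (exc Y); rewrite wcoefD.
  have G0 : wcoef G Y = 0 by apply/eqP/negPn/negP => /exG.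
  by have -> : wcoef F Y = 0; [apply/eqP/negPn/negP => /exF|rewrite G0 addr0 eqxx].
have GF0 Y : (0 <= wcoef (G + F) Y)%R.
  rewrite wcoefD; have [/FE ->|nexY] := pselect (exc Y).
    by rewrite -Num.Theory.lerBlDl sub0r -Num.Theory.normrN Num.Theory.ler_norm.
  by have -> : wcoef G Y = 0; [apply/eqP/negPn/negP => /exG|rewrite add0r].
have gF := grp_exceptional compat exF; have gGF := grp_exceptional compat exGF.
have [pGF quoE] := quo_add_exceptional gD pD exGF GF0.
have DE : D + (G + F) - (D0 + F) = D - D0 + G.
  by rewrite opprD addrACA addrK.
have pE : principal (D + (G + F) - (D0 + F)) by rewrite DE.
have gDGF := cd_groupD gD gGF; have gD0F := cd_groupD gD0 gF.
exists F, (phi * cd_char delta2 (D + (G + F) - (D0 + F))); split; [exact: exF|exact: F0| |].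
  exact: (global_section_shift (cd_groupB gDGF gD0F) pE pGF).
apply: (etrans (esym quoE)).
exact: (congr1 _ (cox_section_shift gDGF gD0F pE pGF)).
Qed.

(** The terms arrive in degrees [D0 + F1] and [D0 + F2]; as [F1] and [F2] are effective, both can be
    moved to [D0 + (F1 + F2)] and added there. *)
Lemma quo_collect (S : seq (wdiv X2)) (phi : wdiv X2 -> funfield X2) D0 : grp2 D0 ->
  (forall D, D \in S -> [/\ grp2 D, global_section D (phi D) &
     dclass (push D) = dclass (push D0)]) ->
  exists F psi, [/\ excwdiv F, forall Y, (0 <= wcoef F Y)%R, global_section (D0 + F) psi &
    quo (\sum_(D <- S) cox_section delta2 (phi D) D) = quo (cox_section delta2 psi (D0 + F))].
Proof.
move=> gD0; elim: S => [|D S IH] SP.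
  exists 0, 0; split.
  - by move=> Y; rewrite /wcoef coeff0 eqxx.
  - by move=> Y; rewrite /wcoef coeff0.
  - exact: global_section0.
  by rewrite big_nil cox_section0 !raddf0.
have [|F2 [psi2 [exF2 F20 p2 q2]]] := IH; first by move=> D' D'S; apply: SP; rewrite inE D'S orbT.
have [gD pD cD] : [/\ grp2 D, global_section D (phi D) & dclass (push D) = dclass (push D0)].
  by apply: SP; rewrite inE eqxx.
have [F1 [psi1 [exF1 F10 p1 q1]]] := quo_move gD gD0 pD cD.
have g1 := cd_groupD gD0 (grp_exceptional compat exF1).
have g2 := cd_groupD gD0 (grp_exceptional compat exF2).
have [p1' q1'] := quo_add_exceptional g1 p1 exF2 F20.
have [p2' q2'] := quo_add_exceptional g2 p2 exF1 F10.
rewrite -addrA in p1' q1'; rewrite -addrA [F2 + F1]addrC in p2' q2'.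
have exF : excwdiv (F1 + F2).
  move=> Y; have [//|nexY] := pselect (exc Y); rewrite wcoefD.
  have -> : wcoef F1 Y = 0 by apply/eqP/negPn/negP => /exF1.
  by rewrite add0r => /exF2.
exists (F1 + F2), (psi1 + psi2); split; first exact: exF.
- by move=> Y; rewrite wcoefD Num.Theory.addr_ge0.
- exact: (global_sectionD p1' p2').
have gF := cd_groupD gD0 (grp_exceptional compat exF).
have quoD a b : quo (a + b) = quo a + quo b by exact: (raddfD quo).
rewrite big_cons (cox_sectionD gF p1' p2') !quoD.
exact: (etrans (f_equal2 +%R q1 q2) (esym (f_equal2 +%R q1' q2'))).
Qed.

(** Components are grouped by the class of their push forward, not by their class on X2. Directness
    on X1 makes each group push forward to 0, and each group is collected into one section. *)
Lemma quo_push_inj r : pi_R r = 0 -> quo r = 0.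
Proof.
have [S [phi [gS pS ->]]] := cox_decomp r.
pose cl D := dclass (push D).
pose ws := undup [seq cl D | D <- S].
pose part w := \sum_(D <- S | cl D == w) cox_section delta2 (phi D) D.
have partE : \sum_(D <- S) cox_section delta2 (phi D) D = \sum_(w <- ws) part w.
  by apply: sum_by_class => [|D DS]; [exact: undup_uniq|rewrite mem_undup map_f].
have pi_part w : cox_part w (pi_R (part w)).
  rewrite rmorph_sum big_seq_cond.
  apply: (@gr_part_sum _ (cox_algebra delta1)) => [|D /andP[DS /eqP Dw]]; first exact: cox_graded.
  have gD := gS _ DS; rewrite (pi_RP gD (pS D)).
  apply/(cox_partP _ (grp_push compat gD)) => //.
  exists (sigma (phi D)) => //; exact: (global_section_push modpi centerC iso sigmaP (pS D)).
have [_ _ _ _ [_ uniq1]] := cox_graded delta1.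
rewrite partE rmorph_sum => pi0.
have pi_part0 := uniq1 ws (fun w => pi_R (part w)) (undup_uniq _) pi_part pi0.
rewrite raddf_sum big_seq big1 // => w wws.
have := wws; rewrite mem_undup => /mapP[D0 D0S wE].
have [|F [psi [exF F0 pF quoE]]] := @quo_collect [seq D <- S | cl D == w] phi D0 (gS _ D0S).
  move=> D; rewrite mem_filter => /andP[/eqP clD DS].
  by split; [exact: gS|exact: pS|rewrite -/(cl D) clD wE].
rewrite big_filter -/(part w) in quoE.
have gF := cd_groupD (gS _ D0S) (grp_exceptional compat exF).
(* Equality in the quotient gives equality of the push forwards because [pi_R] factors through
   [quo]. *)
have psi_sigma : pi_R (part w) = pi_R (cox_section delta2 psi (D0 + F)).
  by have [chi chiP] := push_cox_factor; rewrite -!chiP quoE.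
have := pi_part0 w wws; rewrite psi_sigma (pi_RP gF pF) => /(cox_section_eq0 (grp_push compat gF)).
have spF := global_section_push modpi centerC iso sigmaP pF.
(* A homomorphism of fields is injective, so the vanishing of [sigma psi] gives that of [psi]. *)
move=> /(_ spF) /eqP; rewrite fmorph_eq0 => /eqP psi0.
by move: quoE; rewrite psi0 cox_section0 raddf0.
Qed.

Lemma cox_quotient_iso : exists (psi : {rmorphism gr_ring (gr_quotient f degf) ->
      gr_ring (cox_algebra delta1)})
    (psi_deg : {additive gr_deg (gr_quotient f degf) -> gr_deg (cox_algebra delta1)}),
  [/\ graded_morphism (gr_proj f degf) (gr_proj_deg f degf),
      graded_isomorphism psi psi_deg,
      forall r, pi_R r = psi (gr_proj f degf r) &
      forall w, pi_Cl w = psi_deg (gr_proj_deg f degf w)].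
Proof.
have [psi psiE] := push_cox_factor; have [psi' psi'E] := push_class_factor.
exists psi, psi'.
have psi_inj : injective psi.
  apply: raddf_inj => x; have [r <-] := rproj_surj x => psi0.
  exact: (quo_push_inj (etrans (esym (psiE r)) psi0)).
have psi'_inj : injective psi'.
  apply: raddf_inj => x; have [w <-] := zproj_surj x => psi0.
  exact: (zproj_push_inj (etrans (esym (psi'E w)) psi0)).
have gr1 := cox_graded delta1; have gr2 := cox_graded delta2.
have psiP u x : gr_part (A := gr_quotient f degf) u x ->
    gr_part (A := cox_algebra delta1) (psi' u) (psi x).
  move=> [s [sP ->]]; rewrite raddf_sum rmorph_sum big_seq; apply: gr_part_sum => // a.
  by move=> /sP[m <- am] /=; rewrite psiE psi'E; exact: push_cox_part.
(* Available only now, since the injectivity of both factor maps is an input. *)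
have grQ : is_graded_algebra (gr_quotient f degf).
  exact: (gr_quotient_graded gr2 gr1 psiP psi_inj psi'_inj).
split.
- split=> // m a am; exists [:: a]; rewrite big_seq1; split=> // b.
  by rewrite inE => /eqP->; exists m.
- apply: graded_bij_iso.
  + split=> // c; have [_ _ cE _] := push_cox_graded.
    by rewrite -cE; exact: psiE.
  + apply: inj_surj_bijective => // u; have [r <-] := push_cox_surj u.
    by exists (quo r); exact: psiE.
  apply: inj_surj_bijective => // u; have [w <-] := push_class_surj u.
  by exists (zproj (unit_degree degf) w); exact: psi'E.
- by move=> r; rewrite -psiE.
by move=> w; rewrite -psi'E.
Qed.

End CoxPushForward.

Theorem proposition2p2
  (K : closedFieldType) (charK : [pchar K] =i pred0)
  (n1 n2 : nat) (X1 : projvar K n1) (X2 : projvar K n2)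
  (normalX1 : normal_variety X1) (normalX2 : normal_variety X2)
  (fgCl1 : finitely_generated_group (Cl X1))
  (fgCl2 : finitely_generated_group (Cl X2))
  (pi : pspace K n2 -> pspace K n1) (modpi : modification X2 X1 pi)
  (C : set (pspace K n1)) (centerC : center X2 X1 pi C)
  (delta1 : cox_datum X1) (delta2 : cox_datum X2)
  (compat : compatible pi C delta2 delta1) :
  exists (pi_Cl : {additive gr_deg (cox_algebra delta2) ->
                            gr_deg (cox_algebra delta1)})
         (pi_R : {rmorphism gr_ring (cox_algebra delta2) ->
                            gr_ring (cox_algebra delta1)}),
    [/\ forall D : wdiv X2, pi_Cl (dclass D) = dclass (pushforward X1 pi D),
        forall w, exists v, pi_Cl v = w,
        graded_morphism pi_R pi_Cl,
        forall (D : wdiv X2) (phi2 : funfield X2),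
          cd_group delta2 D -> global_section D phi2 ->
          exists phi1 : funfield X1,
            [/\ same_restriction pi C phi2 phi1,
                global_section (pushforward X1 pi D) phi1 &
                pi_R (cox_section delta2 phi2 D) =
                  cox_section delta1 phi1 (pushforward X1 pi D)] &
        forall r, exists s, pi_R s = r] /\
    (finitely_generated_algebra (cox_algebra delta2) ->
     forall (l : nat) (E : 'I_l -> primediv X2),
       injective E ->
       (forall Y, exceptional X1 pi Y <-> exists i, Y = E i) ->
       let f (i : 'I_l) : gr_ring (cox_algebra delta2) :=
         canonical_section delta2 (E i) in
       let degf (i : 'I_l) : gr_deg (cox_algebra delta2) :=
         dclass (wprime (E i)) in
       exists (psi : {rmorphism gr_ring (gr_quotient f degf) ->
                                gr_ring (cox_algebra delta1)})
              (psi_deg : {additive gr_deg (gr_quotient f degf) ->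
                                   gr_deg (cox_algebra delta1)}),
         [/\ graded_morphism (gr_proj f degf) (gr_proj_deg f degf),
             graded_isomorphism psi psi_deg,
             forall r, pi_R r = psi (gr_proj f degf r) &
             forall w, pi_Cl w = psi_deg (gr_proj_deg f degf w)]).
Proof.
have [rho iso] := center_open_iso modpi centerC.
have [sigma sigmaP] := funfield_iso iso.
have [pi_Cl pi_ClP] := push_class_ex modpi centerC iso sigmaP.
have [pi_R pi_RP] := push_cox_ex modpi centerC iso sigmaP compat.
exists pi_Cl, pi_R; split; last first.
  move=> _ l E _ EP f degf.
  exact: (cox_quotient_iso modpi centerC iso sigmaP compat pi_ClP pi_RP EP).
split.
- exact: pi_ClP.
- exact: (push_class_surj modpi centerC iso pi_ClP).
- exact: (push_cox_graded modpi centerC iso sigmaP compat pi_ClP pi_RP).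
- move=> D phi gD pD; exists (sigma phi); split.
  + exact: (same_restrictionP (sigmaP phi)).
  + exact: (global_section_push modpi centerC iso sigmaP pD).
  exact: pi_RP.
exact: (push_cox_surj modpi centerC iso sigmaP compat pi_ClP pi_RP).
Qed.
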